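(* Let $n\ge 3$, let $Q^{n-1}=\{[z]\in\mathbb{P}^n : z_0^2+\dots+z_n^2=0\}\subset\mathbb{P}^n$ be the complex quadric, and let $\Gamma:\mathbb{P}^1\to Q^{n-1}$ be an embedded holomorphic curve. If $\zeta_{\mathbb{P}^n}(\Gamma(\mathbb{P}^1))\ge \frac{\pi}{4}$, where $\Gamma(\mathbb{P}^1)$ is regarded as a complex submanifold of $\mathbb{P}^n$, then $$\mathrm{Vol}\big(\Gamma(\mathbb{P}^1)\big) < \frac{\pi\, 2^{n}}{n-1}.$$
   Context: $\mathbb{P}^n$ denotes complex projective space of complex dimension $n$ with the Fubini-Study metric of constant holomorphic sectional curvature $4$. $\mathrm{Vol}$ is the volume (area) with respect to the metric induced from $\mathbb{P}^n$. For a submanifold $X\subset\mathbb{P}^n$ with normal bundle $\nu(X)$, a focal point of $X$ is a singularity of the normal exponential map $\nu(X)\to\mathbb{P}^n$, $r\xi(p)\mapsto \exp_p(r\xi(p))$ (with $\xi(p)$ a unit normal vector); equivalently, a focal point along the normal geodesic $C_\xi$ (where $C_\xi(0)=p\in X$, $C_\xi'(0)=\xi$) at distance $r$ is a point $C_\xi(r)$ for which there is a nonzero Jacobi field $Y$ along $C_\xi$, perpendicular to $C_\xi$, with $Y(0)\in T_pX$, $Y'(0)+A_{\xi}Y(0)\in\nu_p(X)$ and $Y(r)=0$, where $A_\xi$ is the shape operator of $X$. The minimal focal distance $\zeta_{\mathbb{P}^n}(X)$ is the smallest $r>0$ such that the tube of radius $r$ around $X$, $\{\exp(r\xi): \xi\text{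 a unit normal vector of }X\}$, contains a focal point of $X$ at distance $r$. *)

(* Defs.v *)
From HB Require Import structures.
From mathcomp Require Import all_boot all_order all_algebra.
From mathcomp Require Import all_classical all_reals all_analysis.
From mathcomp Require Import complex.

Set Implicit Arguments.
Unset Strict Implicit.
Unset Printing Implicit Defensive.

Import Order.TTheory GRing.Theory Num.Theory.
Import numFieldNormedType.Exports.

Local Open Scope classical_set_scope.
Local Open Scope ring_scope.
Local Open Scope complex_scope.

(* R[i] carries its normed-module structure over itself through the alias
   _^o; derivatives of maps defined on C R are thus complex derivatives. *)
Notation C R := ((R[i])^o).
Notation Cvec R n := ('rV[C R]_n.+1).

(* P^n: the complex lines through the origin of C^(n+1). *)
Definition proj_space (R : realType) (n : nat) :=
  {L : {vspace Cvec R n} | \dim L == 1%N}.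

Lemma dim_line0 (R : realType) (n : nat) :
  \dim <[delta_mx ord0 ord0 : Cvec R n]>%VS == 1%N.
Proof.
rewrite dim_vline eqb1; apply/eqP => /matrixP /(_ ord0 ord0) /eqP.
by rewrite !mxE !eqxx oner_eq0.
Qed.

(* [z_0 : ... : z_n]; an arbitrary point when z = 0. *)
Definition pt (R : realType) (n : nat) (z : Cvec R n) : proj_space R n :=
  insubd (exist _ <[delta_mx ord0 ord0 : Cvec R n]>%VS (dim_line0 R n)
           : proj_space R n) <[z]>%VS.

(* A (nonzero) vector of homogeneous coordinates of p. *)
Definition rep (R : realType) (n : nat) (p : proj_space R n) : Cvec R n :=
  vpick (val p).

(* The affine chart {z_j <> 0}, and the homogeneous coordinates of p
   normalised by z_j = 1, i.e. the affine coordinates z_k / z_j. *)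
Definition in_chart (R : realType) (n : nat) (j : 'I_n.+1)
    (p : proj_space R n) : bool :=
  rep p 0 j != 0.

Definition aff (R : realType) (n : nat) (j : 'I_n.+1) (p : proj_space R n)
    : Cvec R n :=
  (rep p 0 j)^-1 *: rep p.

Definition quadric (R : realType) (n : nat) : set (proj_space R n) :=
  [set p : proj_space R n | forall z : Cvec R n, z \in val p -> \sum_k z 0 k ^+ 2 = 0].

(* The quotient topology from C^(n+1) minus the origin. *)
Definition proj_open (R : realType) (n : nat) (A : set (proj_space R n)) :=
  open [set z : Cvec R n | z != 0 /\ A (pt z)].

(* The two affine parametrisations C -> P^1 : s |-> [1 : s], s |-> [s : 1]. *)
Definition param (R : realType) (i : 'I_2) (s : C R) : proj_space R 1 :=
  pt (\row_(k < 2) (if k == i then 1 else s)).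

(* f read in the i-th chart of P^1 and the j-th chart of P^n. *)
Definition local_expr (R : realType) (n : nat)
    (f : proj_space R 1 -> proj_space R n) (i : 'I_2) (j : 'I_n.+1)
    : C R -> Cvec R n :=
  fun s => aff j (f (param i s)).

Definition holomorphic (R : realType) (n : nat)
    (f : proj_space R 1 -> proj_space R n) :=
  forall (i : 'I_2) (j : 'I_n.+1) (s : C R), in_chart j (f (param i s)) ->
    (\forall t \near s, in_chart j (f (param i t))) /\
    derivable (local_expr f i j) s 1.

Definition immersion (R : realType) (n : nat)
    (f : proj_space R 1 -> proj_space R n) :=
  forall (i : 'I_2) (j : 'I_n.+1) (s : C R), in_chart j (f (param i s)) ->
    'D_1 (local_expr f i j) s != 0.

(* Injective immersion, homeomorphic onto its image. *)
Definition embedding (R : realType) (n : nat)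
    (f : proj_space R 1 -> proj_space R n) :=
  [/\ injective f, immersion f &
      forall U, proj_open U <-> exists2 V, proj_open V & U = f @^-1` V].

Definition hdot (R : realType) (n : nat) (z w : Cvec R n) : R[i] :=
  \sum_k z 0 k * (w 0 k)^*.

(* Hermitian projection onto the orthogonal complement of z; for z <> 0 its
   kernel is the kernel of the differential at z of C^(n+1) \ 0 -> P^n, so a
   vector v : Cvec R n at z stands for a tangent vector of P^n at [z] and
   hproj z v is its horizontal lift. *)
Definition hproj (R : realType) (n : nat) (z v : Cvec R n) : Cvec R n :=
  v - (hdot v z / hdot z z) *: z.

(* The Fubini-Study metric, in homogeneous coordinates, normalised so that
   the Hopf map from the unit sphere to P^n is a Riemannian submersion: the
   holomorphic sectional curvature is 4 (and the area of P^1 is pi). *)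
Definition FS (R : realType) (n : nat) (z v w : Cvec R n) : R :=
  complex.Re (hdot (hproj z v) (hproj z w) / hdot z z).

Definition has_velocity (R : realType) (n : nat) (c : R -> Cvec R n) (t : R)
    (v : Cvec R n) :=
  forall k,
    is_derive (t : R^o) (1 : R^o)
      (fun s : R^o => complex.Re (c s 0 k) : R^o) (complex.Re (v 0 k)) /\
    is_derive (t : R^o) (1 : R^o)
      (fun s : R^o => complex.Im (c s 0 k) : R^o) (complex.Im (v 0 k)).

(* v represents a tangent vector of X at [z]: it is the velocity of a curve
   in X.  When X is an embedded submanifold it does not matter that the curve
   is only required to be differentiable at 0. *)
Definition tangent (R : realType) (n : nat) (X : set (proj_space R n))
    (z v : Cvec R n) :=
  exists c : R -> Cvec R n,
    [/\ c 0 = z, \forall t \near (0 : R), X (pt (c t)) & has_velocity c 0 v].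

(* A pair (z, w), with z in the unit sphere and w horizontal at z, stands for
   the tangent vector w of P^n at [z].  Two pairs stand for the same tangent
   vector iff they differ by the action of U(1). *)
Definition normal_vector (R : realType) (n : nat) (X : set (proj_space R n))
    (z w : Cvec R n) :=
  [/\ hdot z z = 1, X (pt z), hdot w z = 0 &
      forall v, tangent X z v -> FS z w v = 0].

(* c is the horizontal lift to the unit sphere of a geodesic of P^n.  The
   Levi-Civita derivative in P^n of a horizontal field along a horizontal
   curve is the horizontal part of its ordinary derivative in C^(n+1). *)
Definition geodesic_lift (R : realType) (n : nat) (c : R -> Cvec R n) :=
  exists c1 c2 : R -> Cvec R n, forall t,
    [/\ hdot (c t) (c t) = 1, hdot (c1 t) (c t) = 0,
        has_velocity c t (c1 t), has_velocity c1 t (c2 t) &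
        hproj (c t) (c2 t) = 0].

(* [y] = exp_[z] (w), lifted to the unit sphere. *)
Definition is_exp (R : realType) (n : nat) (z w y : Cvec R n) :=
  exists c : R -> Cvec R n,
    [/\ geodesic_lift c, c 0 = z, has_velocity c 0 w & c 1 = y].

(* The normal exponential map of X is singular at the normal vector w at [z]:
   some curve in the normal bundle through (z, w) has nonzero velocity there
   while its image in P^n has zero velocity.  The velocity (z1, w1) is zero in
   the normal bundle iff it is tangent to the U(1)-orbit of (z, w). *)
Definition normal_exp_singular (R : realType) (n : nat)
    (X : set (proj_space R n)) (z w : Cvec R n) :=
  exists (zc wc yc : R -> Cvec R n) (z1 w1 y1 : Cvec R n),
    [/\ zc 0 = z /\ wc 0 = w,
        \forall t \near (0 : R),
          normal_vector X (zc t) (wc t) /\ is_exp (zc t) (wc t) (yc t),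
        [/\ has_velocity zc 0 z1, has_velocity wc 0 w1 &
            has_velocity yc 0 y1],
        ~ (exists a : R, z1 = (a *i) *: z /\ w1 = (a *i) *: w) &
        hproj (yc 0) y1 = 0].

(* The tube of radius r around X contains a focal point of X at distance r. *)
Definition focal_radius (R : realType) (n : nat) (X : set (proj_space R n))
    : set R :=
  [set r | 0 < r /\ exists z xi : Cvec R n,
     [/\ normal_vector X z xi, hdot xi xi = 1 &
         normal_exp_singular X z (r%:C *: xi)]].

(* For a compact submanifold the infimum is a minimum; it is +oo if there is
   no focal point. *)
Definition min_focal_distance (R : realType) (n : nat)
    (X : set (proj_space R n)) : \bar R :=
  ereal_inf [set r%:E | r in focal_radius X].

(* The Riemannian area density, with respect to dx dy, of f restricted to the
   chart x + iy |-> [1 : x + iy]; it does not depend on the chart j of P^n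
   used to represent the differential of f. *)
Definition area_density (R : realType) (n : nat)
    (f : proj_space R 1 -> proj_space R n) (s : C R) : R :=
  let j := odflt ord0 [pick j | in_chart j (f (param ord0 s))] in
  let u := local_expr f ord0 j in
  let ux := 'D_1 u s in
  let uy := 'D_('i : C R) u s in
  Num.sqrt (FS (u s) ux ux * FS (u s) uy uy - FS (u s) ux uy ^+ 2).

(* The area of f (P^1), for f injective; the chart misses only the point
   [0 : 1] of P^1. *)
Definition Vol (R : realType) (n : nat)
    (f : proj_space R 1 -> proj_space R n) : \bar R :=
  (\int[lebesgue_measure \x lebesgue_measure]_(p in [set: R * R])
     (area_density f (p.1 +i* p.2))%:E)%E.

(* Main.v *)
(* Let f be a local holomorphic lift of Gamma, N = |f|^2 |f'|^2 - |<f', f>|^2 and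
   g = N / |f|^4, so that the area is the integral of g over C.

   If the second fundamental form has norm greater than 1 at some point, take
   the unit normal xi along it.  Move the foot point z along the curve, for a lift f
   with |f| = 1 and f' orthogonal to f at that point, and correct xi by
   Gram-Schmidt: the velocities of z and xi are real multiples of f' of opposite
   signs, and cos r z + sin r xi has zero velocity for some r with tan r < 1.
   This is a focal point at distance r < pi / 4.
   Hence the second fundamental form has norm at most 1, and the Gauss equation
   (curvature 4 - 2 |II|^2 >= 2) reads: Laplacian (log g) <= - 4 g.

   By the divergence theorem on the square [-L, L]^2, four times the area of
   the square is at most the flux of - grad (log g).  Comparing the charts s and
   1 / s of P^1 gives d/ds log g = - 2 / s + O(s^-2) at infinity, and bounding
   |Re (1 / s)| by 1 / L on the sides gives Vol <= 8 < 4 pi, while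
   4 pi <= pi 2^n / (n - 1) for n >= 3.

   Holomorphic maps are only assumed to have a complex derivative, so the
   existence of f'' and f''' requires Goursat's lemma and Cauchy's formula. *)
Require Import Defs.
From HB Require Import structures.
From mathcomp Require Import all_boot all_order all_algebra.
From mathcomp Require Import all_classical all_reals all_analysis.
From mathcomp Require Import complex ring lra.

Set Implicit Arguments.
Unset Strict Implicit.
Unset Printing Implicit Defensive.

Import Order.TTheory GRing.Theory Num.Theory.
Import numFieldNormedType.Exports.

Local Open Scope classical_set_scope.
Local Open Scope ring_scope.
Local Open Scope complex_scope.
Import Normc.

(** * Goursat's lemma *)

Section calculus.
Variable R : realType.

(** Gauss-Bonnet suggests the bound 2 pi for the area: the curvature is at least 2 and the sphere
    has Euler characteristic 2. Bounding the flux side by side on a square only gives 8, and the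
    strict inequality 2 < pi still puts this below 4 pi. The logarithm of g is never formed. Its
    Wirtinger derivative is a rational expression in the 2-jet of a lift, unchanged when the lift is
    multiplied by a holomorphic function; so it is one function on the whole plane although lifts
    exist only in charts. Its first partial derivatives must be continuous, which is where f'''
    enters. Regularity comes from circle integrals: f' is such an integral of f, hence continuous;
    then difference quotients of f converge uniformly on circles, and f' is differentiable. The
    focal point requires the moving vector xi to be normal to the image as a set, whose tangent
    vectors are velocities of arbitrary curves, differentiable at a single instant. The
    homeomorphism onto the image provides parameters for such a curve, and a first-order estimate
    avoids differentiating them. *)

Lemma antiderivative_exists (f : R -> R) (a : R) : continuous f ->
  exists F : R -> R, forall x, a < x -> is_derive x (1 : R) F (f x).
Proof.
move=> cf; exists (fun x => \int[lebesgue_measure]_(t in `[a, x]) f t)%R => x ax.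
have xu : x < x + 1 by rewrite ltrDl.
have fi : lebesgue_measure.-integrable `[a, x + 1] (EFin \o f).
  apply: continuous_compact_integrable; first exact: segment_compact.
  exact: continuous_subspaceT.
have [dF <-] := continuous_FTC1_closed xu fi ax (cf x).
by rewrite derive1E; apply: DeriveDef.
Qed.

(** The mean value theorem for [F - G]. It turns bounds on integrands into bounds on increments of
    antiderivatives, so that line integrals can be handled through [PA], [PB] and the like. *)
Lemma increment_le (F G f g : R -> R) (a b e : R) : a <= b ->
  (forall x, a <= x <= b -> is_derive x (1 : R) F (f x)) ->
  (forall x, a <= x <= b -> is_derive x (1 : R) G (g x)) ->
  (forall x, a <= x <= b -> `|f x - g x| <= e) ->
  `|F b - F a - (G b - G a)| <= e * (b - a).
Proof.
move=> ab dF dG fg.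
have dFG x : a <= x <= b -> is_derive x (1 : R) (F - G) (f x - g x).
  by move=> xab; have := dF x xab; have := dG x xab => ? ?; exact: is_deriveB.
have [c cab E] : exists2 c, c \in `[a, b] &
    (F - G) b - (F - G) a = (f c - g c) * (b - a).
  apply: (@MVT_segment R (F - G) (fun x => f x - g x)) => //.
    by move=> x; rewrite in_itv /= => /andP[/ltW ? /ltW ?]; apply: dFG; apply/andP.
  apply: derivable_within_continuous => x; rewrite in_itv /= => /dFG.
  by move=> [].
have -> : F b - F a - (G b - G a) = (F - G) b - (F - G) a.
  by rewrite -[(F - G) b]/(F b - G b) -[(F - G) a]/(F a - G a); ring.
rewrite E normrM (ger0_norm (_ : 0 <= b - a)) ?subr_ge0//.
by rewrite ler_wpM2r ?subr_ge0// fg.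
Qed.
End calculus.

Section goursat.
Variable R : realType.

Lemma halving_small (c d : R) : 0 < d -> exists n : nat, c / 2 ^+ n < d.
Proof.
move=> d0; exists (Num.truncn (c / d)).+1.
have : c / d < (Num.truncn (c / d)).+1%:R by exact: truncnS_gt.
rewrite !ltr_pdivrMr ?exprn_gt0// => /lt_le_trans; apply.
rewrite mulrC ler_pM2l// -natrX ler_nat; exact/ltnW/ltn_expl.
Qed.

(* Bisection: the rectangle form of Goursat's lemma, where the Cauchy-Riemann
   equation A_y = B_x appears as the common coefficient v of the affine
   approximations of A and B, and PA, PB are partial antiderivatives. *)
Lemma goursat (A B PA PB : R -> R -> R) (x0 x1 y0 y1 : R) :
  x0 < x1 -> y0 < y1 ->
  (forall x y, x0 <= x <= x1 -> y0 <= y <= y1 ->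
     is_derive x (1 : R) (PA ^~ y) (A x y)) ->
  (forall x y, x0 <= x <= x1 -> y0 <= y <= y1 ->
     is_derive y (1 : R) (PB x) (B x y)) ->
  (forall x y, x0 <= x <= x1 -> y0 <= y <= y1 ->
     exists ca cb u v w, forall e, 0 < e -> exists2 d, 0 < d &
     forall x' y', x0 <= x' <= x1 -> y0 <= y' <= y1 ->
       `|x' - x| < d -> `|y' - y| < d ->
       `|A x' y' - (ca + u * x' + v * y')| <= e * (`|x' - x| + `|y' - y|) /\
       `|B x' y' - (cb + v * x' + w * y')| <= e * (`|x' - x| + `|y' - y|)) ->
  PB x1 y1 - PB x1 y0 - (PB x0 y1 - PB x0 y0) =
  PA x1 y1 - PA x0 y1 - (PA x1 y0 - PA x0 y0).
Proof.
move=> xx yy dA dB hAB.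
(* Circulation of [A dx + B dy] around the rectangle with lower left corner [(a, b)] and sides [l],
   [m]. *)
pose Phi (a b l m : R) := PB (a + l) (b + m) - PB (a + l) b
   - (PB a (b + m) - PB a b) - (PA (a + l) (b + m) - PA a (b + m)
   - (PA (a + l) b - PA a b)).
pose W := x1 - x0; pose H := y1 - y0.
have W0 : 0 < W by rewrite subr_gt0.
have H0 : 0 < H by rewrite subr_gt0.
suff : Phi x0 y0 W H = 0.
  rewrite /Phi /W /H !(addrC _ (_ - _)) !subrK => E.
  by apply/eqP; rewrite -subr_eq0; apply/eqP; rewrite -[RHS]E; ring.
apply/eqP/negPn/negP => Kn0; pose K := `|Phi x0 y0 W H|.
have K0 : 0 < K by rewrite normr_gt0.
pose P n (p : R * R) := K / 4 ^+ n <= `|Phi p.1 p.2 (W / 2 ^+ n) (H / 2 ^+ n)|.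
(* The fourth quarter is the default choice: [Ps] shows that if the first three quarters fall below
   [K / 4 ^+ n.+1], the fourth one cannot. *)
pose step n (p : R * R) : R * R :=
  let l := W / 2 ^+ n.+1 in let m := H / 2 ^+ n.+1 in
  if P n.+1 p then p else if P n.+1 (p.1 + l, p.2) then (p.1 + l, p.2)
  else if P n.+1 (p.1, p.2 + m) then (p.1, p.2 + m) else (p.1 + l, p.2 + m).
pose s := fix s n := if n is n'.+1 then step n' (s n') else (x0, y0).
have half c n : c / 2 ^+ n = c / 2 ^+ n.+1 + c / 2 ^+ n.+1 :> R.
  by rewrite exprS; field; rewrite expf_neq0.
have Ps n : P n (s n).
  elim: n => [|n IH]; first by rewrite /P /= !expr0 !divr1.
  rewrite /= /step; case: ifPn => // h1; case: ifPn => // h2; case: ifPn => // h3.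
  move: IH h1 h2 h3; case: (s n) => a b; rewrite /P /= -!ltNge.
  rewrite (half W n) (half H n); set l := W / _; set m := H / _.
  have -> : K / 4 ^+ n = 4 * (K / 4 ^+ n.+1).
    by rewrite [4 ^+ n.+1]exprS; field; rewrite expf_neq0.
  set k := K / _ => h h1 h2 h3; rewrite leNgt; apply/negP => h4.
  have E : Phi a b (l + l) (m + m) = Phi a b l m + Phi (a + l) b l m
     + Phi a (b + m) l m + Phi (a + l) (b + m) l m by rewrite /Phi !addrA; ring.
  have : 4 * k < 4 * k; last by rewrite ltxx.
  apply: (le_lt_trans h); rewrite E.
  apply: le_lt_trans (ler_normD _ _) _; have := ler_normD (Phi a b l m + Phi (a + l) b l m) (Phi a (b + m) l m).
  have := ler_normD (Phi a b l m) (Phi (a + l) b l m); lra.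
have l0 n : 0 < W / 2 ^+ n by rewrite divr_gt0// exprn_gt0.
have m0 n : 0 < H / 2 ^+ n by rewrite divr_gt0// exprn_gt0.
have s1S n : (s n).1 <= (s n.+1).1 <= (s n).1 + W / 2 ^+ n.+1.
  have := l0 n.+1; rewrite /= /step; do ![case: ifP => _] => /= ?; lra.
have s2S n : (s n).2 <= (s n.+1).2 <= (s n).2 + H / 2 ^+ n.+1.
  have := m0 n.+1; rewrite /= /step; do ![case: ifP => _] => /= ?; lra.
have s1m n k : (s n).1 <= (s (n + k)%N).1 /\
    (s (n + k)%N).1 + W / 2 ^+ (n + k) <= (s n).1 + W / 2 ^+ n.
  elim: k => [|k [IH1 IH2]]; first by rewrite addn0.
  rewrite addnS; have := s1S (n + k)%N; have := half W (n + k)%N; lra.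
have s2m n k : (s n).2 <= (s (n + k)%N).2 /\
    (s (n + k)%N).2 + H / 2 ^+ (n + k) <= (s n).2 + H / 2 ^+ n.
  elim: k => [|k [IH1 IH2]]; first by rewrite addn0.
  rewrite addnS; have := s2S (n + k)%N; have := half H (n + k)%N; lra.
have s1b n k : (s k).1 <= (s n).1 + W / 2 ^+ n.
  have := s1m n k; have := s1m k n; rewrite addnC; have := l0 (n + k)%N.
  have := l0 k; lra.
have s2b n k : (s k).2 <= (s n).2 + H / 2 ^+ n.
  have := s2m n k; have := s2m k n; rewrite addnC; have := m0 (n + k)%N.
  have := m0 k; lra.
(* The lower left corners increase in both coordinates; their suprema give a point common to all the
   nested rectangles. *)
pose x := sup (range (fun n => (s n).1)); pose y := sup (range (fun n => (s n).2)).
have xb n : (s n).1 <= x <= (s n).1 + W / 2 ^+ n.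
  apply/andP; split.
    apply: ub_le_sup; last by exists n.
    by exists (x0 + W / 2 ^+ 0) => _ [k _ <-]; exact: (s1b 0%N).
  by apply: ge_sup; [exists (s 0%N).1; exists 0%N|move=> _ [k _ <-]].
have yb n : (s n).2 <= y <= (s n).2 + H / 2 ^+ n.
  apply/andP; split.
    apply: ub_le_sup; last by exists n.
    by exists (y0 + H / 2 ^+ 0) => _ [k _ <-]; exact: (s2b 0%N).
  by apply: ge_sup; [exists (s 0%N).2; exists 0%N|move=> _ [k _ <-]].
have xin n z : (s n).1 <= z <= (s n).1 + W / 2 ^+ n -> x0 <= z <= x1.
  have := s1m 0%N n; rewrite add0n /= expr0 divr1 /W; lra.
have yin n z : (s n).2 <= z <= (s n).2 + H / 2 ^+ n -> y0 <= z <= y1.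
  have := s2m 0%N n; rewrite add0n /= expr0 divr1 /H; lra.
have [ca [cb [u [v [w hd]]]]] := hAB x y (xin 0%N x (xb 0%N)) (yin 0%N y (yb 0%N)).
have S0 : 0 < W + H by rewrite addr_gt0.
(* Chosen so that [4 * e * (l + m) ^+ 2] is exactly [K / 4 ^+ n] at stage [n]. The four sides
   contribute an error of at most [2 * e * (l + m) ^+ 2], which is strictly less. *)
pose e := K / (4 * (W + H) ^+ 2).
have e0 : 0 < e by rewrite divr_gt0// mulr_gt0// exprn_gt0.
have [d d0 {}hd] := hd e e0.
have [n hn] := halving_small (W + H) d0.
have := Ps n; rewrite /P; move: (xb n) (yb n) (xin n) (yin n) (l0 n) (m0 n).
have : (W / 2 ^+ n + H / 2 ^+ n) ^+ 2 * (4 * e) = K / 4 ^+ n.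
  rewrite /e (_ : 4 ^+ n = 2 ^+ n * 2 ^+ n :> R); last first.
    by rewrite -exprMn; congr (_ ^+ _); ring.
  by field; rewrite expf_neq0//= gt_eqF.
move: hn; rewrite mulrDl; set l := W / _; set m := H / _.
case: (s n) => a b /= hn <- xab yab xi yi ll mm; apply/negP; rewrite -ltNge.
have hx x' y' : a <= x' <= a + l -> b <= y' <= b + m ->
   `|A x' y' - (ca + u * x' + v * y')| <= e * (l + m) /\
   `|B x' y' - (cb + v * x' + w * y')| <= e * (l + m).
  move=> hx' hy'.
  have nx : `|x' - x| <= l by rewrite ler_norml; lra.
  have ny : `|y' - y| <= m by rewrite ler_norml; lra.
  have [||h1 h2] := hd x' y' (xi _ hx') (yi _ hy'); [lra|lra|].
  have : e * (`|x' - x| + `|y' - y|) <= e * (l + m) by rewrite ler_pM2l// lerD.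
  lra.
have la : a <= a <= a + l by lra.
have lal : a <= a + l <= a + l by lra.
have mb : b <= b <= b + m by lra.
have mbm : b <= b + m <= b + m by lra.
(* The affine approximations integrate exactly. In [Phi] their contributions cancel, because both
   coordinate directions produce the same term [v * l * m]. *)
have hA y' : b <= y' <= b + m -> `|PA (a + l) y' - PA a y' - ((ca + v * y') * l
    + u / 2 * ((a + l) ^+ 2 - a ^+ 2))| <= e * (l + m) * l.
  move=> hy'.
  pose G z := (ca + v * y') * z + u / 2 * z ^+ 2.
  have dG z : is_derive z (1 : R) G (ca + u * z + v * y').
    by apply: is_derive_eq; rewrite /GRing.scale /=; field.
  have := @increment_le R (PA ^~ y') G (A ^~ y') _ a (a + l) (e * (l + m)) _ _
    (fun z _ => dG z) _.
  rewrite /G => /(_ _ _ _).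
  rewrite (_ : a + l - a = l); last by ring.
  rewrite (_ : (ca + v * y') * (a + l) + _ - _ = (ca + v * y') * l
    + u / 2 * ((a + l) ^+ 2 - a ^+ 2)); last by ring.
  apply; [lra| |].
    by move=> z hz; apply: dA; [exact: xi|exact: yi].
  by move=> z hz; case: (hx z y' hz hy').
have hB x' : a <= x' <= a + l -> `|PB x' (b + m) - PB x' b - ((cb + v * x') * m
    + w / 2 * ((b + m) ^+ 2 - b ^+ 2))| <= e * (l + m) * m.
  move=> hx'.
  pose G z := (cb + v * x') * z + w / 2 * z ^+ 2.
  have dG z : is_derive z (1 : R) G (cb + v * x' + w * z).
    by apply: is_derive_eq; rewrite /GRing.scale /=; field.
  have := @increment_le R (PB x') G (B x') _ b (b + m) (e * (l + m)) _ _
    (fun z _ => dG z) _.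
  rewrite /G => /(_ _ _ _).
  rewrite (_ : b + m - b = m); last by ring.
  rewrite (_ : (cb + v * x') * (b + m) + _ - _ = (cb + v * x') * m
    + w / 2 * ((b + m) ^+ 2 - b ^+ 2)); last by ring.
  apply; [lra| |].
    by move=> z hz; apply: dB; [exact: xi|exact: yi].
  by move=> z hz; case: (hx x' z hx' hz).
have := hA b mb; have := hA (b + m) mbm; have := hB a la; have := hB (a + l) lal.
rewrite !ler_norml => /andP[b1 b2] /andP[b3 b4] /andP[b5 b6] /andP[b7 b8].
have p1 : 0 < e * (l + m) ^+ 2 by rewrite mulr_gt0// exprn_gt0// addr_gt0.
rewrite /Phi ltr_norml; apply/andP; split; lra.
Qed.
End goursat.

(** The little-o form of the derivative, stated over a general field so that it serves [R] and [C R]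
    alike. The error is compared with a multiple of [h] rather than divided by it, so [h = 0] need
    not be excluded. *)
Lemma is_derive_nearP (K : numFieldType) (W : normedModType K) (f : K -> W)
    (x : K) (l : W) :
  is_derive x (1 : K) f l <->
  forall e : K, 0 < e ->
    \forall h \near 0, `|f (x + h) - f x - h *: l| <= e * `|h|.
Proof.
split.
  move=> [df <-] e e0; have := derivable_nbhs df.
  move=> /eqaddoP /(_ e e0); apply: filterS => h /=.
  rewrite -![(_ + _ : _ -> _) _]/(_ + _) -![(- _ : _ -> _) _]/(- _) /cst /=.
  rewrite [h *: 1]mulr1 [h + x]addrC opprD addrA.
  by [].
move=> H.
suff cl : (fun h => h^-1 *: ((f \o shift x) (h *: (1 : K)) - f x)) @ 0^' --> l.
  by apply: DeriveDef; [apply/cvg_ex; exists l|apply/cvg_lim].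
apply/cvgrPdist_le => e e0.
rewrite near_withinE; move: (H e e0); apply: filterS => h hh hn0.
rewrite /= [h *: 1]mulr1 -(ler_pM2r (x := `|h|)) ?normr_gt0//.
apply: le_trans hh; rewrite mulrC -normrZ distrC scalerBr scalerA mulfV//.
by rewrite scale1r [h + x]addrC.
Qed.

(** * Complex derivatives with real radii, and the chain rules *)

Section complex_derivatives.
Variable R : realType.
Implicit Types (f g : C R -> C R) (s l : C R).

Lemma normcP (z : R[i]) : `|z| = (normc z)%:C.
Proof. by case: z. Qed.

(** Radii of balls in [C R] are elements of [R[i]]; being positive they are real, so all later
    estimates can use real radii and the real-valued [normc]. *)
Lemma nbhs_complexP (s : C R) (P : set (C R)) :
  (\forall z \near s, P z) <->
  exists2 d : R, 0 < d & forall z : R[i], normc (z - s) < d -> P z.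
Proof.
split.
  move=> /nbhs_ballP[e /= e0 h].
  exists (complex.Re e).
    by move: e0; rewrite ltcE => /andP[].
  move=> z hz; apply: h; rewrite -ball_normE /= distrC normcP.
  move: e0; rewrite ltcE /= => /andP[/eqP Ie _].
  by rewrite ltcE /= Ie eqxx.
move=> [d d0 h]; apply/nbhs_ballP; exists (d%:C) => /=.
  by rewrite ltcR.
move=> z; rewrite -ball_normE /= distrC normcP ltcR; exact: h.
Qed.

Lemma nbhs_realP (s : R) (P : set R) :
  (\forall z \near s, P z) <->
  exists2 d : R, 0 < d & forall z : R, `|z - s| < d -> P z.
Proof.
split.
  move=> /nbhs_ballP[e /= e0 h]; exists e => // z hz; apply: h.
  by rewrite -ball_normE /= distrC.
move=> [d d0 h]; apply/nbhs_ballP; exists d => // z.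
by rewrite -ball_normE /= distrC; exact: h.
Qed.

Lemma is_derive_complexP f s l :
  is_derive s (1 : C R) f l <->
  forall e : R, 0 < e -> exists2 d : R, 0 < d & forall h : R[i],
    normc h < d -> normc (f (s + h) - f s - h * l) <= e * normc h.
Proof.
rewrite is_derive_nearP; split=> H e e0.
  have := H e%:C; rewrite ltcR => /(_ e0) /nbhs_complexP[d d0 hd].
  exists d => // h hh; have := hd h; rewrite subr0 => /(_ hh).
  by rewrite !normcP -rmorphM lecR.
have [e1 e2] : 0 < complex.Re e /\ e = (complex.Re e)%:C.
  by case: e e0 => a b; rewrite ltcE /= => /andP[/eqP -> ?].
rewrite e2; have [d d0 hd] := H _ e1; apply/nbhs_complexP; exists d => // h.
by rewrite subr0 => /hd; rewrite !normcP -rmorphM lecR.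
Qed.

Lemma is_derive_realP (f : R -> R) (s l : R) :
  is_derive s (1 : R) f l <->
  forall e : R, 0 < e -> exists2 d : R, 0 < d & forall h : R,
    `|h| < d -> `|f (s + h) - f s - h * l| <= e * `|h|.
Proof.
rewrite is_derive_nearP; split=> H e /H.
  by move=> /nbhs_realP[d d0 hd]; exists d => // h hh; apply: hd; rewrite subr0.
by move=> [d d0 hd]; apply/nbhs_realP; exists d => // h; rewrite subr0 => /hd.
Qed.

Lemma row_norm_le (K : numDomainType) (n : nat) (A : 'rV[K]_n) (e : K) :
  0 <= e -> `|A| <= e <-> forall k, `|A 0 k| <= e.
Proof.
move=> e0; split=> [H k|H].
  apply: (@le_trans _ _ (mx_norm A)) => //; rewrite mx_normE.
  by apply: (le_bigmax _ (fun ij : 'I_1 * 'I_n =>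
    (widen_itv `|A ij.1 ij.2|%:itv : {nonneg K})) (0, k)).
have [/eqP A0|A0] := boolP (`|A| == 0); first by rewrite A0.
have [[i j] /= E] := mx_norm_neq0 A0.
by apply: (@le_trans _ _ (mx_norm A)) => //; rewrite E ord1.
Qed.

Lemma nbhs_rowP (n : nat) (z : Cvec R n) (P : set (Cvec R n)) :
  (\forall w \near z, P w) <->
  exists2 d : R, 0 < d &
    forall w : Cvec R n, (forall k, normc (w 0 k - z 0 k) < d) -> P w.
Proof.
split.
  move=> /nbhs_ballP[e /= e0 h].
  have [e1 e2] : 0 < complex.Re e /\ e = (complex.Re e)%:C.
    by case: e e0 {h} => a b; rewrite ltcE /= => /andP[/eqP -> ?].
  exists (complex.Re e / 2); first by rewrite divr_gt0.
  move=> w hw; apply: h; rewrite -ball_normE /=.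
  apply: (@le_lt_trans _ _ (complex.Re e / 2)%:C); last first.
    by rewrite [ltRHS]e2 ltcR; lra.
  apply/row_norm_le; first by rewrite lecR; lra.
  by move=> k; rewrite !mxE -normrN opprB normcP lecR ltW.
move=> [d d0 h]; apply/nbhs_ballP; exists (d%:C) => /=.
  by rewrite ltcR.
move=> w; rewrite -ball_normE /= => hw; apply: h => k.
rewrite -ltcR -normcP -normrN opprB; apply: le_lt_trans hw.
have /(row_norm_le _ (normr_ge0 _)) /(_ k) := lexx `|z - w|.
by rewrite !mxE.
Qed.

Lemma is_derive_rowP (n : nat) (u : C R -> Cvec R n) s (v : Cvec R n) :
  is_derive s (1 : C R) u v <->
  forall k, is_derive s (1 : C R) (fun z => u z 0 k : C R) (v 0 k).
Proof.
split=> [H k|H].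
  apply/is_derive_nearP => e e0; move/is_derive_nearP: H => /(_ e e0).
  apply: filterS => h /(row_norm_le _ (mulr_ge0 (ltW e0) (normr_ge0 h))).
  by move=> /(_ k); rewrite !mxE.
apply/is_derive_nearP => e e0.
have hf : \forall h \near 0, forall k,
    `|u (s + h) 0 k - u s 0 k - h *: v 0 k| <= e * `|h|.
  have := @filter_forall _ _ (fun k h => `|u (s + h) 0 k - u s 0 k - h *: v 0 k|
    <= e * `|h|) (nbhs (0 : C R)) _; apply => k.
  by move/is_derive_nearP: (H k) => /(_ e e0).
apply: filterS hf => h hf.
apply/(row_norm_le _ (mulr_ge0 (ltW e0) (normr_ge0 h))) => k.
by rewrite !mxE; exact: hf.
Qed.

Lemma normc_ge0 (z : R[i]) : 0 <= normc z.
Proof. by case: z => a b /=; exact: sqrtr_ge0. Qed.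

Lemma normc_Re (z : R[i]) : `|complex.Re z| <= normc z.
Proof. by rewrite -lecR -normcP normc_ge_Re. Qed.

Lemma normc_Im (z : R[i]) : `|complex.Im z| <= normc z.
Proof.
have := normc_Re (z * 'i%C); rewrite ReiNIm normrN normcM.
by rewrite [normc 'i%C]/= expr0n /= expr1n add0r sqrtr1 mulr1.
Qed.

Lemma normc_ler (z : R[i]) : normc z <= `|complex.Re z| + `|complex.Im z|.
Proof.
rewrite -(ler_pXn2r (n := 2)) ?nnegrE ?normc_ge0 ?addr_ge0//.
case: z => a b /=; rewrite sqr_sqrtr ?addr_ge0 ?sqr_ge0//.
have := normr_ge0 a; have := normr_ge0 b; have := real_normK (num_real a).
have := real_normK (num_real b); nra.
Qed.

Lemma normc_real (a : R) : normc a%:C = `|a|.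
Proof. by rewrite /= expr0n addr0 sqrtr_sqr. Qed.

Definition cvel (c : R -> R[i]) (t : R) (v : R[i]) :=
  is_derive t (1 : R) (fun x => complex.Re (c x)) (complex.Re v) /\
  is_derive t (1 : R) (fun x => complex.Im (c x)) (complex.Im v).

Lemma cvelP (c : R -> R[i]) t v : cvel c t v <->
  forall e : R, 0 < e -> exists2 d : R, 0 < d & forall h : R,
    `|h| < d -> normc (c (t + h) - c t - h%:C * v) <= e * `|h|.
Proof.
have ReE x h : complex.Re (x - h%:C * v) = complex.Re x - h * complex.Re v.
  by case: x v {c} => a b [p q] /=; ring.
have ImE x h : complex.Im (x - h%:C * v) = complex.Im x - h * complex.Im v.
  by case: x v {c ReE} => a b [p q] /=; ring.
split=> [[/is_derive_realP H1 /is_derive_realP H2] e e0|H].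
  have e20 : 0 < e / 2 by lra.
  have [d1 d10 h1] := H1 _ e20; have [d2 d20 h2] := H2 _ e20.
  exists (Num.min d1 d2); first by rewrite lt_min d10.
  move=> h; rewrite lt_min => /andP[/h1 {}h1 /h2 {}h2].
  apply: le_trans (normc_ler _) _; rewrite ReE ImE !raddfB /=; lra.
by split; apply/is_derive_realP => e /H[d d0 hd]; exists d => // h /hd;
  apply: le_trans; [apply: le_trans (normc_Re _)|apply: le_trans (normc_Im _)];
  rewrite ?ReE ?ImE !raddfB /=.
Qed.

(** The common core of both chain rules: [h] is a real increment in [cvel_comp] and a complex one in
    [is_derive_complex_comp], while [k] is the increment of the inner function. Capping [e'] by 1
    gives the bound [(normc v + 1) * normc h] for [normc k]. *)
Lemma chain_estimate f p l (v : R[i]) : is_derive p (1 : C R) f l ->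
  forall e : R, 0 < e -> exists e' d' : R, [/\ 0 < e', 0 < d' &
    forall h k : R[i], normc h < d' -> normc (k - h * v) <= e' * normc h ->
      normc (f (p + k) - f p - h * (v * l)) <= e * normc h].
Proof.
move=> /is_derive_complexP H2 e e0.
pose M := normc v + 1; pose L := normc l + 1.
have M0 : 0 < M by rewrite ltr_wpDl ?normc_ge0.
have L0 : 0 < L by rewrite ltr_wpDl ?normc_ge0.
have eM0 : 0 < e / (2 * M) by rewrite divr_gt0// mulr_gt0.
have [d2 d20 h2] := H2 _ eM0.
have eL0 : 0 < Num.min (e / (2 * L)) 1.
  by rewrite lt_min ltr01 andbT divr_gt0// mulr_gt0.
exists (Num.min (e / (2 * L)) 1), (d2 / M); split=> //; first by rewrite divr_gt0.
move=> h k hd2 h1.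
have nk : normc k <= M * normc h.
  rewrite -(subrK (h * v) k); apply: le_trans (le_normcD _ _) _.
  rewrite normcM.
  have : Num.min (e / (2 * L)) 1 * normc h <= 1 * normc h.
    by rewrite ler_wpM2r ?normc_ge0// ge_min lexx orbT.
  rewrite /M; lra.
have kd2 : normc k < d2.
  by apply: le_lt_trans nk _; rewrite mulrC -ltr_pdivlMr.
have {}h2 := h2 _ kd2.
rewrite -(subrK (k * l) (f (p + k) - f p)) -addrA.
apply: le_trans (le_normcD _ _) _.
have -> : k * l - h * (v * l) = (k - h * v) * l by ring.
rewrite normcM.
have p1 : normc (k - h * v) * normc l <= e / 2 * normc h.
  apply: (@le_trans _ _ (e / (2 * L) * normc h * L)).
    apply: ler_pM; rewrite ?normc_ge0//; last by rewrite /L lerDl.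
    by apply: le_trans h1 _; rewrite ler_wpM2r ?normc_ge0// ge_min lexx.
  by rewrite le_eqVlt; apply/orP; left; apply/eqP; field; rewrite gt_eqF.
have p2 : e / (2 * M) * normc k <= e / 2 * normc h.
  apply: (@le_trans _ _ (e / (2 * M) * (M * normc h))).
    by rewrite ler_pM2l.
  by rewrite le_eqVlt; apply/orP; left; apply/eqP; field; rewrite gt_eqF.
lra.
Qed.

Lemma cvel_comp (c : R -> C R) t v f l : cvel c t v ->
  is_derive (c t) (1 : C R) f l -> cvel (f \o c) t (v * l).
Proof.
move=> /cvelP H1 H2; apply/cvelP => e e0.
have [e' [d' [e'0 d'0 H]]] := chain_estimate v H2 e0.
have [d d0 hd] := H1 _ e'0.
exists (Num.min d d'); first by rewrite lt_min d0.
move=> h; rewrite lt_min => /andP[/hd h1 h2].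
have := H h%:C (c (t + h) - c t).
by rewrite normc_real [c t + _]addrC subrK => /(_ h2 h1).
Qed.

Lemma is_derive_complex_comp f g s l m : is_derive s (1 : C R) g m ->
  is_derive (g s) (1 : C R) f l -> is_derive s (1 : C R) (f \o g) (m * l).
Proof.
move=> /is_derive_complexP H1 H2; apply/is_derive_complexP => e e0.
have [e' [d' [e'0 d'0 H]]] := chain_estimate m H2 e0.
have [d d0 hd] := H1 _ e'0.
exists (Num.min d d'); first by rewrite lt_min d0.
move=> h; rewrite lt_min => /andP[/hd h1 h2].
have := H h (g (s + h) - g s).
by rewrite [g s + _]addrC subrK => /(_ h2 h1).
Qed.
End complex_derivatives.

(** * Cauchy's formula and regularity of complex derivatives *)

Section exponential.
Variable R : realType.
Implicit Types (f g k : C R -> C R) (s a l : C R).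

Definition cis (t : R) : R[i] := cos t +i* sin t.
Definition cexp (z : C R) : C R := (expR (complex.Re z))%:C * cis (complex.Im z).

Lemma normc_cis t : normc (cis t) = 1.
Proof. by rewrite /= cos2Dsin2 sqrtr1. Qed.

Lemma cexpD x y : cexp (x + y) = cexp x * cexp y.
Proof.
case: x y => a b [c d]; rewrite /cexp /cis /= expRD cosD sinD.
by apply/eqP; rewrite eq_complex /=; apply/andP; split; apply/eqP; ring.
Qed.

Lemma cexp0 : cexp 0 = 1.
Proof.
rewrite /cexp /cis /= expR0 cos0 sin0.
by apply/eqP; rewrite eq_complex /=; apply/andP; split; apply/eqP; ring.
Qed.

(** The first-order expansions of [expR], [cos] and [sin] at 0 leave only the products
    [(X - 1) * (c - 1)] and [(X - 1) * t], which are of higher order. Other points follow from the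
    functional equation [cexpD]. *)
Lemma is_derive_cexp0 : is_derive (0 : C R) (1 : C R) cexp 1.
Proof.
apply/is_derive_complexP => e e0.
have [q [q0 qe q1]] : exists q : R, [/\ 0 < q, q <= e / 16 & q <= 1].
  exists (Num.min (e / 16) 1); rewrite !ge_min !lexx orbT; split=> //.
  by rewrite lt_min ltr01 andbT; lra.
have [d1 d10 h1] := (is_derive_realP (@expR R) 0 1).1
  (is_derive_eq (is_derive_expR 0) (expR0 R)) _ q0.
have [d2 d20 h2] := (is_derive_realP (@cos R) 0 0).1
  (is_derive_eq (is_derive_cos 0) (etrans (congr1 -%R (sin0 R)) (oppr0 R))) _ q0.
have [d3 d30 h3] := (is_derive_realP (@sin R) 0 1).1
  (is_derive_eq (is_derive_sin 0) (cos0 R)) _ q0.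
exists (Num.min (Num.min d1 1) (Num.min d2 (Num.min d3 q))).
  by rewrite !lt_min d10 d20 d30 q0 ltr01.
move=> z; rewrite !lt_min -!andbA => /and5P[z1 z4 z2 z3 z5].
rewrite add0r cexp0 mulr1; apply: le_trans (normc_ler _) _.
have := normc_Re z; have := normc_Im z.
case: z z1 z2 z3 z4 z5 => x y; set n := normc _; rewrite /cexp /cis /=.
move=> z1 z2 z3 z4 z5 ny nx.
have {}h1 := h1 x (le_lt_trans nx z1).
have {}h2 := h2 y (le_lt_trans ny z2).
have {}h3 := h3 y (le_lt_trans ny z3).
rewrite !add0r expR0 sin0 cos0 in h1 h2 h3.
have n0 : 0 <= n by apply: le_trans nx.
set X := expR x in h1 *; set c := cos y in h2 *; set t := sin y in h3 *.
have {}h1 : `|X - 1 - x| <= q * n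
  by move: h1; rewrite mulr1 => /le_trans; apply; rewrite ler_pM2l.
have {}h2 : `|c - 1| <= q * n.
  by move: h2; rewrite mulr0 subr0 => /le_trans; apply; rewrite ler_pM2l.
have {}h3 : `|t - y| <= q * n.
  by move: h3; rewrite subr0 mulr1 => /le_trans; apply; rewrite ler_pM2l.
have qn : q * n <= 1 * n by rewrite ler_wpM2r.
have hE : `|X - 1| <= 2 * n.
  have := ler_normD (X - 1 - x) x; rewrite subrK; lra.
have ht : `|t| <= 2 * n.
  have := ler_normD (t - y) y; rewrite subrK; lra.
have p1 : `|(X - 1) * (c - 1)| <= 2 * n * q.
  rewrite normrM; apply: ler_pM => //; apply: le_trans h2 _.
  by rewrite -[leRHS]mulr1 ler_pM2l// ltW.
have p2 : `|(X - 1) * t| <= 2 * n * (2 * q).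
  rewrite normrM; apply: ler_pM => //; lra.
have -> : X * c - 0 * t - 1 - x = (X - 1 - x) + (c - 1) + (X - 1) * (c - 1) by ring.
have -> : X * t + 0 * c - 0 - y = (t - y) + (X - 1) * t by ring.
have := ler_normD (X - 1 - x + (c - 1)) ((X - 1) * (c - 1)).
have := ler_normD (X - 1 - x) (c - 1).
have := ler_normD (t - y) ((X - 1) * t).
have : q * n <= e / 16 * n by rewrite ler_wpM2r.
have : 0 <= e * n by rewrite mulr_ge0// ltW.
lra.
Qed.

Lemma is_derive_cexp z : is_derive z (1 : C R) cexp (cexp z).
Proof.
apply/is_derive_complexP => e e0.
pose M := normc (cexp z) + 1.
have M0 : 0 < M by rewrite ltr_wpDl ?normc_ge0.
have [d d0 hd] := (is_derive_complexP _ _ _).1 is_derive_cexp0 _ (divr_gt0 e0 M0).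
exists d => // h /hd; rewrite add0r cexp0 cexpD => H.
have -> : cexp z * cexp h - cexp z - h * cexp z = cexp z * (cexp h - 1 - h * 1).
  by ring.
rewrite normcM; apply: (@le_trans _ _ (M * (e / M * normc h))).
  by apply: ler_pM; rewrite ?normc_ge0// /M lerDl.
by rewrite mulrA [M * _]mulrC divfK ?lexx// gt_eqF.
Qed.

Lemma is_derive_complex_continuous f s l : is_derive s (1 : C R) f l ->
  {for s, continuous f}.
Proof. by move=> [/derivable1_diffP /differentiable_continuous]. Qed.

Lemma continuous_normcP (T : topologicalType) (f : T -> C R) x :
  {for x, continuous f} <->
  forall e : R, 0 < e -> \forall t \near x, normc (f t - f x) < e.
Proof.
split=> [/cvgrPdist_lt H e e0|H].
  have := H e%:C; rewrite ltcR => /(_ e0); apply: filterS => t.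
  by rewrite distrC normcP ltcR.
apply/cvgrPdist_lt => e e0.
have [e1 e2] : 0 < complex.Re e /\ e = (complex.Re e)%:C.
  by case: e e0 => a b; rewrite ltcE /= => /andP[/eqP -> ?].
by rewrite e2; apply: filterS (H _ e1) => t; rewrite distrC normcP ltcR.
Qed.

Lemma continuous_complexP (T : topologicalType) (f : T -> C R) x :
  {for x, continuous f} <->
  {for x, continuous (fun t => complex.Re (f t))} /\
  {for x, continuous (fun t => complex.Im (f t))}.
Proof.
have key := continuous_normcP f x.
split=> [/key H|[/cvgrPdist_lt H1 /cvgrPdist_lt H2]].
  split; apply/cvgrPdist_lt => e /H; apply: filterS => t; apply: le_lt_trans;
    rewrite distrC -raddfB; [exact: normc_Re|exact: normc_Im].
apply/key => e e0; have e20 : 0 < e / 2 by lra.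
near=> t; apply: le_lt_trans (normc_ler _) _; rewrite !raddfB /=.
have : `|complex.Re (f x) - complex.Re (f t)| < e / 2.
  by near: t; exact: H1.
have : `|complex.Im (f x) - complex.Im (f t)| < e / 2.
  by near: t; exact: H2.
rewrite [X in _ -> _ -> X + _ < _]distrC [X in _ -> _ -> _ + X < _]distrC; lra.
Unshelve. all: by end_near. Qed.

Lemma cvel_re f x y l : is_derive (x +i* y : C R) (1 : C R) f l ->
  cvel (fun t => f (t +i* y)) x l.
Proof.
move=> H; rewrite -[X in cvel _ _ X]mul1r.
apply: (@cvel_comp R (fun t => (t +i* y : C R)) x 1 f) => //.
by split => /=; [exact: is_derive_id|exact: is_derive_cst].
Qed.

Lemma cvel_im f x y l : is_derive (x +i* y : C R) (1 : C R) f l ->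
  cvel (fun t => f (x +i* t)) y ('i%C * l).
Proof.
move=> H.
apply: (@cvel_comp R (fun t => (x +i* t : C R)) y 'i%C f) => //.
by split => /=; [exact: is_derive_cst|exact: is_derive_id].
Qed.
End exponential.

(** * Integrals over the circle *)

Section circle_integrals.
Variable R : realType.
Implicit Types g h : R -> R[i].

Definition Icirc (c : R -> R) : R := \int[lebesgue_measure]_(t in `[0, 2 * pi]) c t.

Lemma twopi_gt0 : 0 < 2 * pi :> R.
Proof. by rewrite mulr_gt0// pi_gt0. Qed.

Lemma is_derive_continuous (F : R -> R) (x l : R) : is_derive x (1 : R) F l ->
  {for x, continuous F}.
Proof. by move=> [/derivable1_diffP /differentiable_continuous]. Qed.

Lemma Icirc_FTC (c F : R -> R) : continuous c ->
  (forall t, 0 <= t <= 2 * pi -> is_derive t (1 : R) F (c t)) ->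
  Icirc c = F (2 * pi) - F 0.
Proof.
move=> cc dF; have cF t : 0 <= t <= 2 * pi -> {for t, continuous F}.
  by move=> /dF /is_derive_continuous.
have p := twopi_gt0.
rewrite /Icirc /Rintegral (@continuous_FTC2 _ c F)//.
- exact: continuous_subspaceT.
- split.
  + by move=> x; rewrite in_itv /= => /andP[/ltW x1 /ltW x2]; case: (dF x) => //; apply/andP.
  + by apply: cvg_at_right_filter; apply: cF; rewrite lexx ltW.
  + by apply: cvg_at_left_filter; apply: cF; rewrite lexx ltW.
- move=> x; rewrite in_itv /= => /andP[/ltW x1 /ltW x2].
  by rewrite derive1E; case: (dF x) => //; apply/andP.
Qed.

Lemma Icirc_antider (c : R -> R) : continuous c ->
  exists2 F : R -> R, (forall t, 0 <= t <= 2 * pi -> is_derive t (1 : R) F (c t)) &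
  Icirc c = F (2 * pi) - F 0.
Proof.
(* The base point -1 lies to the left of 0, so that [F] is differentiable at the endpoint 0 as
   well. *)
move=> cc; have [F dF] := antiderivative_exists (-1) cc.
have dF' t : 0 <= t <= 2 * pi -> is_derive t (1 : R) F (c t).
  by move=> /andP[t0 _]; apply: dF; lra.
by exists F => //; exact: Icirc_FTC.
Qed.

Lemma Icirc_lin (c d : R -> R) (u v : R) : continuous c -> continuous d ->
  Icirc (fun t => u * c t + v * d t) = u * Icirc c + v * Icirc d.
Proof.
move=> cc cd; have [F dF ->] := Icirc_antider cc.
have [G dG ->] := Icirc_antider cd.
have -> : Icirc (fun t => u * c t + v * d t) =
  (u * F (2 * pi) + v * G (2 * pi)) - (u * F 0 + v * G 0).
  apply: (@Icirc_FTC _ (fun t => u * F t + v * G t)).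
    by move=> t; apply: cvgD; apply: cvgM => //;
      [exact: cvg_cst|exact: cc|exact: cvg_cst|exact: cd].
  move=> t ht; have := dF t ht; have := dG t ht => ? ?.
  by apply: is_derive_eq; rewrite /GRing.scale.
by ring.
Qed.

Lemma Icirc_le (c : R -> R) (M : R) : continuous c ->
  (forall t, 0 <= t <= 2 * pi -> `|c t| <= M) -> `|Icirc c| <= M * (2 * pi).
Proof.
move=> cc cM; have [F dF ->] := Icirc_antider cc.
have d0 t : 0 <= t <= 2 * pi -> is_derive t (1 : R) (cst (0 : R)) (0 : R).
  by move=> _; exact: is_derive_cst.
have := increment_le (ltW twopi_gt0) dF d0 (e := M).
rewrite /cst !subr0; apply => x hx.
by rewrite subr0 cM.
Qed.

Definition CI (g : R -> R[i]) : R[i] :=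
  Icirc (fun t => complex.Re (g t)) +i* Icirc (fun t => complex.Im (g t)).

Definition ccont (g : R -> R[i]) := continuous (g : R -> C R).

Lemma ccontP g : ccont g <-> continuous (fun t => complex.Re (g t)) /\
   continuous (fun t => complex.Im (g t)).
Proof.
split=> [H|[H1 H2] t]; last by apply/continuous_complexP; split; [exact: H1|exact: H2].
by split=> t; have /continuous_complexP[] := H t.
Qed.

Lemma ccontM g h : ccont g -> ccont h -> ccont (fun t => g t * h t).
Proof. by move=> cg ch t; apply: cvgM; [exact: cg|exact: ch]. Qed.

Lemma ccontD g h : ccont g -> ccont h -> ccont (fun t => g t + h t).
Proof. by move=> cg ch t; apply: cvgD; [exact: cg|exact: ch]. Qed.

Lemma ccont_cst (z : R[i]) : ccont (fun=> z).
Proof. by move=> t; exact: cvg_cst. Qed.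

Lemma CI_lin g h (u v : R[i]) : ccont g -> ccont h ->
  CI (fun t => u * g t + v * h t) = u * CI g + v * CI h.
Proof.
move=> /ccontP[g1 g2] /ccontP[h1 h2]; case: u v => a b [p q].
rewrite /CI.
have E1 : (fun t => complex.Re ((a +i* b) * g t + (p +i* q) * h t)) =
  (fun t => 1 * (a * complex.Re (g t) + (- b) * complex.Im (g t)) +
            1 * (p * complex.Re (h t) + (- q) * complex.Im (h t))).
  by apply/funext => t; case: (g t) (h t) => ? ? [? ?] /=; ring.
have E2 : (fun t => complex.Im ((a +i* b) * g t + (p +i* q) * h t)) =
  (fun t => 1 * (a * complex.Im (g t) + b * complex.Re (g t)) +
            1 * (p * complex.Im (h t) + q * complex.Re (h t))).
  by apply/funext => t; case: (g t) (h t) => ? ? [? ?] /=; ring.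
have cl (c d : R -> R) (u v : R) : continuous c -> continuous d ->
    continuous (fun t => u * c t + v * d t).
  by move=> cc cd t; apply: cvgD; apply: cvgM => //; [exact: cvg_cst|exact: cc|exact: cvg_cst|exact: cd].
rewrite E1 E2 !Icirc_lin //; try exact: cl.
by apply/eqP; rewrite eq_complex /=; apply/andP; split; apply/eqP; ring.
Qed.

(** Real and imaginary parts are bounded separately, hence [4 * pi] in place of the optimal
    [2 * pi]. *)
Lemma CI_le g (M : R) : ccont g ->
  (forall t, 0 <= t <= 2 * pi -> normc (g t) <= M) ->
  normc (CI g) <= M * (4 * pi).
Proof.
move=> /ccontP[g1 g2] gM; apply: le_trans (normc_ler _) _; rewrite /CI /=.
have := Icirc_le g1 (fun t ht => le_trans (normc_Re _) (gM t ht)).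
have := Icirc_le g2 (fun t ht => le_trans (normc_Im _) (gM t ht)); lra.
Qed.

Lemma cis_cont : ccont (@cis R).
Proof. by apply/ccontP; split; [exact: continuous_cos|exact: continuous_sin]. Qed.

Lemma cisN_cont : ccont (fun t => cis (- t) : R[i]).
Proof.
by move=> t; apply: (@continuous_comp _ _ _ (fun t => - t) (@cis R : R -> C R)); [exact: oppr_continuous|exact: cis_cont].
Qed.

Lemma CI_cst (z : R[i]) : CI (fun=> z) = (2 * pi)%:C * z.
Proof.
have Ic (r : R) : Icirc (fun=> r) = 2 * pi * r.
  have -> : Icirc (fun=> r) = 2 * pi * r - 0 * r.
    apply: (@Icirc_FTC _ (fun t => t * r)); first exact: cst_continuous.
    by move=> t _; apply: is_derive_eq; rewrite /GRing.scale /=; ring.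
  by ring.
rewrite /CI !Ic.
by case: z => a b; apply/eqP; rewrite eq_complex /=; apply/andP; split; apply/eqP; ring.
Qed.

Lemma CI_cisN : CI (fun t => cis (- t)) = 0.
Proof.
have /ccontP[c1 c2] := cisN_cont.
have p2 : 2 * pi = pi *+ 2 :> R by ring.
rewrite /CI.
have -> : Icirc (fun t => complex.Re (cis (- t))) = sin (2 * pi) - sin 0.
  by apply: Icirc_FTC => // t _; rewrite /= cosN; exact: is_derive_sin.
have -> : Icirc (fun t => complex.Im (cis (- t))) = cos (2 * pi) - cos 0.
  by apply: Icirc_FTC => // t _; rewrite /= sinN; exact: is_derive_cos.
by rewrite p2 cos0 sin0 sin2pi cos2pi !subrr.
Qed.

Lemma cis_2pi (t : R) : cis (t + 2 * pi) = cis t.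
Proof. by rewrite /cis [2 * pi]mulrC mulr_natr cosD2pi sinD2pi. Qed.
End circle_integrals.

(** * Circle integrals on different radii, compared in logarithmic polar coordinates *)

Section log_polar.
Variable R : realType.
Implicit Types (f k : C R -> C R) (a s : C R).

(* Goursat for h(eta) = k(a + e^eta) e^(-eta), which is 2 pi i-periodic: the
   contributions of the two horizontal sides cancel. *)
Lemma log_polar_mean k a (rho x0 x1 : R) :
  (forall z, normc (z - a) < rho -> derivable k z (1 : C R)) ->
  x0 < x1 -> expR x1 < rho ->
  let h z := k (a + cexp z) * cexp (- z) : C R in
  Icirc (fun t => complex.Im (h (x1 +i* t))) =
  Icirc (fun t => complex.Im (h (x0 +i* t))).
Proof.
move=> dk x01 x1r h.
have dh x y : x <= x1 -> is_derive (x +i* y : C R) (1 : C R) h ('D_1 h (x +i* y : C R)).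
  move=> xx1; apply: derivableP; set z : C R := x +i* y.
  have n1 : normc (a + cexp z - a) < rho.
    rewrite addrC addrA addNr add0r /cexp normcM normc_cis mulr1 normc_real.
    by rewrite ger0_norm ?expR_ge0//; apply: le_lt_trans x1r; rewrite ler_expR.
  have d1 : is_derive z (1 : C R) (fun w : C R => a + cexp w) (cexp z).
    by have := is_deriveD (is_derive_cst (a : C R) z 1) (is_derive_cexp z); rewrite add0r.
  have d2 := is_derive_complex_comp d1 (derivableP (dk _ n1)).
  have d3 : is_derive z (1 : C R) (fun w : C R => - w) (-1) by exact: is_deriveNid.
  have d4 := is_derive_complex_comp d3 (is_derive_cexp (- z)).
  have [D2 _] := d2; have [D4 _] := d4.
  exact: (derivableM D2 D4).
(* The form [A dx + B dy] is the real part of [h dz]; the Cauchy-Riemann equations provide the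
   common coefficient asked for by [goursat]. *)
pose A x y := complex.Re (h (x +i* y)); pose B x y := - complex.Im (h (x +i* y)).
have dhx x y (xx : x <= x1) := cvel_re (dh x y xx).
have dhy x y (xx : x <= x1) := cvel_im (dh x y xx).
(* Holomorphy of [h] is only established for [x <= x1]. Freezing the abscissa at [x1] gives a
   function continuous on the whole line, to which [antiderivative_exists] applies. *)
have cA y : continuous (fun x => A (Num.min x x1) y).
  move=> x; rewrite /A.
  have [H _] := dhx (Num.min x x1) y (ltac:(by rewrite ge_min lexx orbT)).
  apply: (@continuous_comp _ _ _ (fun x => Num.min x x1)
    (fun x => complex.Re (h (x +i* y)))).
    by apply: continuous_min; [exact: cvg_id|exact: cvg_cst].
  exact: is_derive_continuous H.
have cB x : x <= x1 -> continuous (B x).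
  move=> xx y; apply: cvgN; have [_ H] := dhy x y xx.
  exact: is_derive_continuous H.
have /choice[PA hPA] (y : R) : exists F : R -> R, forall x, x0 - 1 < x ->
    is_derive x (1 : R) F (A (Num.min x x1) y) by exact: antiderivative_exists.
have /choice[PB hPB] (x : R) : exists F : R -> R, x <= x1 ->
    (forall t, 0 <= t <= 2 * pi -> is_derive t (1 : R) F (B x t)) /\
    Icirc (B x) = F (2 * pi) - F 0.
  have [xx|] := leP x x1; last by exists (cst 0).
  by have [F F1 F2] := Icirc_antider (cB x xx); exists F.
have p := @twopi_gt0 R.
have hA y x : x0 <= x <= x1 -> is_derive x (1 : R) (PA y) (A x y).
  move=> /andP[xx0 xx1]; have := hPA y x; rewrite min_l//; apply; lra.
have G := @goursat R A B (fun x y => PA y x) PB x0 x1 0 (2 * pi) x01 p _ _ _.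
have {}G : PB x1 (2 * pi) - PB x1 0 - (PB x0 (2 * pi) - PB x0 0) =
   PA (2 * pi) x1 - PA (2 * pi) x0 - (PA 0 x1 - PA 0 x0).
  apply: G.
  - by move=> x y hx hy; exact: hA.
  - by move=> x y /andP[_ hx] hy; case: (hPB x hx) => + _; apply.
  move=> x y /andP[_ hx] hy; have Dh := dh x y hx.
  set D : R[i] := 'D_1 h _ in Dh; set z : C R := x +i* y in Dh.
  pose u := complex.Re D; pose v := - complex.Im D.
  exists (complex.Re (h z) - u * x - v * y), (- complex.Im (h z) - v * x + u * y), u, v, (- u).
  move=> e e0; have e20 : 0 < e by lra.
  have [d d0 hd] := (is_derive_complexP _ _ _).1 Dh _ e20.
  exists (d / 2); first lra.
  move=> x' y' hx' hy' h1 h2.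
  have nz : normc ((x' - x) +i* (y' - y)) <= `|x' - x| + `|y' - y| by exact: normc_ler.
  have := hd ((x' - x) +i* (y' - y)); rewrite (_ : z + _ = x' +i* y'); last first.
    by rewrite /z; apply/eqP; rewrite eq_complex /=; apply/andP; split; apply/eqP; ring.
  set q := _ - _ * _ => /(_ ltac:(lra)) H.
  have {}H : normc q <= e * (`|x' - x| + `|y' - y|).
    by apply: le_trans H _; rewrite ler_pM2l.
  have Dz : D = u +i* (- v) by rewrite /u /v opprK; case: (D).
  split.
    have -> : A x' y' - (complex.Re (h z) - u * x - v * y + u * x' + v * y') = complex.Re q.
      by rewrite /q /A Dz; case: (h z) (h (x' +i* y')) => ? ? [? ?] /=; ring.
    exact: le_trans (normc_Re _) H.
  have -> : B x' y' - (- complex.Im (h z) - v * x + u * y + v * x' + - u * y') = - complex.Im q.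
    by rewrite /q /B Dz; case: (h z) (h (x' +i* y')) => ? ? [? ?] /=; ring.
  by rewrite normrN; exact: le_trans (normc_Im _) H.
have hper x : h (x +i* (2 * pi)) = h (x +i* 0).
  have cp z : cexp (z + 0 +i* (2 * pi)) = cexp z :> R[i].
    by case: z => b c; rewrite /cexp /= addr0 cis_2pi.
  have -> : x +i* (2 * pi) = x +i* 0 + 0 +i* (2 * pi).
    by apply/eqP; rewrite eq_complex /=; apply/andP; split; apply/eqP; ring.
  rewrite /h cp; congr (_ * _).
  rewrite -[LHS]cp; congr cexp.
  by apply/eqP; rewrite eq_complex /=; apply/andP; split; apply/eqP; ring.
have per : PA (2 * pi) x1 - PA (2 * pi) x0 = PA 0 x1 - PA 0 x0.
  apply/eqP; rewrite -subr_eq0 -normr_le0.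
  have := increment_le (ltW x01) (hA (2 * pi)) (hA 0) (e := 0).
  rewrite mul0r; apply => x _.
  by rewrite /A hper subrr normr0.
move: G; rewrite per subrr -(hPB x1 (lexx _)).2 -(hPB x0 (ltW x01)).2 => /eqP.
rewrite subr_eq0 => /eqP.
have IN x : x <= x1 -> Icirc (fun t => complex.Im (h (x +i* t))) = - Icirc (B x).
  move=> xx; have := Icirc_lin (-1) 0 (cB x xx) (cB x xx).
  rewrite mul0r addr0 mulN1r => <-; congr Icirc.
  by apply/funext => t; rewrite /B; ring.
by rewrite (IN _ (lexx _)) (IN _ (ltW x01)) => ->.
Qed.
End log_polar.

(** * Cauchy's formula for the first derivative *)

Section cauchy.
Variable R : realType.
Implicit Types (f k : C R -> C R) (a s : C R).

Lemma circle_in a (r t rho : R) : 0 <= r < rho -> normc (a + r%:C * cis t - a) < rho.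
Proof.
move=> /andP[r0 rr]; rewrite addrC addrA addNr add0r normcM normc_cis mulr1.
by rewrite normc_real ger0_norm.
Qed.

Lemma ccont_circle f a (r : R) :
  (forall t, {for a + r%:C * cis t, continuous f}) ->
  ccont (fun t => f (a + r%:C * cis t)).
Proof.
move=> cf; have c1 : ccont (fun t => a + r%:C * cis t).
  by apply: ccontD; [exact: ccont_cst|apply: ccontM; [exact: ccont_cst|exact: cis_cont]].
by move=> t; apply: (@continuous_comp _ _ _ (fun t => a + r%:C * cis t : C R) f);
  [exact: c1|exact: cf].
Qed.

Lemma derivable_complex_continuous f a : derivable f a (1 : C R) ->
  {for a, continuous f}.
Proof. by move=> /derivableP /is_derive_complex_continuous. Qed.

(** By [log_polar_mean], the integral divided by the radius does not depend on the radius. Since [k]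
    and its derivative vanish at [a], the integral is o of the radius, so the constant quotient is
    0. *)
Lemma circle_integral_Im k a (rho r : R) :
  (forall z, normc (z - a) < rho -> derivable k z (1 : C R)) ->
  k a = 0 -> is_derive a (1 : C R) k (0 : C R) -> 0 < r < rho ->
  Icirc (fun t => complex.Im (k (a + r%:C * cis t) * cis (- t))) = 0.
Proof.
move=> dk ka /is_derive_complexP dka /andP[r0 rr].
have cI r' : 0 < r' < rho ->
    continuous (fun t => complex.Im (k (a + r'%:C * cis t) * cis (- t))).
  move=> /andP[r'0 r'r].
  have /ccontP[] // : ccont (fun t => k (a + r'%:C * cis t) * cis (- t)).
  apply: ccontM; last exact: cisN_cont.
  apply: ccont_circle => t; apply: derivable_complex_continuous; apply: dk.
  by apply: circle_in; rewrite r'r ltW.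
have key (x : R) : expR x < rho ->
    Icirc (fun t => complex.Im (k (a + cexp (x +i* t)) * cexp (- (x +i* t)))) =
    (expR x)^-1 * Icirc (fun t => complex.Im (k (a + (expR x)%:C * cis t) * cis (- t))).
  move=> xr.
  have cc := cI (expR x); have := Icirc_lin (expR x)^-1 0 (cc _) (cc _).
  rewrite mul0r addr0 => <-; rewrite ?expR_gt0//.
  congr Icirc; apply/funext => t; rewrite /cexp /= expRN mul0r addr0.
  by case: (k _) => p q; rewrite /cis /=; ring.
apply/eqP; rewrite -normr_le0; apply/ler_addgt0Pr => e e0; rewrite add0r.
(* This slope makes the bound on the small circle, once transported back to radius [r], equal to
   [e]. *)
have e10 : 0 < e / (r * (2 * pi)) by rewrite divr_gt0// mulr_gt0// twopi_gt0.
have [d d0 hd] := dka _ e10.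
pose x0 := Num.min (ln r) (ln d) - 1.
have x0r : x0 < ln r.
  have : Num.min (ln r) (ln d) <= ln r by rewrite ge_min lexx.
  rewrite /x0; lra.
have x0d : expR x0 < d.
  rewrite -[ltRHS]lnK ?posrE// ltr_expR /x0.
  have : Num.min (ln r) (ln d) <= ln d by rewrite ge_min lexx orbT.
  lra.
have E0 : expR x0 < rho.
  by apply: lt_trans rr; rewrite -[ltRHS]lnK ?posrE// ltr_expR.
have Er : expR (ln r) = r by rewrite lnK// posrE.
have := @log_polar_mean R k a rho x0 (ln r) dk x0r; rewrite Er => /(_ rr) /=.
rewrite !key ?Er// => M.
have -> : Icirc (fun t => complex.Im (k (a + r%:C * cis t) * cis (- t))) =
  r * ((expR x0)^-1 *
      Icirc (fun t => complex.Im (k (a + (expR x0)%:C * cis t) * cis (- t)))).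
  by rewrite -M mulrA mulfV ?mul1r// gt_eqF.
rewrite !normrM normfV (gtr0_norm r0) (gtr0_norm (expR_gt0 x0)).
have aux (P q : R) : 0 < P -> 0 < q -> e = r * (q^-1 * (e / (r * (2 * P)) * q * (2 * P))).
  by move=> P0 q0; field; rewrite !gt_eqF.
rewrite (aux pi (expR x0)) ?pi_gt0 ?expR_gt0//.
rewrite ler_pM2l// ler_pM2l ?invr_gt0 ?expR_gt0//.
apply: Icirc_le; first by apply: cI; rewrite expR_gt0.
move=> t _; apply: le_trans (normc_Im _) _; rewrite normcM normc_cis mulr1.
have nE : normc ((expR x0)%:C * cis t) = expR x0.
  by rewrite normcM normc_cis mulr1 normc_real gtr0_norm ?expR_gt0.
have := hd ((expR x0)%:C * cis t); rewrite nE => /(_ x0d).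
by rewrite ka mulr0 !subr0.
Qed.

Lemma circle_integral_zero k a (rho r : R) :
  (forall z, normc (z - a) < rho -> derivable k z (1 : C R)) ->
  k a = 0 -> is_derive a (1 : C R) k (0 : C R) -> 0 < r < rho ->
  CI (fun t => k (a + r%:C * cis t) * cis (- t)) = 0.
Proof.
move=> dk ka dka hr; apply/eqP; rewrite eq_complex /CI /=; apply/andP; split; apply/eqP.
  have E : (fun t => complex.Re (k (a + r%:C * cis t) * cis (- t))) =
      (fun t => complex.Im ('i%C * k (a + r%:C * cis t) * cis (- t))).
    by apply/funext => t; case: (k _) => p q; rewrite /cis /=; ring.
  have di : is_derive a (1 : C R) (fun z : C R => 'i%C * k z : C R) (0 : C R).
    have D := is_deriveM (is_derive_cst ('i%C : C R) a 1) dka.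
    by apply: (is_derive_eq D); rewrite [_ *: _]mulr0 [_ *: _]mulr0 addr0.
  rewrite E; apply: (circle_integral_Im _ _ di hr).
    by move=> z hz; apply: derivableM; [exact: derivable_cst|exact: dk].
  by rewrite ka mulr0.
exact: circle_integral_Im dk ka dka hr.
Qed.

(** Subtracting the affine part at [a] leaves a function to which [circle_integral_zero] applies. In
    the affine part the constant [f a] is multiplied by [cis (- t)] and integrates to 0, while the
    linear term becomes the constant [r * l] because [cis t * cis (- t) = 1]. *)
Lemma cauchy_derivative f a (rho r : R) :
  (forall z, normc (z - a) < rho -> derivable f z (1 : C R)) ->
  0 < r < rho ->
  CI (fun t => f (a + r%:C * cis t) * cis (- t)) =
  (2 * pi * r)%:C * 'D_1 f a.
Proof.
move=> df hr; have /andP[r0 rr] := hr.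
have da : derivable f a (1 : C R).
  by apply: df; rewrite subrr normc0; apply: lt_trans rr.
set l := 'D_1 f a.
pose k (z : C R) : C R := f z - (f a + (z - a) * l).
have daff z : is_derive z (1 : C R) (fun z : C R => f a + (z - a) * l) l.
  apply/is_derive_complexP => e e0; exists 1; rewrite ?ltr01// => h _.
  have -> : f a + (z + h - a) * l - (f a + (z - a) * l) - h * l = 0 by ring.
  by rewrite normc0 mulr_ge0 ?(ltW e0) ?normc_ge0.
have dk : is_derive a (1 : C R) k (0 : C R).
  have := is_deriveB (derivableP da) (daff a); rewrite subrr; exact.
have Z := @circle_integral_zero k a rho r _ _ dk hr.
have {}Z : CI (fun t => k (a + r%:C * cis t) * cis (- t)) = 0.
  apply: Z; last by rewrite /k subrr mul0r addr0 subrr.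
  move=> z hz; have [D1 _] := daff z; exact: (derivableB (df z hz) D1).
have cf : ccont (fun t => f (a + r%:C * cis t) * cis (- t)).
  apply: ccontM; last exact: cisN_cont.
  apply: ccont_circle => t; apply: derivable_complex_continuous; apply: df.
  by apply: circle_in; rewrite rr ltW.
have c2 : ccont (fun t => f a * cis (- t) + r%:C * l * 1).
  by apply: ccontD; [apply: ccontM; [exact: ccont_cst|exact: cisN_cont]|exact: ccont_cst].
have := CI_lin 1 (-1) cf c2.
have -> : (fun t => 1 * (f (a + r%:C * cis t) * cis (- t)) +
    -1 * (f a * cis (- t) + r%:C * l * 1)) =
    (fun t => k (a + r%:C * cis t) * cis (- t)).
  apply/funext => t; rewrite /k.
  have cc : cis t * cis (- t) = 1 :> R[i].
    rewrite /cis cosN sinN; apply/eqP; rewrite eq_complex /=; apply/andP; split; apply/eqP; last ring.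
    by rewrite mulrN opprK -[cos t * _]expr2 -[sin t * _]expr2 cos2Dsin2.
  by rewrite -[X in _ + -1 * (_ + _ * X) = _]cc; ring.
rewrite Z CI_lin; [|exact: cisN_cont|exact: ccont_cst].
rewrite CI_cisN CI_cst mulr0 add0r mulr1 mul1r mulN1r => /eqP.
rewrite eq_sym subr_eq0 => /eqP ->; rewrite [RHS]mulrC rmorphM /=.
by rewrite -[l]/(l : R[i]); ring.
Qed.
End cauchy.

(** * The derivative of a complex differentiable function is differentiable *)

Section regularity.
Variable R : realType.
Implicit Types (f k : C R -> C R) (a s : C R).

Lemma ccont_lin (g h : R -> R[i]) (u v : R[i]) : ccont g -> ccont h ->
  ccont (fun t => u * g t + v * h t).
Proof.
move=> cg ch.
exact: (@ccontD R (fun t => u * g t) (fun t => v * h t)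
  (@ccontM R (fun=> u) g (@ccont_cst R u) cg)
  (@ccontM R (fun=> v) h (@ccont_cst R v) ch)).
Qed.

(** The tube lemma for the compact interval of angles: a property that is locally uniform in the
    angle holds for all angles with one [d]. *)
Lemma circle_uniform (P : R -> R[i] -> Prop) :
  (forall t, 0 <= t <= 2 * pi -> exists2 d : R, 0 < d &
     forall t' h, `|t' - t| < d -> normc h < d -> P t' h) ->
  exists2 d : R, 0 < d &
    forall t h, 0 <= t <= 2 * pi -> normc h < d -> P t h.
Proof.
move=> H; have /compact_near_coveringP := @segment_compact R 0 (2 * pi).
move=> /(_ (C R) (nbhs (0 : C R)) (fun h t => P t h) _) K.
have /nbhs_complexP[d d0 hd] : \forall h \near (0 : C R),
    `[0, 2 * pi]%classic `<=` (fun t => P t h).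
  apply: K => t; rewrite /= in_itv /= => /H[d d0 hd].
  exists ([set t' | `|t' - t| < d], [set h : C R | normc h < d]) => /=.
    split; first by apply/nbhs_realP; exists d.
    by apply/nbhs_complexP; exists d => // z; rewrite subr0.
  by move=> [t' h] /= [h1 h2]; exact: hd.
exists d => // t h ht hh; apply: hd; first by rewrite subr0.
by rewrite /= in_itv.
Qed.

Lemma circle_uniform2 s (r : R) (Q : R[i] -> R[i] -> Prop) :
  (forall t, exists2 d : R, 0 < d & forall z w,
     normc (z - (s + r%:C * cis t)) < d -> normc (w - (s + r%:C * cis t)) < d -> Q z w) ->
  exists2 d : R, 0 < d & forall t h, 0 <= t <= 2 * pi -> normc h < d ->
    Q (s + r%:C * cis t) (s + r%:C * cis t + h).
Proof.
move=> H; apply: (@circle_uniform (fun t h =>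
  Q (s + r%:C * cis t) (s + r%:C * cis t + h))) => t _.
have [d d0 hd] := H t.
have c1 : ccont (fun t => s + r%:C * cis t).
  by apply: ccontD; [exact: ccont_cst|apply: ccontM; [exact: ccont_cst|exact: cis_cont]].
have /continuous_normcP/(_ (d / 2)) := c1 t.
case/(_ ltac:(lra))/nbhs_realP => d' d'0 hd'.
exists (Num.min d' (d / 2)); first by rewrite lt_min d'0; lra.
move=> t' h; rewrite !lt_min => /andP[/hd' h1 _] /andP[_ h2].
apply: hd; first lra.
rewrite addrAC; apply: le_lt_trans (le_normcD _ _) _; lra.
Qed.

Lemma complex_continuousP f s : {for s, continuous f} <->
  forall e : R, 0 < e -> exists2 d : R, 0 < d &
    forall z, normc (z - s) < d -> normc (f z - f s) < e.
Proof.
split=> [/continuous_normcP H e /H /nbhs_complexP//|H].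
by apply/continuous_normcP => e /H ?; apply/nbhs_complexP.
Qed.

(** The mean value inequality along the segment from [w] to [w'], which stays in the disc by
    convexity. Real and imaginary parts are treated separately, hence the factor 2. *)
Lemma complex_increment_le f s (d e : R) (l : R[i]) :
  (forall z, normc (z - s) < d -> derivable f z (1 : C R)) ->
  (forall z, normc (z - s) < d -> normc ('D_1 f z - l) <= e) ->
  forall w w', normc (w - s) < d -> normc (w' - s) < d ->
  normc (f w' - f w - (w' - w) * l) <= 2 * e * normc (w' - w).
Proof.
move=> df fl w w' hw hw'.
pose c (t : R) : C R := w + t%:C * (w' - w).
have hc t : 0 <= t <= 1 -> normc (c t - s) < d.
  move=> /andP[t0 t1].
  have -> : c t - s = (1 - t)%:C * (w - s) + t%:C * (w' - s).
    by rewrite /c rmorphB rmorph1; ring.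
  apply: le_lt_trans (le_normcD _ _) _; rewrite !normcM !normc_real.
  rewrite ger0_norm ?subr_ge0// (ger0_norm t0).
  have [->|tn0] := eqVneq t 0; first by rewrite mul0r subr0 mul1r addr0.
  have t0' : 0 < t by rewrite lt_neqAle eq_sym tn0.
  have : t * normc (w' - s) < t * d by rewrite ltr_pM2l.
  have : (1 - t) * normc (w - s) <= (1 - t) * d by rewrite ler_wpM2l ?subr_ge0// ltW.
  lra.
have dc t : cvel c t (w' - w).
  apply/cvelP => e' e'0; exists 1; rewrite ?ltr01// => h _.
  have -> : c (t + h) - c t - h%:C * (w' - w) = 0.
    by rewrite /c rmorphD /=; ring.
  by rewrite normc0 mulr_ge0 ?(ltW e'0).
have dfc t : 0 <= t <= 1 -> cvel (f \o c) t ((w' - w) * 'D_1 f (c t)).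
  by move=> ht; apply: cvel_comp (dc t) (derivableP (df _ (hc _ ht))).
have dl t : cvel (fun t => t%:C * ((w' - w) * l)) t ((w' - w) * l).
  apply/cvelP => e' e'0; exists 1; rewrite ?ltr01// => h _.
  have -> : (t + h)%:C * ((w' - w) * l) - t%:C * ((w' - w) * l) - h%:C * ((w' - w) * l) = 0.
    by rewrite rmorphD /=; ring.
  by rewrite normc0 mulr_ge0 ?(ltW e'0).
have bd t : 0 <= t <= 1 -> normc ((w' - w) * 'D_1 f (c t) - (w' - w) * l) <= e * normc (w' - w).
  by move=> ht; rewrite -mulrBr normcM mulrC ler_wpM2r ?normc_ge0// fl ?hc.
have c0 : c 0 = w by rewrite /c rmorph0 mul0r addr0.
have c1 : c 1 = w' by rewrite /c rmorph1 mul1r addrC subrK.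
have X1 : `|complex.Re (f w' - f w - (w' - w) * l)| <= e * normc (w' - w).
  have := increment_le ler01 (fun t ht => (dfc t ht).1) (fun t _ => (dl t).1)
    (e := e * normc (w' - w)).
  rewrite /= c0 c1 subr0 mulr1 mul1r mul0r [complex.Re 0]/= subr0 -!raddfB; apply.
  by move=> t ht; rewrite -raddfB; exact: le_trans (normc_Re _) (bd t ht).
have X2 : `|complex.Im (f w' - f w - (w' - w) * l)| <= e * normc (w' - w).
  have := increment_le ler01 (fun t ht => (dfc t ht).2) (fun t _ => (dl t).2)
    (e := e * normc (w' - w)).
  rewrite /= c0 c1 subr0 mulr1 mul1r mul0r [complex.Im 0]/= subr0 -!raddfB; apply.
  by move=> t ht; rewrite -raddfB; exact: le_trans (normc_Im _) (bd t ht).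
apply: le_trans (normc_ler _) _; lra.
Qed.

Lemma near_ball (P : C R -> Prop) s : (\forall z \near s, P z) ->
  exists2 d : R, 0 < d & forall z : C R, normc (z - s) < d -> P z.
Proof. by move/nbhs_complexP. Qed.

(** Near [s] the derivative is a circle integral of [f] with a fixed radius, and [f] is uniformly
    continuous near the circle around [s]. *)
Lemma deriv_continuous f s : (\forall z \near s, derivable f z (1 : C R)) ->
  {for s, continuous ('D_1 f : C R -> C R)}.
Proof.
move=> /near_ball[rho rho0 df].
(* With half the radius, the circles of radius [r] around all centres closer than [r] to [s] stay in
   the disc of radius [rho], so one radius serves all these centres. *)
pose r := rho / 2; have r0 : 0 < r by rewrite /r; lra.
have dfz z : normc (z - s) < r -> forall w, normc (w - z) < r + (r - normc (z - s)) ->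
    derivable f w (1 : C R).
  move=> zr w wr; apply: df; rewrite -(subrK z w) -addrA.
  apply: le_lt_trans (le_normcD _ _) _; rewrite /r in wr zr *; lra.
have cauchy z : normc (z - s) < r -> 'D_1 f z =
    ((2 * pi * r)^-1)%:C * CI (fun t => f (z + r%:C * cis t) * cis (- t)).
  move=> zr; rewrite (cauchy_derivative (dfz z zr)); last by rewrite r0 ltrDl subr_gt0.
  rewrite mulrA -rmorphM mulVf ?rmorph1 ?mul1r//.
  by rewrite gt_eqF// mulr_gt0// twopi_gt0.
have cc z : normc (z - s) < r -> ccont (fun t => f (z + r%:C * cis t) * cis (- t)).
  move=> zr; apply: ccontM; last exact: cisN_cont.
  apply: ccont_circle => t; apply: derivable_complex_continuous; apply: (dfz z zr).
  by apply: circle_in; rewrite ltW//= ltrDl subr_gt0.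
apply/complex_continuousP => e e0.
pose K := (2 * pi * r)^-1 * (4 * pi).
have K0 : 0 < K by rewrite mulr_gt0 ?invr_gt0 ?mulr_gt0 ?pi_gt0.
have e20 : 0 < e / (2 * K) by rewrite divr_gt0// mulr_gt0.
have s0 : normc (s - s) < r by rewrite subrr normc0.
case: (@circle_uniform2 s r (fun z w => normc (f w - f z) <= e / (2 * K))) => [|d d0 hd].
  move=> t; have /complex_continuousP cf : {for s + r%:C * cis t, continuous f}.
    apply: derivable_complex_continuous; apply: (dfz s s0).
    by apply: circle_in; rewrite ltW//= ltrDl subr_gt0.
  have e40 : 0 < e / (2 * K) / 2 by lra.
  have [d d0 hd] := cf _ e40.
  exists d => // z w /hd hz /hd hw; rewrite -[f w](subrK (f (s + r%:C * cis t))) -addrA.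
  apply: le_trans (le_normcD _ _) _.
  rewrite -normcN opprB in hz; lra.
exists (Num.min d r); first by rewrite lt_min d0.
move=> z; rewrite lt_min => /andP[zd zr].
rewrite !cauchy// -mulrBr normcM normc_real.
have := CI_lin 1 (-1) (cc _ zr) (cc _ s0).
rewrite !mul1r mulN1r => <-.
have cl : ccont (fun t => 1 * (f (z + r%:C * cis t) * cis (- t)) +
    -1 * (f (s + r%:C * cis t) * cis (- t))).
  by apply: ccontD; apply: ccontM; [exact: ccont_cst|exact: cc|exact: ccont_cst|exact: cc].
have p0 : 0 < (2 * pi * r)^-1 by rewrite invr_gt0 mulr_gt0// twopi_gt0.
have : normc (CI (fun t => 1 * (f (z + r%:C * cis t) * cis (- t)) +
    -1 * (f (s + r%:C * cis t) * cis (- t)))) <= e / (2 * K) * (4 * pi).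
  apply: CI_le => // t ht.
  rewrite mul1r mulN1r -mulrBl normcM normc_cis mulr1.
  by have := hd t (z - s) ht zd; rewrite addrAC [s + (z - s)]addrC subrK.
rewrite -(ler_pM2l p0) (gtr0_norm p0) => /le_lt_trans; apply.
have -> : (2 * pi * r)^-1 * (e / (2 * K) * (4 * pi)) = e / (2 * K) * K by rewrite /K; ring.
have -> : e / (2 * K) * K = e / 2 by field; rewrite gt_eqF.
lra.
Qed.

(** Continuity of the derivative makes the first-order estimate uniform in the base point [z]. This
    is what allows differentiation under the circle integral. *)
Lemma strict_derivative f s (e : R) : (\forall z \near s, derivable f z (1 : C R)) ->
  0 < e -> exists2 d : R, 0 < d & forall z w : C R,
    normc (z - s) < d -> normc (w - s) < d ->
    normc (f w - f z - (w - z) * 'D_1 f z) <= e * normc (w - z).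
Proof.
move=> df e0; have /complex_continuousP cf := deriv_continuous df.
have [d1 d10 h1] := near_ball df.
have e40 : 0 < e / 4 by lra.
have [d2 d20 h2] := cf _ e40.
exists (Num.min d1 d2); first by rewrite lt_min d10.
move=> z w hz hw.
have H : normc (f w - f z - (w - z) * 'D_1 f s) <= 2 * (e / 4) * normc (w - z).
  apply: (@complex_increment_le f s (Num.min d1 d2) (e / 4)) => // u;
    rewrite lt_min => /andP[u1 u2]; first exact: h1.
  by apply: ltW; exact: h2.
have aux (a b c u v : R[i]) : b - a - c * u = (b - a - c * v) + c * (v - u) by ring.
rewrite (aux _ _ _ _ ('D_1 f s)).
apply: le_trans (le_normcD _ _) _; rewrite normcM.
have h3 : normc (w - z) * normc ('D_1 f s - 'D_1 f z) <= normc (w - z) * (e / 4).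
  rewrite ler_wpM2l ?normc_ge0// -normcN opprB ltW// h2//.
  by move: hz; rewrite lt_min => /andP[].
apply: (le_trans (lerD H h3)).
have : 0 <= e * normc (w - z) by rewrite mulr_ge0 ?normc_ge0 ?(ltW e0).
set n := normc (w - z); lra.
Qed.

(** Cauchy's formula is differentiated in the centre of the circle: [strict_derivative] at each
    point of the circle, made uniform by [circle_uniform2], controls the difference quotient of the
    integrand. *)
Lemma deriv_derivable f s : (\forall z \near s, derivable f z (1 : C R)) ->
  derivable ('D_1 f : C R -> C R) s (1 : C R).
Proof.
move=> /near_ball[rho rho0 df].
have ndf z : normc (z - s) < rho -> \forall w \near z, derivable f w (1 : C R).
  move=> hz; apply/nbhs_complexP; exists (rho - normc (z - s)); rewrite ?subr_gt0//.
  move=> w hw; apply: df; rewrite -(subrK z w) -addrA.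
  apply: le_lt_trans (le_normcD _ _) _; lra.
pose r := rho / 2; have r0 : 0 < r by rewrite /r; lra.
have dfz z : normc (z - s) < r -> forall w, normc (w - z) < r + (r - normc (z - s)) ->
    derivable f w (1 : C R).
  move=> zr w wr; apply: df; rewrite -(subrK z w) -addrA.
  apply: le_lt_trans (le_normcD _ _) _; rewrite /r in wr zr *; lra.
have cauchy z : normc (z - s) < r -> 'D_1 f z =
    ((2 * pi * r)^-1)%:C * CI (fun t => f (z + r%:C * cis t) * cis (- t)).
  move=> zr; rewrite (cauchy_derivative (dfz z zr)); last by rewrite r0 ltrDl subr_gt0.
  rewrite mulrA -rmorphM mulVf ?rmorph1 ?mul1r//.
  by rewrite gt_eqF// mulr_gt0// twopi_gt0.
have cc z : normc (z - s) < r -> ccont (fun t => f (z + r%:C * cis t) * cis (- t)).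
  move=> zr; apply: ccontM; last exact: cisN_cont.
  apply: ccont_circle => t; apply: derivable_complex_continuous; apply: (dfz z zr).
  by apply: circle_in; rewrite ltW//= ltrDl subr_gt0.
have inr t : normc (s + r%:C * cis t - s) < rho.
  by apply: circle_in; rewrite ltW//= /r; lra.
have ccd : ccont (fun t => 'D_1 f (s + r%:C * cis t) * cis (- t)).
  apply: ccontM; last exact: cisN_cont.
  apply: (@ccont_circle _ ('D_1 f : C R -> C R)) => t.
  by apply: deriv_continuous; exact: ndf.
(* The candidate for the second derivative: Cauchy's formula with [f] replaced by its derivative. *)
pose l := ((2 * pi * r)^-1)%:C * CI (fun t => 'D_1 f (s + r%:C * cis t) * cis (- t)).
suff [] : is_derive s (1 : C R) ('D_1 f : C R -> C R) (l : C R) by [].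
apply/is_derive_complexP => e e0.
pose K := (2 * pi * r)^-1 * (4 * pi).
have K0 : 0 < K by rewrite mulr_gt0 ?invr_gt0 ?mulr_gt0 ?pi_gt0.
have e20 : 0 < e / K by rewrite divr_gt0.
have s0 : normc (s - s) < r by rewrite subrr normc0.
have [d d0 hd] := @circle_uniform2 s r (fun z w =>
  normc (f w - f z - (w - z) * 'D_1 f z) <= e / K * normc (w - z))
  (fun t => strict_derivative (ndf _ (inr t)) e20).
exists (Num.min d r); first by rewrite lt_min d0.
move=> h; rewrite lt_min => /andP[hd1 hr].
have zr : normc (s + h - s) < r by rewrite addrAC subrr add0r.
pose g1 t : R[i] := f (s + h + r%:C * cis t) * cis (- t).
pose g2 t : R[i] := f (s + r%:C * cis t) * cis (- t).
pose g3 t : R[i] := 'D_1 f (s + r%:C * cis t) * cis (- t).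
have c1 : ccont g1 := cc _ zr.
have c2 : ccont g2 := cc _ s0.
have c3 : ccont g3 := ccd.
have c12 : ccont (fun t => 1 * g1 t + -1 * g2 t).
  exact: (@ccont_lin g1 g2 1 (-1) c1 c2).
have aux (p a b c q : R[i]) : p * a - p * b - q * (p * c) =
  p * (1 * (1 * a + -1 * b) + (- q) * c) by ring.
pose G t : R[i] := 1 * (1 * g1 t + -1 * g2 t) + (- (h : R[i])) * g3 t.
have E : 'D_1 f (s + h) - 'D_1 f s - h * l = ((2 * pi * r)^-1)%:C * CI G.
  rewrite (cauchy _ zr) (cauchy _ s0) (CI_lin 1 (- (h : R[i])) c12 c3).
  rewrite (CI_lin 1 (-1) c1 c2).
  exact: aux.
rewrite E normcM normc_real.
have p0 : 0 < (2 * pi * r)^-1 by rewrite invr_gt0 mulr_gt0// twopi_gt0.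
rewrite (gtr0_norm p0).
have : normc (CI G) <= e / K * normc h * (4 * pi).
  apply: CI_le => [|t ht].
    exact: (@ccont_lin _ g3 1 (- (h : R[i])) c12 c3).
  have := hd t h ht hd1.
  rewrite [s + _ + h - _]addrAC subrr add0r => H; apply: le_trans H.
  rewrite le_eqVlt; apply/orP; left; apply/eqP.
  rewrite -[RHS]mulr1 -[X in _ = _ * X](normc_cis (- t)) -normcM; congr normc.
  have aux2 (x y z u v : R[i]) : 1 * (1 * (x * u) + -1 * (y * u)) + (- v) * (z * u) =
    (x - y - v * z) * u by ring.
  by rewrite /G /g1 /g2 /g3 aux2 [s + h + _]addrAC.
rewrite -(ler_pM2l p0) => /le_trans; apply.
have -> : (2 * pi * r)^-1 * (e / K * normc h * (4 * pi)) = e / K * K * normc h by rewrite /K; ring.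
by rewrite divfK ?lexx// gt_eqF.
Qed.

Theorem deriv_derivable_near f s : (\forall z \near s, derivable f z (1 : C R)) ->
  \forall z \near s, derivable ('D_1 f : C R -> C R) z (1 : C R).
Proof.
move=> /near_join; apply: filterS => z; exact: deriv_derivable.
Qed.
End regularity.

(** * Wirtinger derivatives and jets of projective curves *)

Section wirtinger.
Variable R : realType.
Implicit Types (c d : R -> R[i]) (F G : C R -> R[i]) (s : C R) (t : R).

Lemma cvel_cst (z : R[i]) t : cvel (fun=> z) t 0.
Proof. by split; exact: is_derive_cst. Qed.

Lemma cvelD c d t u v : cvel c t u -> cvel d t v -> cvel (fun x => c x + d x) t (u + v).
Proof.
move=> [c1 c2] [d1 d2]; split.
  have -> : (fun x => complex.Re (c x + d x)) = (fun x => complex.Re (c x) + complex.Re (d x)).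
    by apply/funext => x; rewrite raddfD.
  by rewrite raddfD; exact: is_deriveD.
have -> : (fun x => complex.Im (c x + d x)) = (fun x => complex.Im (c x) + complex.Im (d x)).
  by apply/funext => x; rewrite raddfD.
by rewrite raddfD; exact: is_deriveD.
Qed.

Lemma cvelM c d t u v : cvel c t u -> cvel d t v ->
  cvel (fun x => c x * d x) t (u * d t + c t * v).
Proof.
move=> [c1 c2] [d1 d2]; split.
  have -> : (fun x => complex.Re (c x * d x)) = (fun x =>
      complex.Re (c x) * complex.Re (d x) - complex.Im (c x) * complex.Im (d x)).
    by apply/funext => x; case: (c x) (d x) => ? ? [].
  apply: is_derive_eq; rewrite /GRing.scale /=.
  by case: (c t) (d t) u v {c1 c2 d1 d2} => ? ? [? ?] [? ?] [? ?] /=; ring.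
have -> : (fun x => complex.Im (c x * d x)) = (fun x =>
    complex.Re (c x) * complex.Im (d x) + complex.Im (c x) * complex.Re (d x)).
  by apply/funext => x; case: (c x) (d x) => ? ? [].
apply: is_derive_eq; rewrite /GRing.scale /=.
by case: (c t) (d t) u v {c1 c2 d1 d2} => ? ? [? ?] [? ?] [? ?] /=; ring.
Qed.

Lemma cvel_conj c t u : cvel c t u -> cvel (fun x => (c x)^*%R) t u^*%R.
Proof.
move=> [c1 c2]; split.
  have -> : (fun x => complex.Re (c x)^*%R) = (fun x => complex.Re (c x)).
    by apply/funext => x; case: (c x).
  by case: u c1 c2.
have -> : (fun x => complex.Im (c x)^*%R) = (fun x => - complex.Im (c x)).
  by apply/funext => x; case: (c x).
have -> : complex.Im u^*%R = - complex.Im u by case: u {c1 c2}.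
exact: is_deriveN.
Qed.

Lemma is_derive_complex_inv (z : C R) : z != 0 ->
  is_derive z (1 : C R) (fun w : C R => w^-1 : C R) (- z ^- 2 : C R).
Proof.
move=> z0; have D := @derivable_id _ (C R) z (1 : C R).
apply: DeriveDef; first by have := @derivableV _ (C R) id z (1 : C R) z0 D.
have := @deriveV _ (C R) id z (1 : C R) z0 D.
by rewrite derive_id [_ *: _]mulr1.
Qed.

Lemma cvelV c t u : cvel c t u -> c t != 0 -> cvel (fun x => (c x)^-1) t (- u / c t ^+ 2).
Proof.
move=> cc c0; have := cvel_comp cc (is_derive_complex_inv c0).
by rewrite mulrN -mulNr.
Qed.

(* The Wirtinger derivatives of F at s are u and v: the partial derivatives
   in x and y are u + v and i (u - v). *)
Definition wder F s (u v : R[i]) :=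
  cvel (fun t => F (t +i* complex.Im s)) (complex.Re s) (u + v) /\
  cvel (fun t => F (complex.Re s +i* t)) (complex.Im s) ('i%C * (u - v)).

Lemma wder_eq F s u v u' v' : wder F s u v -> u = u' -> v = v' -> wder F s u' v'.
Proof. by move=> ? <- <-. Qed.

Lemma wder_cst (z : R[i]) s : wder (fun=> z) s 0 0.
Proof. by split; rewrite ?subrr ?mulr0 ?addr0; exact: cvel_cst. Qed.

Lemma wderD F G s u v u' v' : wder F s u v -> wder G s u' v' ->
  wder (fun z => F z + G z) s (u + u') (v + v').
Proof.
move=> [F1 F2] [G1 G2]; split.
  by rewrite addrACA; exact: cvelD.
have -> : 'i%C * (u + u' - (v + v')) = 'i%C * (u - v) + 'i%C * (u' - v') by ring.
exact: cvelD.
Qed.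

Lemma wderM F G s u v u' v' : wder F s u v -> wder G s u' v' ->
  wder (fun z => F z * G z) s (u * G s + F s * u') (v * G s + F s * v').
Proof.
case: s => x y; move=> [F1 F2] [G1 G2]; split => /=.
  have := cvelM F1 G1 => /=; congr cvel; ring.
have := cvelM F2 G2 => /=; congr cvel; ring.
Qed.

Lemma wderN F s u v : wder F s u v -> wder (fun z => - F z) s (- u) (- v).
Proof.
move=> H; have := wderM (wder_cst (-1) s) H.
rewrite !mul0r !add0r !mulN1r.
by have -> : (fun z => -1 * F z) = (fun z => - F z) by apply/funext => z; rewrite mulN1r.
Qed.

Lemma wderV F s u v : wder F s u v -> F s != 0 ->
  wder (fun z => (F z)^-1) s (- u / F s ^+ 2) (- v / F s ^+ 2).
Proof.
case: s => x y; move=> [F1 F2] F0; split => /=.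
  have := cvelV F1 F0 => /=; congr cvel; ring.
have := cvelV F2 F0 => /=; congr cvel; ring.
Qed.

Lemma wder_conj F s u v : wder F s u v -> wder (fun z => (F z)^*%R) s v^*%R u^*%R.
Proof.
move=> [F1 F2]; split => /=.
  by have := cvel_conj F1; rewrite rmorphD addrC.
have := cvel_conj F2; congr cvel; rewrite rmorphM rmorphB /=.
by apply/eqP; rewrite eq_complex; case: u v {F1 F2} => ? ? [? ?] /=; apply/andP; split; apply/eqP; ring.
Qed.

Lemma wder_holomorphic (f : C R -> C R) s (l : C R) :
  is_derive s (1 : C R) f l -> wder f s l 0.
Proof.
case: s => x y H; split => /=.
  by rewrite addr0; exact: cvel_re.
by rewrite subr0; exact: cvel_im.
Qed.

Lemma wder_sum (I : finType) (F : I -> C R -> R[i]) s (u v : I -> R[i]) :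
  (forall i, wder (F i) s (u i) (v i)) ->
  wder (fun z => \sum_i F i z) s (\sum_i u i) (\sum_i v i).
Proof.
move=> H; have K (r : seq I) : wder (fun z => \sum_(i <- r) F i z) s (\sum_(i <- r) u i) (\sum_(i <- r) v i).
  elim: r => [|i r IH].
    rewrite !big_nil; have -> : (fun z => \sum_(i <- [::]) F i z) = (fun=> 0).
      by apply/funext => z; rewrite big_nil.
    exact: wder_cst.
  rewrite !big_cons; have -> : (fun z => \sum_(j <- i :: r) F j z) =
      (fun z => F i z + \sum_(j <- r) F j z).
    by apply/funext => z; rewrite big_cons.
  exact: wderD.
exact: K.
Qed.
End wirtinger.

Section hdot.
Variables (R : realType) (n : nat).
Implicit Types (u v w : Cvec R n) (a b : R[i]).

Lemma hdotDl u v w : hdot (u + v) w = hdot u w + hdot v w.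
Proof. by rewrite /hdot -big_split; apply: eq_bigr => k _; rewrite mxE mulrDl. Qed.

Lemma hdotZl a u w : hdot (a *: u) w = a * hdot u w.
Proof. by rewrite /hdot mulr_sumr; apply: eq_bigr => k _; rewrite mxE mulrA. Qed.

Lemma hdotC u v : hdot v u = (hdot u v)^*%R.
Proof.
rewrite /hdot rmorph_sum; apply: eq_bigr => k _.
by rewrite rmorphM /= conjCK mulrC.
Qed.

Lemma hdotDr u v w : hdot w (u + v) = hdot w u + hdot w v.
Proof. by rewrite hdotC hdotDl rmorphD /= -!hdotC. Qed.

Lemma hdotZr a u w : hdot w (a *: u) = a^*%R * hdot w u.
Proof. by rewrite hdotC hdotZl rmorphM /= -!hdotC. Qed.

Lemma hdot0l u : hdot 0 u = 0.
Proof. by rewrite -(scale0r 0) hdotZl mul0r. Qed.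

Definition hnorm2 u : R := \sum_k (complex.Re (u 0 k) ^+ 2 + complex.Im (u 0 k) ^+ 2).

Lemma hdotE u : hdot u u = (hnorm2 u)%:C.
Proof.
rewrite /hdot /hnorm2 rmorph_sum /=; apply: eq_bigr => k _.
by case: (u 0 k) => x y /=; apply/eqP; rewrite eq_complex /=; apply/andP; split; apply/eqP; ring.
Qed.

Lemma hnorm2_ge0 u : 0 <= hnorm2 u.
Proof. by apply: sumr_ge0 => k _; rewrite addr_ge0 ?sqr_ge0. Qed.

Lemma hnorm2_eq0 u : (hnorm2 u == 0) = (u == 0).
Proof.
apply/eqP/eqP => [/eqP|->]; last by rewrite /hnorm2 big1// => k _; rewrite mxE /=; ring.
rewrite psumr_eq0 => [/allP H|k _]; last by rewrite addr_ge0 ?sqr_ge0.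
apply/rowP => k; rewrite mxE; have := H k (mem_index_enum k).
rewrite paddr_eq0 ?sqr_ge0// !sqrf_eq0; case: (u 0 k) => x y /= /andP[/eqP -> /eqP ->].
by [].
Qed.

Lemma hnorm2_gt0 u : (0 < hnorm2 u) = (u != 0).
Proof. by rewrite lt_neqAle hnorm2_ge0 andbT eq_sym hnorm2_eq0. Qed.
End hdot.

(** * Hermitian invariants of the jet of a lift *)

Section jets.
Variables (R : realType) (n : nat).
Implicit Types (f u v w : Cvec R n) (a b h : R[i]).

(** The Gram determinant of [f] and [f1]. Along a holomorphic curve [jq] is its derivative in s, and
    [jqc] is the conjugate of [jq], spelled out so that the identities below are rational in the
    products [hdot]. *)
Definition jN f f1 : R[i] :=
  hdot f f * hdot f1 f1 - hdot f1 f * hdot f f1.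
Definition jq f f1 f2 : R[i] :=
  hdot f f * hdot f2 f1 - hdot f2 f * hdot f f1.
Definition jqc f f1 f2 : R[i] :=
  hdot f f * hdot f1 f2 - hdot f f2 * hdot f1 f.
(* d/ds log (N / |f|^4) for a holomorphic curve f with derivatives f1, f2. *)
Definition jp f f1 f2 : R[i] :=
  jq f f1 f2 / jN f f1 - 2 * (hdot f1 f / hdot f f).
(* jcurv |f|^4 / N^3 is the squared norm of the second fundamental form. *)
Definition jcurv f f1 f2 : R[i] :=
  jN f f1 * (hdot f f * hdot f2 f2 - hdot f2 f * hdot f f2)
  - jq f f1 f2 * jqc f f1 f2.
(** The derivative of [jp] in s, see [wder_jp]. It cancels in the divergence, so besides that only
    its continuity is used. *)
Definition jp_dz f f1 f2 f3 : R[i] :=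
  (hdot f1 f * hdot f2 f1 + hdot f f * hdot f3 f1 - hdot f3 f * hdot f f1
   - hdot f2 f * hdot f1 f1) / jN f f1 - jq f f1 f2 ^+ 2 / jN f f1 ^+ 2
  - 2 * (hdot f2 f / hdot f f) + 2 * hdot f1 f ^+ 2 / hdot f f ^+ 2.
(** The derivative of [jp] in the conjugate variable, hence a quarter of the Laplacian of log g. It
    equals (|II|^2 - 2) g, which is the Gauss equation. *)
Definition jp_dzbar f f1 f2 : R[i] :=
  jcurv f f1 f2 / jN f f1 ^+ 2 - 2 * (jN f f1 / hdot f f ^+ 2).

Section along.
Variables (f f1 f2 f3 : C R -> Cvec R n) (s : C R).

Lemma wder_hdot (u v : C R -> Cvec R n) (u1 v1 : Cvec R n) :
  is_derive s (1 : C R) u u1 -> is_derive s (1 : C R) v v1 ->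
  wder (fun z => hdot (u z) (v z)) s (hdot u1 (v s)) (hdot (u s) v1).
Proof.
move=> /is_derive_rowP du /is_derive_rowP dv.
have H k := wderM (wder_holomorphic (du k)) (wder_conj (wder_holomorphic (dv k))).
have := wder_sum H; congr wder; rewrite /hdot; apply: eq_bigr => k _.
  by rewrite rmorph0 mulr0 addr0.
by rewrite mul0r add0r.
Qed.

Hypothesis df : is_derive s (1 : C R) f (f1 s).
Hypothesis df1 : is_derive s (1 : C R) f1 (f2 s).
Hypothesis df2 : is_derive s (1 : C R) f2 (f3 s).
Hypothesis a0 : hdot (f s) (f s) != 0.
Hypothesis N0 : jN (f s) (f1 s) != 0.

Lemma wder_jp : wder (fun z => jp (f z) (f1 z) (f2 z)) s
  (jp_dz (f s) (f1 s) (f2 s) (f3 s)) (jp_dzbar (f s) (f1 s) (f2 s)).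
Proof.
have ha := wder_hdot df df.
have hb := wder_hdot df1 df.
have hb' := wder_hdot df df1.
have hc := wder_hdot df1 df1.
have hd := wder_hdot df2 df.
have hk := wder_hdot df2 df1.
have hN := wderD (wderM ha hc) (wderN (wderM hb hb')).
have hq := wderD (wderM ha hk) (wderN (wderM hd hb')).
have hp := wderD (wderM hq (wderV hN N0))
  (wderN (wderM (wder_cst 2 s) (wderM hb (wderV ha a0)))).
apply: (wder_eq hp); rewrite /= /jp_dz /jp_dzbar /jcurv /jq /jqc /jN.
  rewrite -/(jN (f s) (f1 s)); move: N0 a0; rewrite /jN.
  move: (hdot (f s) (f s)) (hdot (f1 s) (f s)) (hdot (f s) (f1 s))
    (hdot (f1 s) (f1 s)) (hdot (f2 s) (f s)) (hdot (f2 s) (f1 s))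
    (hdot (f3 s) (f1 s)) (hdot (f3 s) (f s)) => xa xb xb' xc xd xk xm xl h1 h2.
  by field; rewrite h1 h2.
move: N0 a0; rewrite /jN.
move: (hdot (f s) (f s)) (hdot (f1 s) (f s)) (hdot (f s) (f1 s))
    (hdot (f1 s) (f1 s)) (hdot (f2 s) (f s)) (hdot (f2 s) (f1 s))
    (hdot (f s) (f2 s)) (hdot (f1 s) (f2 s)) (hdot (f2 s) (f2 s))
    => xa xb xb' xc xd xk xm xl xe h1 h2.
by field; rewrite h1 h2.
Qed.
End along.

(** Multiplying a lift by a holomorphic function acts on jets by the Leibniz rule; [h], [h1], [h2]
    stand for the 2-jet of the factor. *)
Lemma jN_gauge h h1 f f1 :
  jN (h *: f) (h *: f1 + h1 *: f) = (h * h^*%R) ^+ 2 * jN f f1.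
Proof. by rewrite /jN !(hdotDl, hdotDr, hdotZl, hdotZr); ring. Qed.

Lemma jq_gauge h h1 h2 f f1 f2 :
  jq (h *: f) (h *: f1 + h1 *: f) (h *: f2 + (2 * h1) *: f1 + h2 *: f) =
  (h * h^*%R) ^+ 2 * jq f f1 f2 + 2 * h * h1 * h^*%R ^+ 2 * jN f f1.
Proof. by rewrite /jq /jN !(hdotDl, hdotDr, hdotZl, hdotZr); ring. Qed.

(** The Gram determinant and |f|^4 scale by the same factor |h|^4. Concretely, the term [2 * h1 / h]
    coming from [jq] is cancelled by the one coming from [hdot f1 f]. *)
Lemma jp_gauge h h1 h2 f f1 f2 : h != 0 -> hdot f f != 0 -> jN f f1 != 0 ->
  jp (h *: f) (h *: f1 + h1 *: f) (h *: f2 + (2 * h1) *: f1 + h2 *: f) = jp f f1 f2.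
Proof.
move=> h0 a0 N0; have hc0 : h^*%R != 0 by rewrite conjC_eq0.
rewrite /jp jN_gauge jq_gauge !(hdotDl, hdotDr, hdotZl, hdotZr).
move: (hdot f f) (hdot f1 f) (jq f f1 f2) (jN f f1) (h^*%R) a0 N0 hc0 => a b q N k a0 N0 k0.
by field; rewrite ?a0 ?N0 ?k0 ?h0.
Qed.

Lemma jp_gauge_eq h h1 h2 f f1 f2 g g1 g2 : h != 0 -> hdot f f != 0 -> jN f f1 != 0 ->
  g = h *: f -> g1 = h *: f1 + h1 *: f ->
  g2 = h *: f2 + (2 * h1) *: f1 + h2 *: f -> jp g g1 g2 = jp f f1 f2.
Proof. by move=> h0 a0 N0 -> -> ->; exact: jp_gauge. Qed.

Lemma jcurv_gauge h h1 h2 f f1 f2 :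
  jcurv (h *: f) (h *: f1 + h1 *: f) (h *: f2 + (2 * h1) *: f1 + h2 *: f) =
  (h * h^*%R) ^+ 4 * jcurv f f1 f2.
Proof.
rewrite /jcurv /jqc jN_gauge jq_gauge /jq /jN !(hdotDl, hdotDr, hdotZl, hdotZr).
rewrite !rmorphM !rmorph_nat; ring.
Qed.

(** Here [t] is 1 / s, and the jet on the left is that of [f] composed with the inversion. The area
    density gains the factor |t|^4, whose logarithmic derivative in s is [- 2 * t]. *)
Lemma jp_inversion (t : R[i]) f f1 f2 : t != 0 -> hdot f f != 0 -> jN f f1 != 0 ->
  jp f (- t ^+ 2 *: f1) (t ^+ 4 *: f2 + (2 * t ^+ 3) *: f1) =
  - t ^+ 2 * jp f f1 f2 - 2 * t.
Proof.
move=> t0 a0 N0; have tc0 : t^*%R != 0 by rewrite conjC_eq0.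
have EN : jN f (- t ^+ 2 *: f1) = (t * t^*%R) ^+ 2 * jN f f1.
  by rewrite /jN !(hdotZl, hdotZr) rmorphN rmorphXn /=; ring.
have Eq : jq f (- t ^+ 2 *: f1) (t ^+ 4 *: f2 + (2 * t ^+ 3) *: f1) =
   - (t ^+ 4 * t^*%R ^+ 2 * jq f f1 f2) - 2 * t ^+ 3 * t^*%R ^+ 2 * jN f f1.
  by rewrite /jq /jN !(hdotDl, hdotDr, hdotZl, hdotZr) rmorphN rmorphXn /=; ring.
rewrite /jp EN Eq !hdotZl.
move: (hdot f f) (hdot f1 f) (jq f f1 f2) (jN f f1) (t^*%R) a0 N0 tc0 => a b q N k a0 N0 k0.
by field; rewrite ?a0 ?N0 ?k0 ?t0.
Qed.

Lemma jp_inversion_eq (t : R[i]) f f1 f2 g g1 g2 :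
  t != 0 -> hdot f f != 0 -> jN f f1 != 0 ->
  g = f -> g1 = - t ^+ 2 *: f1 -> g2 = t ^+ 4 *: f2 + (2 * t ^+ 3) *: f1 ->
  jp g g1 g2 = - t ^+ 2 * jp f f1 f2 - 2 * t.
Proof. by move=> t0 a0 N0 -> -> ->; exact: jp_inversion. Qed.

Definition garea f f1 : R := complex.Re (jN f f1) / hnorm2 f ^+ 2.

Definition hnorm2c (z : R[i]) : R := complex.Re z ^+ 2 + complex.Im z ^+ 2.

Lemma jN_real f f1 : jN f f1 = (complex.Re (jN f f1))%:C.
Proof.
rewrite /jN [hdot f f1]hdotC !hdotE; case: (hdot f1 f) => x y /=.
by apply/eqP; rewrite eq_complex /=; apply/andP; split; apply/eqP; ring.
Qed.

(** The Cauchy-Schwarz inequality in Lagrange's form: the vector [w] is orthogonal to [f] and has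
    squared norm |f|^2 times the Gram determinant. The equality case is [jN_eq0]. *)
Lemma jN_ge0 f f1 : 0 <= complex.Re (jN f f1).
Proof.
have [->|f0] := eqVneq f 0.
  by rewrite /jN !hdot0l [hdot f1 0]hdotC !hdot0l rmorph0 !mul0r subrr.
have a0 : 0 < hnorm2 f by rewrite hnorm2_gt0.
pose w := (hdot f f) *: f1 - (hdot f1 f) *: f.
have E : hdot w w = hdot f f * jN f f1.
  rewrite /w -scaleNr !(hdotDl, hdotDr, hdotZl, hdotZr) rmorphN /= -!hdotC /jN; ring.
have : 0 <= hnorm2 f * complex.Re (jN f f1).
  have := hnorm2_ge0 w; rewrite -lecR -hdotE E hdotE jN_real -rmorphM.
  by rewrite lecR.
by rewrite pmulr_rge0.
Qed.

Lemma jN_eq0 f f1 : f != 0 -> jN f f1 = 0 -> f1 = (hdot f1 f / hdot f f) *: f.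
Proof.
move=> f0 N0; have a0 : hdot f f != 0.
  by rewrite hdotE -(rmorph0 (real_complex R)) (inj_eq (@complexI R)) hnorm2_eq0.
pose w := (hdot f f) *: f1 - (hdot f1 f) *: f.
have E : hdot w w = hdot f f * jN f f1.
  rewrite /w -scaleNr !(hdotDl, hdotDr, hdotZl, hdotZr) rmorphN /= -!hdotC /jN; ring.
have /eqP : hnorm2 w = 0 by apply: (@complexI R); rewrite -hdotE E N0 mulr0.
rewrite hnorm2_eq0 /w subr_eq0 => /eqP H.
by rewrite mulrC -scalerA -H scalerA mulVf ?scale1r.
Qed.

Lemma garea_gauge h h1 f f1 : h != 0 ->
  garea (h *: f) (h *: f1 + h1 *: f) = garea f f1.
Proof.
move=> h0; rewrite /garea jN_gauge jN_real.
have E : h * h^*%R = (hnorm2c h)%:C.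
  by case: h {h0} => x y /=; apply/eqP; rewrite eq_complex /= /hnorm2c /=; apply/andP; split; apply/eqP; ring.
have hn : hnorm2 (h *: f) = hnorm2c h * hnorm2 f.
  apply: (@complexI R); rewrite -hdotE hdotZl hdotZr mulrA E rmorphM /=.
  by rewrite -hdotE.
have c0 : hnorm2c h != 0.
  by rewrite -(inj_eq (@complexI R)) rmorph0 -E mulf_neq0 ?conjC_eq0.
rewrite E hn -rmorphXn -rmorphM /= exprMn.
by rewrite -mulf_div divff ?mul1r// expf_neq0.
Qed.

Lemma garea_gauge_eq h h1 f f1 g g1 : h != 0 ->
  g = h *: f -> g1 = h *: f1 + h1 *: f -> garea g g1 = garea f f1.
Proof. by move=> h0 -> ->; exact: garea_gauge. Qed.

(** The last hypothesis is |II|^2 <= 1 with denominators cleared, and four times the conclusion is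
    the bound on the Laplacian of log g. *)
Lemma Re_jp_dzbar_le f f1 f2 : f != 0 -> jN f f1 != 0 ->
  complex.Re (jcurv f f1 f2) * hnorm2 f ^+ 2 <= complex.Re (jN f f1) ^+ 3 ->
  complex.Re (jp_dzbar f f1 f2) <= - garea f f1.
Proof.
move=> f0 N0 H; rewrite /jp_dzbar /garea; have a0 : 0 < hnorm2 f by rewrite hnorm2_gt0.
have NE := jN_real f f1; set N := complex.Re (jN f f1) in H NE *.
have N0' : 0 < N.
  rewrite lt_neqAle jN_ge0 andbT eq_sym; apply: contra N0 => /eqP h.
  by rewrite NE h.
rewrite NE hdotE -!rmorphXn -!rmorphV ?unitfE ?expf_neq0 ?gt_eqF//.
set j := jcurv f f1 f2 in H *.
have -> : complex.Re (j * ((N ^+ 2)^-1)%:C - 2 * (N%:C * ((hnorm2 f ^+ 2)^-1)%:C)) =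
    complex.Re j / N ^+ 2 - 2 * (N / hnorm2 f ^+ 2).
  have two : (2 : R[i]) = (2 : R)%:C by rewrite rmorph_nat.
  by rewrite two; case: j {H} => x y /=; ring.
have : complex.Re j / N ^+ 2 <= N / hnorm2 f ^+ 2.
  by rewrite ler_pdivrMr ?exprn_gt0// mulrAC ler_pdivlMr ?exprn_gt0// -exprS.
lra.
Qed.
End jets.

(** * Affine charts *)

Section proj.
Variables (R : realType) (n : nat).
Implicit Types (p : proj_space R n) (z w : Cvec R n).

Lemma rep_in p : rep p \in val p.
Proof. exact: memv_pick. Qed.

Lemma rep_neq0 p : rep p != 0.
Proof.
rewrite /rep vpick0; apply: contraTneq (valP p) => ->.
by rewrite dimv0.
Qed.

Lemma val_line p z : z \in val p -> z != 0 -> val p = <[z]>%VS.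
Proof.
move=> zp z0; apply/eqP; rewrite eq_sym eqEdim -memvE zp (eqP (valP p)) dim_vline z0.
by [].
Qed.

Lemma val_pt z : z != 0 -> val (pt z) = <[z]>%VS.
Proof.
move=> z0; rewrite /pt val_insubd /= dim_vline z0.
by [].
Qed.

Lemma pt_eq p z : z \in val p -> z != 0 -> pt z = p.
Proof. by move=> zp z0; apply: val_inj; rewrite val_pt// (val_line zp z0). Qed.

Lemma pt_rep p : pt (rep p) = p.
Proof. exact: pt_eq (rep_in p) (rep_neq0 p). Qed.

Lemma ptZ (a : R[i]) z : a != 0 -> z != 0 -> pt (a *: z) = pt z.
Proof.
move=> a0 z0; apply: pt_eq; last by rewrite scaler_eq0 negb_or a0.
by rewrite val_pt// memvZ ?memv_line.
Qed.

Lemma rep_ptE z : z != 0 -> exists2 a : R[i], a != 0 & rep (pt z) = a *: z.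
Proof.
move=> z0; have := rep_in (pt z); rewrite val_pt// => /vlineP[a E].
exists a => //; apply: contraTneq (rep_neq0 (pt z)) => a0.
by rewrite E a0 scale0r eqxx.
Qed.

Lemma in_chart_pt j z : z != 0 -> in_chart j (pt z) = (z 0 j != 0).
Proof.
move=> /rep_ptE[a a0 E]; rewrite /in_chart E mxE mulf_eq0 negb_or a0.
by [].
Qed.

Lemma aff_pt j z : z != 0 -> z 0 j != 0 -> aff j (pt z) = (z 0 j)^-1 *: z.
Proof.
move=> /rep_ptE[a a0 E] zj; rewrite /aff E mxE scalerA invfM mulrAC mulVf// mul1r.
by [].
Qed.

Lemma aff_coord j p : in_chart j p -> aff j p 0 j = 1.
Proof. by move=> pj; rewrite /aff mxE mulVf. Qed.

Lemma aff_neq0 j p : in_chart j p -> aff j p != 0.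
Proof.
move=> pj; apply: contra_eq_neq (aff_coord pj) => ->.
by rewrite mxE eq_sym oner_eq0.
Qed.

Lemma pt_aff j p : in_chart j p -> pt (aff j p) = p.
Proof.
move=> pj; rewrite /aff ptZ ?pt_rep ?rep_neq0 ?invr_eq0//.
Qed.

Lemma exists_chart p : exists j, in_chart j p.
Proof.
apply/existsP; apply: contraT => /existsPn H; have := rep_neq0 p.
rewrite (_ : rep p = 0) ?eqxx//; apply/rowP => j; rewrite mxE.
by have := H j; rewrite /in_chart negbK => /eqP.
Qed.

Lemma aff_change j j' p : in_chart j p -> in_chart j' p ->
  aff j' p = (aff j p 0 j')^-1 *: aff j p.
Proof.
move=> pj pj'; have := aff_neq0 pj => a0.
have aj : aff j p 0 j' != 0 by rewrite -in_chart_pt// pt_aff.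
by rewrite -[in LHS](pt_aff pj) aff_pt.
Qed.
End proj.

Section param.
Variable R : realType.

Lemma row2_neq0 (i : 'I_2) (s : C R) :
  (\row_(k < 2) (if k == i then 1 else s) : Cvec R 1) != 0.
Proof.
apply/eqP => /rowP/(_ i) /eqP; rewrite !mxE eqxx; exact/negP/oner_neq0.
Qed.

Lemma param_inv (s : C R) : s != 0 -> param ord0 s = param (lift ord0 ord0) s^-1.
Proof.
move=> s0; rewrite /param.
rewrite -[RHS](@ptZ _ _ s) ?row2_neq0//; congr pt; apply/rowP => k.
by rewrite !mxE; case: k => -[|[|//]] hk /=; rewrite ?mulr1 ?mulfV.
Qed.

Lemma param_inj (i : 'I_2) (s t : C R) : param i s = param i t -> s = t.
Proof.
move=> E.
have nz := row2_neq0 i.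
have H (u : C R) : aff i (param i u) = \row_(k < 2) (if k == i then 1 else u) :> Cvec R 1.
  rewrite /param aff_pt ?nz// !mxE eqxx ?oner_neq0// invr1 scale1r.
  by [].
have := H s; rewrite E H => /rowP/(_ (rev_ord i)); rewrite !mxE.
by rewrite (_ : rev_ord i == i = false) => [->//|]; case: i {E nz H} => -[|[|]].
Qed.

End param.

(** * Higher derivatives of vector-valued lifts *)

Section row_derivatives.
Variables (R : realType) (n : nat).
Implicit Types (f g : C R -> Cvec R n) (s : C R).

(* Opaque below: conversion tests on iterated 'D_1 diverge. *)
Definition deriv f : C R -> Cvec R n := fun z => 'D_1 f z.
Notation deriv2 f := (deriv (deriv f)).
Notation deriv3 f := (deriv (deriv (deriv f))).

Lemma derivE f s : deriv f s = 'D_1 f s.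
Proof. by []. Qed.

Lemma deriv_is_derive f s : derivable f s (1 : C R) -> is_derive s (1 : C R) f (deriv f s).
Proof. exact: derivableP. Qed.

Lemma row_derivable_near f s : (\forall z \near s, derivable f z (1 : C R)) ->
  \forall z \near s, derivable (deriv f) z (1 : C R).
Proof.
move=> df.
have comp z : derivable f z (1 : C R) -> forall k,
    is_derive z (1 : C R) (fun w => f w 0 k : C R) ('D_1 f z 0 k).
  by move=> /derivableP /is_derive_rowP.
have H k : \forall z \near s, derivable (fun w => 'D_1 f w 0 k : C R) z (1 : C R).
  have d1 : \forall z \near s, derivable (fun w => f w 0 k : C R) z (1 : C R).
    by apply: filterS df => z /comp /(_ k) [].
  have d2 := deriv_derivable_near d1.
  have e2 : \forall z \near s, \forall w \near z,
      ('D_1 (fun w => f w 0 k : C R) : C R -> C R) w = 'D_1 f w 0 k.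
    by move/near_join: df; apply: filterS => z; apply: filterS => w /comp /(_ k) [].
  near=> z; apply: (@near_eq_derivable _ _ _ ('D_1 (fun w => f w 0 k : C R) : C R -> C R)).
    by near: z.
  by near: z.
have : \forall z \near s, forall k,
    derivable (fun w => 'D_1 f w 0 k : C R) z (1 : C R).
  exact: (@filter_forall _ _ (fun k z =>
    derivable (fun w => 'D_1 f w 0 k : C R) z (1 : C R)) (nbhs s) _ H).
apply: filterS => z Hz.
suff [] : is_derive z (1 : C R) (deriv f)
    (\row_k 'D_1 (fun w => 'D_1 f w 0 k : C R) z) by [].
by apply/is_derive_rowP => k; rewrite mxE; exact: derivableP.
Unshelve. all: by end_near. Qed.

Lemma is_derive_scale (h : C R -> C R) f s (h1 : C R) (f1 : Cvec R n) :
  is_derive s (1 : C R) h h1 -> is_derive s (1 : C R) f f1 ->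
  is_derive s (1 : C R) (fun z => h z *: f z) (h s *: f1 + h1 *: f s).
Proof.
move=> dh /is_derive_rowP df; apply/is_derive_rowP => k.
have -> : (fun z => (h z *: f z) 0 k : C R) = (fun z => h z * f z 0 k).
  by apply/funext => z; rewrite mxE.
have := is_deriveM dh (df k); congr is_derive.
by rewrite !mxE /GRing.scale /= [f s 0 k * _]mulrC.
Qed.

Lemma is_derive_row_comp f (g : C R -> C R) s (m : C R) (f1 : Cvec R n) :
  is_derive s (1 : C R) g m -> is_derive (g s) (1 : C R) f f1 ->
  is_derive s (1 : C R) (f \o g) (m *: f1).
Proof.
move=> dg /is_derive_rowP df; apply/is_derive_rowP => k; rewrite mxE.
exact: (is_derive_complex_comp dg (df k)).
Qed.

Lemma is_derive_unique (V : normedModType (R[i])) (f : C R -> V) s (l m : V) :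
  is_derive s (1 : C R) f l -> is_derive s (1 : C R) f m -> l = m.
Proof. by move=> [_ <-] [_ <-]. Qed.

Lemma near_derivs f s : (\forall z \near s, derivable f z (1 : C R)) ->
  \forall z \near s, [/\ is_derive z (1 : C R) f (deriv f z),
    is_derive z (1 : C R) (deriv f) (deriv2 f z),
    is_derive z (1 : C R) (deriv2 f) (deriv3 f z) &
    derivable (deriv3 f) z (1 : C R)].
Proof.
move=> d0; have d1 := row_derivable_near d0; have d2 := row_derivable_near d1.
have d3 := row_derivable_near d2.
have [e0 e00 h0] := near_ball d0; have [e1 e10 h1] := near_ball d1.
have [e2 e20 h2] := near_ball d2; have [e3 e30 h3] := near_ball d3.
apply/nbhs_complexP; exists (Num.min (Num.min e0 e1) (Num.min e2 e3)).
  by rewrite !lt_min e00 e10 e20 e30.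
move=> z; rewrite !lt_min => /andP[/andP[z0 z1] /andP[z2 z3]].
split.
- exact: (deriv_is_derive (h0 z z0)).
- exact: (deriv_is_derive (h1 z z1)).
- exact: (deriv_is_derive (h2 z z2)).
- exact: (h3 z z3).
Qed.

(** The values [h1], [h2] may stay existential: the gauge identities hold for all of them. *)
Lemma jet_gauge (h : C R -> C R) f g s :
  (\forall z \near s, derivable h z (1 : C R)) ->
  (\forall z \near s, derivable f z (1 : C R)) ->
  (\forall z \near s, g z = h z *: f z) ->
  exists h1 h2 : R[i], deriv g s = h s *: deriv f s + h1 *: f s /\
    deriv2 g s = h s *: deriv2 f s + (2 * h1) *: deriv f s + h2 *: f s.
Proof.
move=> dh df gE.
pose dh' : C R -> C R := fun z => 'D_1 h z.
have dh1 : \forall z \near s, derivable dh' z (1 : C R) := deriv_derivable_near dh.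
have df1 := row_derivable_near df.
have E1 : \forall z \near s, deriv g z = h z *: deriv f z + dh' z *: f z.
  have [e0 e00 h0] := near_ball dh; have [e1 e10 h1] := near_ball df.
  have [e2 e20 h2] := near_ball (near_join gE).
  apply/nbhs_complexP; exists (Num.min e0 (Num.min e1 e2)).
    by rewrite !lt_min e00 e10 e20.
  move=> z; rewrite !lt_min => /andP[z0 /andP[z1 z2]].
  have gz : \forall w \near (z : C R), h w *: f w = g w.
    by apply: filterS (h2 z z2) => v ->.
  by case: (near_eq_is_derive gz (is_derive_scale (derivableP (h0 z z0)) (deriv_is_derive (h1 z z1)))).
exists (dh' s), ('D_1 dh' s); split; first exact: nbhs_singleton E1.
have H1 := is_derive_scale (derivableP (nbhs_singleton dh)) (deriv_is_derive (nbhs_singleton df1)).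
have H2 := is_derive_scale (derivableP (nbhs_singleton dh1)) (deriv_is_derive (nbhs_singleton df)).
have E2 : \forall z \near s, h z *: deriv f z + dh' z *: f z = deriv g z.
  by move: E1; apply: filterS => z ->.
case: (near_eq_is_derive E2 (is_deriveD H1 H2)) => _ E; apply: (etrans E).
rewrite -!addrA; congr (_ + _); rewrite !addrA; congr (_ + _).
by rewrite -scalerDl; congr (_ *: _); rewrite mulr2n mulrDl mul1r.
Qed.
End row_derivatives.

#[global] Opaque deriv.

(** * Continuity of the jet invariants *)

Section continuity.
Variables (R : realType) (n : nat) (T : topologicalType) (s : T).
Implicit Types (F G : T -> R[i]) (f g : T -> Cvec R n).

Definition ccts F := {for s, continuous (F : T -> C R)}.

Lemma ccts_cst (z : R[i]) : ccts (fun=> z).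
Proof. exact: cvg_cst. Qed.

Lemma cctsD F G : ccts F -> ccts G -> ccts (fun z => F z + G z).
Proof. by move=> cF cG; apply: cvgD; [exact: cF|exact: cG]. Qed.

Lemma cctsM F G : ccts F -> ccts G -> ccts (fun z => F z * G z).
Proof. by move=> cF cG; apply: cvgM; [exact: cF|exact: cG]. Qed.

Lemma cctsN F : ccts F -> ccts (fun z => - F z).
Proof. by move=> cF; apply: cvgN; exact: cF. Qed.

Lemma cctsV F : ccts F -> F s != 0 -> ccts (fun z => (F z)^-1).
Proof. by move=> cF F0; apply: cvgV; [exact: F0|exact: cF]. Qed.

Lemma ccts_conj F : ccts F -> ccts (fun z => (F z)^*%R).
Proof.
move=> /continuous_normcP H; apply/continuous_normcP => e /H; apply: filterS => t.
by rewrite -rmorphB -[normc (_^*%R)]/(normc (conjc _)) => h; rewrite (_ : normc _ = normc (F t - F s))//; case: (F t - F s) => x y /=; rewrite sqrrN.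
Qed.

Lemma ccts_sum (I : finType) (F : I -> T -> R[i]) :
  (forall i, ccts (F i)) -> ccts (fun z => \sum_i F i z).
Proof.
move=> H; have K (r : seq I) : ccts (fun z => \sum_(i <- r) F i z).
  elim: r => [|i r IH].
    have -> : (fun z => \sum_(i <- [::]) F i z) = (fun=> 0).
      by apply/funext => z; rewrite big_nil.
    exact: ccts_cst.
  have -> : (fun z => \sum_(j <- i :: r) F j z) =
      (fun z => F i z + \sum_(j <- r) F j z).
    by apply/funext => z; rewrite big_cons.
  exact: (cctsD (H i) IH).
exact: K.
Qed.

Definition vcts f := forall k, ccts (fun z => f z 0 k).

Lemma ccts_hdot f g : vcts f -> vcts g -> ccts (fun z => hdot (f z) (g z)).
Proof.
by move=> cf cg; apply: ccts_sum => k; apply: cctsM; [exact: cf|apply: ccts_conj; exact: cg].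
Qed.

Variables (f f1 f2 f3 : T -> Cvec R n).
Hypotheses (cf : vcts f) (cf1 : vcts f1) (cf2 : vcts f2) (cf3 : vcts f3).
Hypothesis a0 : hdot (f s) (f s) != 0.
Hypothesis N0 : jN (f s) (f1 s) != 0.

Lemma ccts_jN : ccts (fun z => jN (f z) (f1 z)).
Proof. by apply: cctsD; [|apply: cctsN]; apply: cctsM; exact: ccts_hdot. Qed.

Lemma ccts_jq : ccts (fun z => jq (f z) (f1 z) (f2 z)).
Proof. by apply: cctsD; [|apply: cctsN]; apply: cctsM; exact: ccts_hdot. Qed.

Lemma ccts_jqc : ccts (fun z => jqc (f z) (f1 z) (f2 z)).
Proof. by apply: cctsD; [|apply: cctsN]; apply: cctsM; exact: ccts_hdot. Qed.

Lemma ccts_sqV F : ccts F -> F s != 0 -> ccts (fun z => (F z ^+ 2)^-1).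
Proof. by move=> cF F0; exact: (cctsV (cctsM cF cF) (mulf_neq0 F0 F0)). Qed.

Lemma ccts_jp : ccts (fun z => jp (f z) (f1 z) (f2 z)).
Proof.
apply: cctsD; first by apply: cctsM; [exact: ccts_jq|apply: cctsV => //; exact: ccts_jN].
apply: cctsN; apply: cctsM; first exact: ccts_cst.
by apply: cctsM; [exact: ccts_hdot|apply: cctsV => //; exact: ccts_hdot].
Qed.

Lemma ccts_jp_dzbar : ccts (fun z => jp_dzbar (f z) (f1 z) (f2 z)).
Proof.
apply: cctsD.
  apply: cctsM; last by apply: ccts_sqV => //; exact: ccts_jN.
  apply: cctsD; last by apply: cctsN; apply: cctsM; [exact: ccts_jq|exact: ccts_jqc].
  apply: cctsM; first exact: ccts_jN.
  by apply: cctsD; [|apply: cctsN]; apply: cctsM; exact: ccts_hdot.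
apply: cctsN; apply: cctsM; first exact: ccts_cst.
by apply: cctsM; [exact: ccts_jN|apply: ccts_sqV => //; exact: ccts_hdot].
Qed.

Lemma ccts_jp_dz : ccts (fun z => jp_dz (f z) (f1 z) (f2 z) (f3 z)).
Proof.
have h u v : vcts u -> vcts v -> ccts (fun z => hdot (u z) (v z)) by exact: ccts_hdot.
apply: cctsD; first apply: cctsD; first apply: cctsD.
- apply: cctsM; last by apply: cctsV => //; exact: ccts_jN.
  do 2 (apply: cctsD; last by apply: cctsN; apply: cctsM; exact: h).
  by apply: cctsD; apply: cctsM; exact: h.
- apply: cctsN; apply: cctsM; last by apply: ccts_sqV => //; exact: ccts_jN.
  by apply: cctsM; exact: ccts_jq.
- apply: cctsN; apply: cctsM; first exact: ccts_cst.
  by apply: cctsM; [exact: h|apply: cctsV => //; exact: h].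
- apply: cctsM; last by apply: ccts_sqV => //; exact: h.
  apply: cctsM; first exact: ccts_cst.
  by apply: cctsM; exact: h.
Qed.

Lemma ccts_garea : {for s, continuous (fun z => garea (f z) (f1 z))}.
Proof.
have -> : (fun z => garea (f z) (f1 z)) =
    (fun z => complex.Re (jN (f z) (f1 z) * (hdot (f z) (f z) ^+ 2)^-1)).
  apply/funext => z; rewrite /garea hdotE -rmorphXn /= jN_real.
  by rewrite -[(_ %:C)^-1]/((real_complex R _)^-1) -fmorphV -rmorphM.
suff /continuous_complexP[] : ccts (fun z => jN (f z) (f1 z) * (hdot (f z) (f z) ^+ 2)^-1) by [].
by apply: cctsM; [exact: ccts_jN|apply: ccts_sqV => //; exact: ccts_hdot].
Qed.
End continuity.

Lemma is_derive_vcts (R : realType) (n : nat) (f : C R -> Cvec R n) (s : C R) (l : Cvec R n) :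
  is_derive s (1 : C R) f l -> vcts s f.
Proof. by move=> /is_derive_rowP H k; exact: is_derive_complex_continuous (H k). Qed.

Lemma wder_near (R : realType) (F G : C R -> R[i]) (s : C R) u v :
  (\forall z \near s, F z = G z) -> wder F s u v -> wder G s u v.
Proof.
case: s => x y /nbhs_complexP[d d0 hd] [[F1 F2] [F3 F4]].
have h1 : \forall t \near x, F (t +i* y) = G (t +i* y).
  apply/nbhs_realP; exists d => // t ht; apply: hd.
  apply: le_lt_trans (normc_ler _) _; rewrite /= subrr normr0 addr0.
  exact: ht.
have h2 : \forall t \near y, F (x +i* t) = G (x +i* t).
  apply/nbhs_realP; exists d => // t ht; apply: hd.
  apply: le_lt_trans (normc_ler _) _; rewrite /= subrr normr0 add0r.
  exact: ht.
split; split.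
- by apply: near_eq_is_derive F1; apply: filterS h1 => t /= ->.
- by apply: near_eq_is_derive F2; apply: filterS h1 => t /= ->.
- by apply: near_eq_is_derive F3; apply: filterS h2 => t /= ->.
- by apply: near_eq_is_derive F4; apply: filterS h2 => t /= ->.
Qed.

Lemma wder_unique (R : realType) (F : C R -> R[i]) (s : C R) u v u' v' :
  wder F s u v -> wder F s u' v' -> u = u' /\ v = v'.
Proof.
move=> [[[_ F1] [_ F2]] [[_ F3] [_ F4]]] [[[_ G1] [_ G2]] [[_ G3] [_ G4]]].
rewrite F1 in G1; rewrite F2 in G2; rewrite F3 in G3; rewrite F4 in G4.
case: u v u' v' G1 G2 G3 G4 {F1 F2 F3 F4} => a b [c d] [a' b'] [c' d'] /= *.
by split; apply/eqP; rewrite eq_complex /=; apply/andP; split; apply/eqP; lra.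
Qed.

Lemma near_continuous (R : realType) (T : topologicalType) (F G : T -> R) (s : T) :
  (\forall z \near s, F z = G z) -> {for s, continuous F} -> {for s, continuous G}.
Proof.
move=> FG /cvgrPdist_lt H; apply/cvgrPdist_lt => e /H {}H.
by rewrite -(nbhs_singleton FG); near do rewrite -(near FG _)//.
Unshelve. all: by end_near. Qed.

(** * Jet functions of the curve, independent of the chart *)

Section curve.
Variables (R : realType) (n : nat) (Gamma : proj_space R 1 -> proj_space R n).
Hypothesis Gamma_hol : holomorphic Gamma.
Hypothesis Gamma_imm : immersion Gamma.
Implicit Types (i : 'I_2) (j : 'I_n.+1) (s : C R).
Local Notation u := (local_expr Gamma).
Local Notation deriv2 f := (deriv (deriv f)).
Local Notation deriv3 f := (deriv (deriv (deriv f))).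

Lemma near_in_chart i j s : in_chart j (Gamma (param i s)) ->
  \forall t \near s, in_chart j (Gamma (param i t)).
Proof. by move=> /Gamma_hol[]. Qed.

Lemma near_derivable i j s : in_chart j (Gamma (param i s)) ->
  \forall t \near s, derivable (u i j) t (1 : C R).
Proof.
by move=> /near_in_chart; apply: filterS => t /Gamma_hol[].
Qed.

Lemma local_expr_coord i j s : in_chart j (Gamma (param i s)) -> u i j s 0 j = 1.
Proof. exact: aff_coord. Qed.

Lemma local_expr_neq0 i j s : in_chart j (Gamma (param i s)) -> u i j s != 0.
Proof. exact: aff_neq0. Qed.

Lemma hdot_local_expr_neq0 i j s : in_chart j (Gamma (param i s)) ->
  hdot (u i j s) (u i j s) != 0.
Proof.
move=> /local_expr_neq0 h; rewrite hdotE.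
by rewrite -(rmorph0 (real_complex R)) (inj_eq (@complexI R)) hnorm2_eq0.
Qed.

(** If the Gram determinant vanished, the derivative would be a multiple of the lift. The [j]-th
    coordinate of the lift is constantly 1, so the multiple is 0, which contradicts the immersion
    hypothesis. *)
Lemma jN_local_expr_neq0 i j s : in_chart j (Gamma (param i s)) ->
  jN (u i j s) (deriv (u i j) s) != 0.
Proof.
move=> cs; apply/eqP => /(jN_eq0 (local_expr_neq0 cs)).
set k := _ / _ => E.
have dj : is_derive s (1 : C R) (fun z => u i j z 0 j : C R) (deriv (u i j) s 0 j).
  have [_ ds] := Gamma_hol cs.
  by have /is_derive_rowP := deriv_is_derive ds; exact.
have d0 : is_derive s (1 : C R) (fun z => u i j z 0 j : C R) (0 : C R).
  have E1 : \forall t \near s, cst (1 : C R) t = (u i j t 0 j : C R).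
    by apply: filterS (near_in_chart cs) => t /local_expr_coord ->.
  exact: near_eq_is_derive E1 (is_derive_cst (1 : C R) s (1 : C R)).
have := is_derive_unique dj d0; rewrite E mxE local_expr_coord// mulr1 => k0.
have := Gamma_imm cs; rewrite -derivE E k0 scale0r eqxx.
by [].
Qed.

(** The same choice as in [area_density], so that the two expressions fold into each other. *)
Definition chart i s : 'I_n.+1 :=
  odflt ord0 [pick j | in_chart j (Gamma (param i s))].

Lemma chartP i s : in_chart (chart i s) (Gamma (param i s)).
Proof.
rewrite /chart; case: pickP => //= H.
by have [j] := exists_chart (Gamma (param i s)); rewrite H.
Qed.

Lemma chart_jet_gauge i j j' s : in_chart j (Gamma (param i s)) ->
  in_chart j' (Gamma (param i s)) ->
  exists h h1 h2 : R[i], [/\ h != 0, u i j' s = h *: u i j s,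
    deriv (u i j') s = h *: deriv (u i j) s + h1 *: u i j s &
    deriv2 (u i j') s = h *: deriv2 (u i j) s + (2 * h1) *: deriv (u i j) s
      + h2 *: u i j s].
Proof.
move=> cj cj'.
have nz t : in_chart j (Gamma (param i t)) -> in_chart j' (Gamma (param i t)) ->
    u i j t 0 j' != 0.
  by move=> c1 c2; rewrite -in_chart_pt ?local_expr_neq0// /local_expr pt_aff.
pose h (z : C R) : C R := (u i j z 0 j')^-1.
have uE : \forall z \near s, u i j' z = h z *: u i j z.
  have [d1 d10 h1] := near_ball (near_in_chart cj).
  have [d2 d20 h2] := near_ball (near_in_chart cj').
  apply/nbhs_complexP; exists (Num.min d1 d2); first by rewrite lt_min d10.
  by move=> z; rewrite lt_min => /andP[/h1 c1 /h2 c2]; exact: aff_change.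
have dh : \forall z \near s, derivable h z (1 : C R).
  have [d1 d10 h1] := near_ball (near_in_chart cj).
  have [d2 d20 h2] := near_ball (near_in_chart cj').
  have [d3 d30 h3] := near_ball (near_derivable cj).
  apply/nbhs_complexP; exists (Num.min d1 (Num.min d2 d3)).
    by rewrite !lt_min d10 d20 d30.
  move=> z; rewrite !lt_min => /andP[/h1 c1 /andP[/h2 c2 /h3 dz]].
  have /is_derive_rowP/(_ j')[D _] := deriv_is_derive dz.
  exact: (@derivableV _ (C R) (fun w => u i j w 0 j') z (1 : C R) (nz z c1 c2) D).
have [h1 [h2 [E1 E2]]] := jet_gauge dh (near_derivable cj) uE.
exists (h s), h1, h2; split => //; last exact: nbhs_singleton uE.
by rewrite invr_eq0 nz.
Qed.

(** The chosen chart may jump from point to point. By [jetp_chart] the value does not depend on it,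
    so near each point regularity can be read off in one fixed chart. *)
Definition jetp i s : R[i] := let f := u i (chart i s) in
  jp (f s) (deriv f s) (deriv2 f s).
Definition jetp_dz i s : R[i] := let f := u i (chart i s) in
  jp_dz (f s) (deriv f s) (deriv2 f s) (deriv3 f s).
Definition jetp_dzbar i s : R[i] := let f := u i (chart i s) in
  jp_dzbar (f s) (deriv f s) (deriv2 f s).
Definition jetg i s : R := let f := u i (chart i s) in garea (f s) (deriv f s).

Lemma jetp_chart i j s : in_chart j (Gamma (param i s)) ->
  jetp i s = jp (u i j s) (deriv (u i j) s) (deriv2 (u i j) s).
Proof.
move=> cj; have [h [h1 [h2 [h0 E E1 E2]]]] := chart_jet_gauge cj (chartP i s).
exact: (jp_gauge_eq h0 (hdot_local_expr_neq0 cj) (jN_local_expr_neq0 cj) E E1 E2).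
Qed.

Lemma jetg_chart i j s : in_chart j (Gamma (param i s)) ->
  jetg i s = garea (u i j s) (deriv (u i j) s).
Proof.
move=> cj; have [h [h1 [h2 [h0 E E1 E2]]]] := chart_jet_gauge cj (chartP i s).
exact: (garea_gauge_eq h0 E E1).
Qed.

Lemma near_jetp i j s : in_chart j (Gamma (param i s)) ->
  \forall z \near s, jp (u i j z) (deriv (u i j) z) (deriv2 (u i j) z) = jetp i z.
Proof.
move=> /near_in_chart; apply: filterS => z cz; exact: esym (jetp_chart cz).
Qed.

Lemma wder_jetp_chart i j s : in_chart j (Gamma (param i s)) -> wder (jetp i) s
  (jp_dz (u i j s) (deriv (u i j) s) (deriv2 (u i j) s) (deriv3 (u i j) s))
  (jp_dzbar (u i j s) (deriv (u i j) s) (deriv2 (u i j) s)).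
Proof.
move=> cj; apply: wder_near (near_jetp cj) _.
have [H0 H1 H2 _] := nbhs_singleton (near_derivs (near_derivable cj)).
exact: (wder_jp H0 H1 H2 (hdot_local_expr_neq0 cj) (jN_local_expr_neq0 cj)).
Qed.

Lemma wder_jetp i s : wder (jetp i) s (jetp_dz i s) (jetp_dzbar i s).
Proof. exact: wder_jetp_chart (chartP i s). Qed.

(** Uniqueness of the Wirtinger derivatives of [jetp] transports both expressions between charts,
    which spares a gauge identity for 3-jets. *)
Lemma near_jetp_dz i j s : in_chart j (Gamma (param i s)) -> \forall z \near s,
  jp_dz (u i j z) (deriv (u i j) z) (deriv2 (u i j) z) (deriv3 (u i j) z) =
    jetp_dz i z /\
  jp_dzbar (u i j z) (deriv (u i j) z) (deriv2 (u i j) z) = jetp_dzbar i z.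
Proof.
move=> /near_in_chart; apply: filterS => z cz.
exact: wder_unique (wder_jetp_chart cz) (wder_jetp i z).
Qed.

Lemma ccts_near (F G : C R -> R[i]) s : (\forall z \near s, F z = G z) ->
  ccts s F -> ccts s G.
Proof.
move=> FG /continuous_normcP H; apply/continuous_normcP => e e0.
have FGs := nbhs_singleton FG; have [d1 d10 h1] := near_ball FG.
have [d2 d20 h2] := near_ball (H e e0).
apply/nbhs_complexP; exists (Num.min d1 d2); first by rewrite lt_min d10.
by move=> z; rewrite lt_min => /andP[/h1 <- /h2]; rewrite FGs.
Qed.

Lemma chart_vcts i j s : in_chart j (Gamma (param i s)) ->
  [/\ vcts s (u i j), vcts s (deriv (u i j)), vcts s (deriv2 (u i j)) &
      vcts s (deriv3 (u i j))].
Proof.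
move=> cj; have [H0 H1 H2 /derivableP H3] := nbhs_singleton (near_derivs (near_derivable cj)).
by split; [exact: is_derive_vcts H0|exact: is_derive_vcts H1|exact: is_derive_vcts H2|exact: is_derive_vcts H3].
Qed.

Lemma ccts_jetp i s : ccts s (jetp i).
Proof.
have cj := chartP i s; apply: ccts_near (near_jetp cj) _.
have [c0 c1 c2 c3] := chart_vcts cj.
exact: (ccts_jp c0 c1 c2 (hdot_local_expr_neq0 cj) (jN_local_expr_neq0 cj)).
Qed.

Lemma ccts_jetp_dz i s : ccts s (jetp_dz i).
Proof.
have cj := chartP i s; apply: (@ccts_near _ _ s).
  by apply: filterS (near_jetp_dz cj) => z [H _]; exact: H.
have [c0 c1 c2 c3] := chart_vcts cj.
exact: (ccts_jp_dz c0 c1 c2 c3 (hdot_local_expr_neq0 cj) (jN_local_expr_neq0 cj)).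
Qed.

Lemma ccts_jetp_dzbar i s : ccts s (jetp_dzbar i).
Proof.
have cj := chartP i s; apply: (@ccts_near _ _ s).
  by apply: filterS (near_jetp_dz cj) => z [_ H]; exact: H.
have [c0 c1 c2 c3] := chart_vcts cj.
exact: (ccts_jp_dzbar c0 c1 c2 (hdot_local_expr_neq0 cj) (jN_local_expr_neq0 cj)).
Qed.

Lemma jetg_continuous i s : {for s, continuous (jetg i)}.
Proof.
have cj := chartP i s; have [c0 c1 _ _] := chart_vcts cj.
have H : {for s, continuous (fun z => garea (u i (chart i s) z) (deriv (u i (chart i s)) z))}.
  exact: (ccts_garea c0 c1 (hdot_local_expr_neq0 cj)).
have nE : \forall z \near s, garea (u i (chart i s) z) (deriv (u i (chart i s)) z) = jetg i z.
  apply: filterS (near_in_chart cj) => z cz; exact: esym (jetg_chart cz).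
exact: near_continuous nE H.
Qed.

(** The parameters s and 1 / s name the same point, so one chart [j] of the target serves both sides
    and only the parameter changes. *)
Lemma jetp_inversion s : s != 0 ->
  jetp ord0 s = - (s^-1) ^+ 2 * jetp (lift ord0 ord0) s^-1 - 2 * s^-1.
Proof.
move=> s0; set i1 : 'I_2 := lift ord0 ord0.
have cj : in_chart (chart i1 s^-1) (Gamma (param i1 s^-1)) by exact: chartP.
set j := chart i1 s^-1 in cj.
have cj0 : in_chart j (Gamma (param ord0 s)) by rewrite param_inv.
rewrite (jetp_chart cj0) (jetp_chart cj).
pose inv (z : C R) : C R := z^-1.
have uE (z : C R) : z != 0 -> u ord0 j z = u i1 j (inv z).
  by move=> z0; rewrite /local_expr param_inv.
have nz : \forall z \near s, z != 0.
  apply/nbhs_complexP; exists (normc s).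
    by rewrite lt_neqAle normc_ge0 andbT eq_sym; apply: contra s0 => /eqP/eq0_normc ->.
  by move=> z; apply: contraTneq => ->; rewrite sub0r normcN ltxx.
have [d1 d10 h1] := near_ball (near_derivs (near_derivable cj)).
have ic : {for s, continuous inv}.
  exact: is_derive_complex_continuous (is_derive_complex_inv s0).
have nd : \forall z \near s, z != 0 /\ normc (inv z - inv s) < d1.
  have [d2 d20 h2] := near_ball nz.
  have [d3 d30 h3] := (complex_continuousP inv s).1 ic _ d10.
  apply/nbhs_complexP; exists (Num.min d2 d3); first by rewrite lt_min d20.
  by move=> z; rewrite lt_min => /andP[/h2 ? /h3].
have D1 : \forall z \near s, deriv (u ord0 j) z = (- inv z ^+ 2) *: deriv (u i1 j) (inv z).
  have [d2 d20 h2] := near_ball nd; have [d3 d30 h3] := near_ball (near_join nz).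
  apply/nbhs_complexP; exists (Num.min d2 d3); first by rewrite lt_min d20.
  move=> z; rewrite lt_min => /andP[/h2[z0 /h1[H0 _ _ _]] /h3 nzz].
  have H := is_derive_row_comp (is_derive_complex_inv z0) H0.
  have nE : \forall w \near (z : C R), (u i1 j \o inv) w = u ord0 j w.
    by apply: filterS nzz => w /uE ->.
  by have [_] := near_eq_is_derive nE H; rewrite -derivE -exprVn.
have D2 : deriv2 (u ord0 j) s = (s^-1 ^+ 4) *: deriv2 (u i1 j) s^-1
    + (2 * s^-1 ^+ 3) *: deriv (u i1 j) s^-1.
  have [_ /h1[_ H1 _ _]] := nbhs_singleton nd.
  have H2 := is_derive_row_comp (is_derive_complex_inv s0) H1.
  have di : is_derive s (1 : C R) (fun z => - inv z ^+ 2 : C R) (2 * inv s ^+ 3 : C R).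
    have d0 := is_derive_complex_inv s0.
    have d2 := is_deriveN (is_deriveM d0 d0).
    have -> : (fun z => - inv z ^+ 2 : C R) = (- ((fun w : C R => w^-1) * (fun w : C R => w^-1)) : C R -> C R).
      by apply/funext => z; rewrite expr2.
    apply: (is_derive_eq d2); rewrite /GRing.scale /= /inv -exprVn.
    by move: (s^-1 : R[i]) => t; ring.
  have H := is_derive_scale di H2.
  have nE : \forall z \near s, - inv z ^+ 2 *: (deriv (u i1 j) \o inv) z = deriv (u ord0 j) z.
    by apply: filterS D1 => z ->.
  have [_ E0] := near_eq_is_derive nE H.
  apply: (etrans (derivE (deriv (u ord0 j)) s)); apply: (etrans E0).
  rewrite scalerA /inv -exprVn; congr (_ *: _ + _).
  by rewrite mulrNN -exprD.
have t0 : s^-1 != 0 by rewrite invr_eq0.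
exact: (jp_inversion_eq t0 (hdot_local_expr_neq0 cj) (jN_local_expr_neq0 cj)
  (uE s s0) (nbhs_singleton D1) D2).
Qed.
End curve.

(** * The area bound *)

Section divergence.
Variable R : realType.
Notation mu := (@lebesgue_measure R).

(** Second countability: an open set is the union of the rational boxes contained in it. Boxes that
    are not contained in it are replaced by the empty set, which keeps the union indexed by all
    rationals. *)
Lemma open_prod_measurable (U : set (R * R)) : open U -> measurable U.
Proof.
move=> oU.
pose box (a b c d : rat) : set (R * R) :=
  `]ratr a, ratr b[%classic `*` `]ratr c, ratr d[%classic.
have -> : U = \bigcup_a \bigcup_b \bigcup_c \bigcup_d
    (if pselect (box a b c d `<=` U) then box a b c d else set0).
  apply/seteqP; split=> [[x y] Uxy|]; last first.
    by move=> p [a _ [b _ [c _ [d _]]]]; case: pselect => // h /h.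
  have /nbhs_ballP[e /= e0 he] := open_nbhs_nbhs (conj oU Uxy).
  have [a] := @rat_in_itvoo R (x - e) x ltac:(lra).
  rewrite in_itv /= => /andP[a1 a2].
  have [b] := @rat_in_itvoo R x (x + e) ltac:(lra).
  rewrite in_itv /= => /andP[b1 b2].
  have [c] := @rat_in_itvoo R (y - e) y ltac:(lra).
  rewrite in_itv /= => /andP[c1 c2].
  have [d] := @rat_in_itvoo R y (y + e) ltac:(lra).
  rewrite in_itv /= => /andP[d1 d2].
  refine (ex_intro2 _ _ a Logic.I (ex_intro2 _ _ b Logic.I
    (ex_intro2 _ _ c Logic.I (ex_intro2 _ _ d Logic.I _)))).
  have sub : box a b c d `<=` U.
    move=> [u v] [/=]; rewrite !in_itv /= => /andP[au ub] /andP[cv vd].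
    by apply: he; split; rewrite /ball /= ltr_norml; apply/andP; split; lra.
  case: (pselect (box a b c d `<=` U)) => [h|/(_ sub)//].
  by split; rewrite /= in_itv /=; apply/andP.
do 4 (apply: bigcupT_measurable_rat => ?); case: pselect => h; last exact: measurable0.
by apply: measurableX; exact: measurable_itv.
Qed.

Lemma continuous_prod_measurable (F : R * R -> R) : continuous F ->
  measurable_fun setT F.
Proof.
move=> /continuousP cF _; apply: (measurability _ (measurable_realfun.RGenOInfty.measurableE R)) => //.
move=> _ [_ [a ->] <-]; rewrite setTI; apply: open_prod_measurable.
by apply: cF; exact: rray_open.
Qed.

Definition cont2 (F : R -> R -> R) := continuous (fun p : R * R => F p.1 p.2).

Lemma cont2_l F y : cont2 F -> continuous (F ^~ y).
Proof.
move=> cF x; apply: (@continuous_comp _ _ _ (fun x => (x, y)) (fun p : R * R => F p.1 p.2)).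
  exact: (@cvg_pair _ _ _ (nbhs x) (nbhs x) (nbhs y) _ _ _ id (fun=> y)
    (@cvg_id _ (nbhs x)) (@cvg_cst _ y _ _ _)).
exact: cF.
Qed.

Lemma cont2_r F x : cont2 F -> continuous (F x).
Proof.
move=> cF y; apply: (@continuous_comp _ _ _ (fun y => (x, y)) (fun p : R * R => F p.1 p.2)).
  exact: (@cvg_pair _ _ _ (nbhs y) (nbhs x) (nbhs y) _ _ _ (fun=> x) id
    (@cvg_cst _ x _ _ _) (@cvg_id _ (nbhs y))).
exact: cF.
Qed.

Local Open Scope ereal_scope.

Section square.
Variable L : R.
Hypothesis L0 : (0 < L)%R.
Notation I := (`[(- L)%R, L]%classic : set R).
Notation m2 := (mu \x mu).

Lemma measurable_square : measurable (I `*` I).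
Proof. by apply: measurableX; exact: measurable_itv. Qed.

Lemma square_integrable F : cont2 F ->
  m2.-integrable (I `*` I) (fun p => (F p.1 p.2)%:E).
Proof.
move=> cF; pose f (p : measurableTypeR R * measurableTypeR R) : R := F p.1 p.2.
suff : m2.-integrable (I `*` I) (EFin \o f) by [].
apply: measurable_bounded_integrable.
- exact: measurable_square.
- have LL : (- L < L)%R by have := L0; lra.
  have hI : mu I = (L - - L)%:E by rewrite lebesgue_measure_itv /= lte_fin LL EFinB.
  have hE : (mu \x mu) (I `*` I) = mu I * mu I.
    by apply: product_measure1E; exact: measurable_itv.
  by apply: (@le_lt_trans _ _ (mu I * mu I)); [rewrite -hE|rewrite hI -EFinM ltry].
- by apply: measurable_funTS; exact: continuous_prod_measurable.
- have cD : compact (I `*` I) by apply: compact_setX; exact: segment_compact.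
  have cf : {within I `*` I, continuous f} by exact: continuous_subspaceT.
  have := compact_bounded (continuous_compact cf cD).
  move=> [M [Mr hM]]; exists M; split => // z Mz p Dp; apply: (hM z Mz).
  by exists p.
Qed.

(** Fubini's theorem applied to the extension by zero; the restriction to the square is recovered in
    each variable separately. *)
Lemma square_integral_iterated F : cont2 F ->
  \int[m2]_(p in I `*` I) (F p.1 p.2)%:E =
    \int[mu]_(x in I) \int[mu]_(y in I) (F x y)%:E /\
  \int[m2]_(p in I `*` I) (F p.1 p.2)%:E =
    \int[mu]_(y in I) \int[mu]_(x in I) (F x y)%:E.
Proof.
move=> cF; have := square_integrable cF.
rewrite integrable_mkcond => [iF|]; last exact: measurable_square.
rewrite integral_mkcond; split.
  rewrite -(integral12_prod_meas1 iF) [RHS]integral_mkcond /fubini_F.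
  apply: eq_integral => x _; rewrite patchE /=; case: ifPn => xI.
    rewrite [RHS]integral_mkcond; apply: eq_integral => y _; rewrite !patchE.
    by rewrite in_setX /= xI.
  by apply: integral0_eq => y _; rewrite patchE in_setX /= (negbTE xI).
rewrite -(integral21_prod_meas1 iF) [RHS]integral_mkcond /fubini_G.
apply: eq_integral => y _; rewrite patchE /=; case: ifPn => yI.
  rewrite [RHS]integral_mkcond; apply: eq_integral => x _; rewrite !patchE.
  by rewrite in_setX /= yI andbT.
by apply: integral0_eq => x _; rewrite patchE in_setX /= (negbTE yI) andbF.
Qed.

Lemma segment_FTC (f F : R -> R) : continuous f ->
  (forall x, is_derive x (1%R : R) F (f x)) ->
  \int[mu]_(x in I) (f x)%:E = (F L - F (- L))%:E.
Proof.
move=> cf dF; rewrite (@continuous_FTC2 _ f F)//.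
- by have := L0; lra.
- exact: continuous_subspaceT.
- split.
  + by move=> x _; case: (dF x).
  + by apply: cvg_at_right_filter; apply: is_derive_continuous (dF _).
  + by apply: cvg_at_left_filter; apply: is_derive_continuous (dF _).
- by move=> x _; rewrite derive1E; case: (dF x).
Qed.

Lemma segment_integral_ge (f : R -> R) (c : R) : continuous f ->
  (forall x, - L <= x <= L -> c <= f x)%R ->
  (c * (2 * L))%:E <= \int[mu]_(x in I) (f x)%:E.
Proof.
move=> cf hf.
have ic (h : R -> R) : continuous h -> mu.-integrable I (EFin \o h).
  move=> ch; apply: continuous_compact_integrable; first exact: segment_compact.
  exact: continuous_subspaceT.
have dc x : is_derive x (1%R : R) (fun x => c * x)%R c.
  by apply: is_derive_eq; rewrite /GRing.scale /=; ring.
have -> : (c * (2 * L))%:E = \int[mu]_(x in I) c%:E.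
  by rewrite (segment_FTC (@cst_continuous _ _ c) dc); congr EFin; ring.
apply: le_integral => //.
- exact: (ic (fun=> c) (@cst_continuous _ _ c)).
- exact: ic.
- by move=> x; rewrite inE /= in_itv /= => xI; rewrite lee_fin hf.
Qed.

(** [P + Q] is the divergence of [(V, W)]. Each pair of opposite sides, of length [2 * L],
    contributes at least [- c * (2 * L)], so four times the integral of [g] is at most
    [4 * c * L]. *)
Lemma square_divergence_bound (g V W P Q : R -> R -> R) (c : R) :
  cont2 g -> cont2 V -> cont2 W -> cont2 P -> cont2 Q ->
  (forall x y, is_derive x (1%R : R) (V ^~ y) (P x y)) ->
  (forall x y, is_derive y (1%R : R) (W x) (Q x y)) ->
  (forall x y, P x y + Q x y <= - 4 * g x y)%R ->
  (forall t, - L <= t <= L -> - c <= V L t - V (- L) t)%R ->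
  (forall t, - L <= t <= L -> - c <= W t L - W t (- L))%R ->
  \int[m2]_(p in I `*` I) (g p.1 p.2)%:E <= (c * L)%:E.
Proof.
move=> cg cV cW cP cQ dV dW PQg bV bW.
have [_ EP] := square_integral_iterated cP.
have [EQ _] := square_integral_iterated cQ.
have hP : (- c * (2 * L))%:E <= \int[m2]_(p in I `*` I) (P p.1 p.2)%:E.
  rewrite EP; under eq_integral => y _ do
    rewrite (segment_FTC (@cont2_l P y cP) (fun x => dV x y)).
  apply: segment_integral_ge bV.
  by move=> y; apply: cvgB; exact: cont2_r.
have hQ : (- c * (2 * L))%:E <= \int[m2]_(p in I `*` I) (Q p.1 p.2)%:E.
  rewrite EQ; under eq_integral => x _ do
    rewrite (segment_FTC (@cont2_r Q x cQ) (dW x)).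
  apply: segment_integral_ge bW.
  by move=> x; apply: cvgB; exact: cont2_l.
have ig := square_integrable cg.
have iP := square_integrable cP.
have iQ := square_integrable cQ.
have mD := measurable_square.
have h4 : \int[m2]_(p in I `*` I) (P p.1 p.2)%:E +
    \int[m2]_(p in I `*` I) (Q p.1 p.2)%:E <=
    (- 4)%:E * \int[m2]_(p in I `*` I) (g p.1 p.2)%:E.
  rewrite -integralD// -integralZl//.
  apply: le_integral => //.
  - exact: integrableD.
  - exact: integrableZl.
  - by move=> p _; rewrite -EFinD -EFinM lee_fin PQg.
have := le_trans (leeD hP hQ) h4.
have [r ->] : exists r, \int[m2]_(p in I `*` I) (g p.1 p.2)%:E = r%:E.
  have : \int[m2]_(p in I `*` I) (g p.1 p.2)%:E \is a fin_num.
    exact: integrable_fin_num.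
  by move=> /fineK <-; eexists.
by rewrite -EFinD -EFinM !lee_fin; lra.
Qed.
End square.

(** Monotone convergence along the squares with integer half-side; finitely many of them may violate
    the bound. *)
Lemma plane_integral_le (g : R -> R -> R) (M : R) : cont2 g ->
  (forall x y, 0 <= g x y)%R ->
  (exists L0 : R, forall L : R, (L0 <= L)%R ->
    \int[mu \x mu]_(p in `[(- L)%R, L]%classic `*` `[(- L)%R, L]%classic)
      (g p.1 p.2)%:E <= M%:E) ->
  \int[mu \x mu]_(p in [set: R * R]) (g p.1 p.2)%:E <= M%:E.
Proof.
move=> cg g0 [L0 H].
pose D (n : nat) : set (R * R) :=
  `[(- n%:R)%R, n%:R]%classic `*` `[(- n%:R)%R, n%:R]%classic.
have DT : \bigcup_n D n = setT.
  apply/seteqP; split=> // -[x y] _.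
  exists (Num.truncn (`|x| + `|y|)).+1 => //.
  have := truncnS_gt (`|x| + `|y|); set n := _.+1 => h.
  have := ler_norm x; have := ler_norm (- x); rewrite normrN => ? ?.
  have := ler_norm y; have := ler_norm (- y); rewrite normrN => ? ?.
  have := normr_ge0 x; have := normr_ge0 y => ? ?.
  by split; rewrite /= in_itv /=; apply/andP; split; lra.
pose f (p : measurableTypeR R * measurableTypeR R) : R := g p.1 p.2.
have mf : measurable_fun setT f by exact: continuous_prod_measurable.
have C : \int[mu \x mu]_(p in D i) (g p.1 p.2)%:E @[i --> \oo] -->
    \int[mu \x mu]_(p in \bigcup_i D i) (g p.1 p.2)%:E.
  apply: ge0_nondecreasing_set_cvg_integral.
  - move=> m n mn; apply/subsetPset => -[x y] [] /=; rewrite !in_itv /= => h1 h2.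
    have : (m%:R <= n%:R :> R)%R by rewrite ler_nat.
    by move=> h; split; rewrite /= in_itv /=; lra.
  - by move=> n; apply: measurableX; exact: measurable_itv.
  - by move=> n; apply/measurable_realfun.measurable_EFinP; exact: measurable_funTS.
  - by move=> n x _; rewrite lee_fin.
rewrite -DT; apply: (cvge_to_le C).
near=> n; apply: H; near: n; exact: nbhs_infty_ger.
Unshelve. all: by end_near. Qed.
End divergence.

(** * The Fubini-Study metric on complex tangent lines *)

Section FS.
Variables (R : realType) (n : nat).
Implicit Types (z v w : Cvec R n).

Lemma hprojE z v : hproj z v = v + (- (hdot v z / hdot z z)) *: z.
Proof. by rewrite scaleNr. Qed.

Lemma hdot_hproj z v w : z != 0 -> hdot (hproj z v) (hproj z w) =
  (hdot z z * hdot v w - hdot v z * hdot z w) / hdot z z.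
Proof.
move=> z0; have a0 : hdot z z != 0.
  by rewrite hdotE -(rmorph0 (real_complex R)) (inj_eq (@complexI R)) hnorm2_eq0.
have ac : (hdot z z)^*%R = hdot z z by rewrite -hdotC.
rewrite !hprojE !(hdotDl, hdotDr, hdotZl, hdotZr) !rmorphN !rmorphM /= fmorphV /= ac.
rewrite -[(hdot w z)^*%R]hdotC.
move: (hdot z z) (hdot v w) (hdot v z) (hdot z w) a0 => a p q r a0.
by field.
Qed.

Lemma FS_self z v : z != 0 -> FS z v v = garea z v.
Proof.
move=> z0; have a0 : hnorm2 z != 0 by rewrite hnorm2_eq0.
rewrite /FS hdot_hproj// /garea -/(jN z v) jN_real hdotE.
rewrite -!fmorphV -!rmorphM /=; field.
by [].
Qed.

Lemma FS_Zi z v : z != 0 -> FS z ('i%C *: v) ('i%C *: v) = garea z v.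
Proof.
move=> z0; rewrite FS_self// /garea; congr (complex.Re _ / _).
have ii : 'i%C * 'i%C = -1 :> R[i] by rewrite -expr2 sqr_i.
have ic : ('i%C : R[i])^*%R = - 'i%C.
  by apply/eqP; rewrite eq_complex /= oppr0 !eqxx.
by rewrite /jN !(hdotZl, hdotZr) ic; ring: ii.
Qed.

Lemma FS_orth z v : z != 0 -> FS z v ('i%C *: v) = 0.
Proof.
move=> z0; have a0 : hnorm2 z != 0 by rewrite hnorm2_eq0.
have ic : ('i%C : R[i])^*%R = - 'i%C.
  by apply/eqP; rewrite eq_complex /= oppr0 !eqxx.
rewrite /FS hdot_hproj// !hdotZr ic.
have -> : hdot z z * (- 'i%C * hdot v v) - hdot v z * (- 'i%C * hdot z v) = - 'i%C * jN z v.
  by rewrite /jN; ring.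
by rewrite jN_real hdotE -fmorphV /=; ring.
Qed.

Lemma derive_i (u : C R -> Cvec R n) (s : C R) : derivable u s (1 : C R) ->
  'D_('i%C : C R) u s = 'i%C *: 'D_1 u s.
Proof.
move=> /derivable1_diffP du; rewrite !deriveE// diff1E//.
by rewrite scale1r.
Qed.
End FS.

(** Strictness leaves the room between 8 and 4 pi that absorbs the error terms of the flux. *)
Lemma pi_gt2 (R : realType) : 2 < pi :> R.
Proof.
rewrite lt_neqAle pi_ge2 andbT; apply/eqP => p2.
have := @cos1_gt0 R; have := @cos_pihalf R; rewrite -p2 divff// => ->.
by rewrite ltxx.
Qed.

Lemma plane_continuous (R : realType) :
  continuous (fun p : R * R => (p.1 +i* p.2 : C R)).
Proof.
move=> p; apply/continuous_complexP; split => /=; [exact: cvg_fst|exact: cvg_snd].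
Qed.

Lemma plane_comp_continuous (R : realType) (T : topologicalType) (F : C R -> T) :
  continuous F -> continuous (fun p : R * R => F (p.1 +i* p.2)).
Proof.
move=> cF p; apply: (@continuous_comp _ _ _ (fun p : R * R => (p.1 +i* p.2 : C R)) F).
  exact: plane_continuous.
exact: cF.
Qed.

Lemma continuous_unit_disc_bounded (R : realType) (F : C R -> C R) : continuous F ->
  exists M : R, forall z, normc z <= 1 -> normc (F z) <= M.
Proof.
move=> cF; have cD : compact (`[(-1 : R), 1]%classic `*` `[(-1 : R), 1]%classic).
  by apply: compact_setX; exact: segment_compact.
have cr (h : C R -> R) : continuous h ->
    exists M : R, forall z, normc z <= 1 -> `|h z| <= M.
  move=> ch; pose f (p : R * R) : R := h (p.1 +i* p.2).
  have cf : {within `[(-1 : R), 1]%classic `*` `[(-1 : R), 1]%classic, continuous f}.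
    by apply: continuous_subspaceT; exact: plane_comp_continuous.
  have [M [_ hM]] := compact_bounded (continuous_compact cf cD).
  exists (M + 1) => -[x y] hz; apply: (hM (M + 1)); first by rewrite ltrDl.
  exists (x, y) => //; have := normc_Re (x +i* y); have := normc_Im (x +i* y).
  rewrite !ler_norml => h1 h2; set q := normc _ in hz h1 h2; move: h1 h2 => /= h1 h2.
  by split; rewrite /= in_itv /=; lra.
have [M1 h1] := cr (fun z => complex.Re (F z)) (fun z => ((continuous_complexP F z).1 (cF z)).1).
have [M2 h2] := cr (fun z => complex.Im (F z)) (fun z => ((continuous_complexP F z).1 (cF z)).2).
exists (M1 + M2) => z hz; apply: le_trans (normc_ler _) _; have := h1 z hz; have := h2 z hz; lra.
Qed.

Section area.
Variables (R : realType) (n : nat) (Gamma : proj_space R 1 -> proj_space R n).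
Hypothesis Gamma_hol : holomorphic Gamma.
Hypothesis Gamma_imm : immersion Gamma.
Local Notation u := (local_expr Gamma).
Local Notation deriv2 f := (deriv (deriv f)).

(** Holomorphic maps are conformal: the images of the two coordinate directions are orthogonal and
    of equal length, so the square root of the Gram determinant is the common squared length. *)
Lemma area_densityE (s : C R) : area_density Gamma s = jetg Gamma ord0 s.
Proof.
have cs := chartP Gamma ord0 s; have [_ ds] := Gamma_hol cs.
rewrite /area_density -/(chart Gamma ord0 s) /=.
have z0 := local_expr_neq0 cs.
rewrite derive_i// FS_self// FS_Zi// FS_orth// expr0n subr0 -expr2 sqrtr_sqr.
rewrite ger0_norm ?divr_ge0 ?jN_ge0 ?exprn_ge0 ?hnorm2_ge0//.
Qed.

Lemma jetg_ge0 s : 0 <= jetg Gamma ord0 s.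
Proof. by rewrite /jetg /garea divr_ge0 ?jN_ge0 ?exprn_ge0 ?hnorm2_ge0. Qed.

(** The inversion formula writes the left side as s^-2 times the jet function of the other
    parametrisation at 1 / s, which is bounded on the closed unit disc. *)
Lemma jetp_boundary : exists C0 : R, forall (L : R) (s : C R), 1 <= L -> L <= normc s ->
  normc (jetp Gamma ord0 s + 2 * s^-1) <= C0 / L ^+ 2.
Proof.
have c1 : continuous (jetp Gamma (lift ord0 ord0) : C R -> C R).
  by move=> s; exact: ccts_jetp.
have [M hM] := continuous_unit_disc_bounded c1.
exists M => L s L1 Ls; have L0 : 0 < L by lra.
have ns0 : 0 < normc s by apply: lt_le_trans Ls.
have s0 : s != 0 by apply: contraTneq ns0 => ->; rewrite normc0 ltxx.
rewrite (jetp_inversion Gamma_hol Gamma_imm s0) subrK normcM normcN.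
rewrite expr2 normcM normcV -expr2.
have i1 : (normc s)^-1 <= L^-1 by rewrite lef_pV2 ?posrE.
have i0 : 0 <= (normc s)^-1 by rewrite invr_ge0 ltW.
rewrite mulrC -exprVn; apply: ler_pM; rewrite ?normc_ge0 ?exprn_ge0//.
  by apply: hM; rewrite normcV; apply: (le_trans i1); rewrite invf_le1.
by rewrite ler_pXn2r ?nnegrE// invr_ge0 ltW.
Qed.

Hypothesis curvature : forall s, let f := u ord0 (chart Gamma ord0 s) in
  complex.Re (jcurv (f s) (deriv f s) (deriv2 f s)) * hnorm2 (f s) ^+ 2 <=
    complex.Re (jN (f s) (deriv f s)) ^+ 3.

Lemma jetp_dzbar_le s : complex.Re (jetp_dzbar Gamma ord0 s) <= - jetg Gamma ord0 s.
Proof.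
have cs := chartP Gamma ord0 s.
exact: (Re_jp_dzbar_le (local_expr_neq0 cs) (jN_local_expr_neq0 Gamma_hol Gamma_imm cs) (curvature s)).
Qed.

Lemma Vol_lt : (Vol Gamma < (4 * pi)%:E)%E.
Proof.
have [C0 hC] := jetp_boundary.
pose p x y : R[i] := jetp Gamma ord0 (x +i* y).
(* [(V, W)] is the gradient of log g: its partial derivatives are [2 * Re p] and [- 2 * Im p]. *)
pose V x y := 2 * complex.Re (p x y); pose W x y := - 2 * complex.Im (p x y).
pose dz x y := jetp_dz Gamma ord0 (x +i* y).
pose dzb x y := jetp_dzbar Gamma ord0 (x +i* y).
pose P x y := 2 * complex.Re (dz x y + dzb x y).
pose Q x y := - 2 * complex.Re (dz x y - dzb x y).
pose g x y := jetg Gamma ord0 (x +i* y).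
have e0 : 0 < 2 * pi - 4 :> R by have := pi_gt2 R; lra.
have cRe (F : C R -> R[i]) : (forall s, ccts s F) ->
    cont2 (fun x y => complex.Re (F (x +i* y))).
  move=> cF; apply: (@plane_comp_continuous _ _ (fun z => complex.Re (F z))) => z.
  exact: ((continuous_complexP F z).1 (cF z)).1.
have cIm (F : C R -> R[i]) : (forall s, ccts s F) ->
    cont2 (fun x y => complex.Im (F (x +i* y))).
  move=> cF; apply: (@plane_comp_continuous _ _ (fun z => complex.Im (F z))) => z.
  exact: ((continuous_complexP F z).1 (cF z)).2.
have cZ (F : R -> R -> R) (c : R) : cont2 F -> cont2 (fun x y => c * F x y).
  by move=> cF q; apply: cvgM; [exact: cvg_cst|exact: cF].
have cg : cont2 g.
  by apply: plane_comp_continuous => s; exact: jetg_continuous.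
have cV : cont2 V by apply: cZ; apply: cRe => s; exact: ccts_jetp.
have cW : cont2 W by apply: cZ; apply: cIm => s; exact: ccts_jetp.
have cdz s : ccts s (jetp_dz Gamma ord0) by exact: ccts_jetp_dz.
have cdzb s : ccts s (jetp_dzbar Gamma ord0) by exact: ccts_jetp_dzbar.
have cP : cont2 P.
  by apply: cZ; apply: (cRe (fun s => jetp_dz Gamma ord0 s + jetp_dzbar Gamma ord0 s)) => s; exact: cctsD.
have cQ : cont2 Q.
  apply: cZ; apply: (cRe (fun s => jetp_dz Gamma ord0 s - jetp_dzbar Gamma ord0 s)) => s.
  by apply: cctsD => //; exact: cctsN.
have dV x y : is_derive x (1 : R) (V ^~ y) (P x y).
  have [[H _] _] := wder_jetp Gamma_hol Gamma_imm ord0 (x +i* y).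
  exact: (is_deriveZ 2 H).
have dW x y : is_derive y (1 : R) (W x) (Q x y).
  have [_ [_ H]] := wder_jetp Gamma_hol Gamma_imm ord0 (x +i* y).
  apply: (is_derive_eq (is_deriveZ (- 2) H)); rewrite /Q /dz /dzb /GRing.scale /=.
  by case: (_ - _) => a b /=; ring.
have PQ x y : P x y + Q x y <= - 4 * g x y.
  have E (a b : R[i]) : 2 * complex.Re (a + b) + - 2 * complex.Re (a - b) = 4 * complex.Re b.
    by case: a b => ? ? [? ?] /=; ring.
  have := jetp_dzbar_le (x +i* y); rewrite /P /Q E /g /dzb; lra.
(* The margin [2 * pi - 4] is half of the gap between 8 and [4 * pi]. *)
apply: (@le_lt_trans _ _ (8 + (2 * pi - 4))%:E); last by rewrite lte_fin; lra.
have -> : Vol Gamma = (\int[lebesgue_measure \x lebesgue_measure]_(q in [set: R * R]) (g q.1 q.2)%:E)%E.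
  by apply: eq_integral => q _; rewrite area_densityE.
apply: plane_integral_le => //; first by move=> x y; exact: jetg_ge0.
pose M := `|C0|.
(* From this side length on the error [4 * M / L] is at most [2 * pi - 4]; the summand 1 ensures
   [1 <= L], as [jetp_boundary] demands. *)
exists (1 + 4 * M / (2 * pi - 4)) => L hL.
have M0 : 0 <= M by exact: normr_ge0.
have L1 : 1 <= L by apply: le_trans hL; rewrite lerDl divr_ge0 ?mulr_ge0 ?(ltW e0).
have L0 : 0 < L by lra.
pose q := 2 * M / L ^+ 2.
have bd (s : C R) : L <= normc s ->
    - q <= 2 * complex.Re (jetp Gamma ord0 s) + 4 * complex.Re s^-1 <= q /\
    - q <= 2 * complex.Im (jetp Gamma ord0 s) + 4 * complex.Im s^-1 <= q.
  move=> Ls; have H := hC L s L1 Ls.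
  have {}H : normc (jetp Gamma ord0 s + 2 * s^-1) <= M / L ^+ 2.
    by apply: le_trans H _; rewrite ler_pM2r ?invr_gt0 ?exprn_gt0// ler_norm.
  have := le_trans (normc_Re _) H; have := le_trans (normc_Im _) H.
  have -> : complex.Re (jetp Gamma ord0 s + 2 * s^-1) = complex.Re (jetp Gamma ord0 s) + 2 * complex.Re s^-1.
    by case: (jetp _ _ _) (s^-1) => ? ? [? ?] /=; ring.
  have -> : complex.Im (jetp Gamma ord0 s + 2 * s^-1) = complex.Im (jetp Gamma ord0 s) + 2 * complex.Im s^-1.
    by case: (jetp _ _ _) (s^-1) => ? ? [? ?] /=; ring.
  rewrite !ler_norml => /andP[a1 a2] /andP[a3 a4].
  have -> : q = 2 * (M / L ^+ 2) by rewrite /q mulrA.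
  by split; apply/andP; split; lra.
have inv_le (x y : R) : x ^+ 2 = L ^+ 2 -> `|x / (x ^+ 2 + y ^+ 2)| <= L^-1.
  move=> xL; have x0 : `|x| = L.
    by apply/eqP; rewrite -(eqrXn2 (n := 2)) ?normr_ge0 ?(ltW L0)// real_normK ?num_real ?xL.
  have d0 : 0 < x ^+ 2 + y ^+ 2 by rewrite xL ltr_wpDr ?sqr_ge0// exprn_gt0.
  rewrite normrM normfV x0 (gtr0_norm d0) ler_pdivrMr// mulrC ler_pdivlMr//.
  by rewrite xL -expr2 lerDl sqr_ge0.
have big (x y : R) : x ^+ 2 = L ^+ 2 -> L <= normc (x +i* y) /\ L <= normc (y +i* x).
  move=> xL; have h : L = Num.sqrt (x ^+ 2) by rewrite xL sqrtr_sqr ger0_norm// ltW.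
  by rewrite h /= !ler_sqrt ?addr_ge0 ?sqr_ge0// lerDl lerDr sqr_ge0.
have ReV (x y : R) : complex.Re (x +i* y)^-1 = x / (x ^+ 2 + y ^+ 2) by [].
have ImV (x y : R) : complex.Im (x +i* y)^-1 = - (y / (x ^+ 2 + y ^+ 2)).
  by [].
have sN : (- L) ^+ 2 = L ^+ 2 by rewrite sqrrN.
(* On each side the normal component of the gradient is, up to sign, that of 4 / s with error at
   most [q], and the relevant part of 1 / s is at most [L^-1] in absolute value. Two opposite sides
   double both terms. *)
pose c := 8 * L^-1 + 2 * q.
have arith (a1 a2 r1 r2 w : R) : - q <= 2 * a1 + 4 * r1 <= q ->
    - q <= 2 * a2 + 4 * r2 <= q -> `|r1| <= w -> `|r2| <= w ->
    - (8 * w + 2 * q) <= 2 * a1 - 2 * a2.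
  by rewrite !ler_norml => /andP[? ?] /andP[? ?] /andP[? ?] /andP[? ?]; lra.
apply: (@le_trans _ _ (c * L)%:E).
  apply: (square_divergence_bound L0 cg cV cW cP cQ dV dW PQ) => t _.
    exact: arith (bd _ (big L t erefl).1).1 (bd _ (big (- L) t sN).1).1
      (inv_le L t erefl) (inv_le (- L) t sN).
  have i1 : `|complex.Im (t +i* L)^-1| <= L^-1.
    by rewrite ImV normrN addrC; exact: inv_le.
  have i2 : `|complex.Im (t +i* - L)^-1| <= L^-1.
    by rewrite ImV normrN addrC; exact: inv_le.
  have swap (a1 a2 : R) : - c <= 2 * a1 - 2 * a2 -> - c <= - 2 * a2 - - 2 * a1 by lra.
  apply: (swap (complex.Im (p t (- L))) (complex.Im (p t L))).
  exact: arith (bd _ (big (- L) t sN).2).2 (bd _ (big L t erefl).2).2 i2 i1.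
have -> : c * L = 8 + 4 * M / L by rewrite /c /q; field; rewrite gt_eqF.
have h4 : 4 * M <= L * (2 * pi - 4).
  by rewrite -ler_pdivrMr// (le_trans _ hL)// lerDr.
by rewrite lee_fin lerD2l ler_pdivrMr// [leRHS]mulrC.
Qed.
End area.

(** * Focal points *)

Section velocity.
Variables (R : realType) (n : nat).
Implicit Types (c d : R -> Cvec R n) (u v w z : Cvec R n) (t r : R).

Lemma has_velocityP c t v :
  has_velocity c t v <-> forall k, cvel (fun x => c x 0 k) t (v 0 k).
Proof. by split => H k; exact: H k. Qed.

Lemma cvel_sum (I : finType) (F : I -> R -> R[i]) t (u : I -> R[i]) :
  (forall i, cvel (F i) t (u i)) -> cvel (fun x => \sum_i F i x) t (\sum_i u i).
Proof.
move=> H; have K (r : seq I) : cvel (fun x => \sum_(i <- r) F i x) t (\sum_(i <- r) u i).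
  elim: r => [|i r IH].
    rewrite big_nil; have -> : (fun x => \sum_(i <- [::]) F i x) = (fun=> 0).
      by apply/funext => x; rewrite big_nil.
    exact: cvel_cst.
  rewrite big_cons; have -> : (fun x => \sum_(j <- i :: r) F j x) =
      (fun x => F i x + \sum_(j <- r) F j x).
    by apply/funext => x; rewrite big_cons.
  exact: cvelD.
exact: K.
Qed.

Lemma has_velocity_cst u t : has_velocity (fun=> u) t 0.
Proof. by apply/has_velocityP => k; rewrite mxE; exact: cvel_cst. Qed.

Lemma has_velocityD c d t u v : has_velocity c t u -> has_velocity d t v ->
  has_velocity (fun x => c x + d x) t (u + v).
Proof.
move=> /has_velocityP H1 /has_velocityP H2; apply/has_velocityP => k; rewrite mxE.
have -> : (fun x => (c x + d x) 0 k) = (fun x => c x 0 k + d x 0 k).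
  by apply/funext => x; rewrite mxE.
exact: cvelD.
Qed.

Lemma has_velocityZ (a : R -> R[i]) c t (b : R[i]) u : cvel a t b -> has_velocity c t u ->
  has_velocity (fun x => a x *: c x) t (b *: c t + a t *: u).
Proof.
move=> H1 /has_velocityP H2; apply/has_velocityP => k; rewrite !mxE.
have -> : (fun x => (a x *: c x) 0 k) = (fun x => a x * c x 0 k).
  by apply/funext => x; rewrite mxE.
exact: cvelM.
Qed.

Lemma has_velocity_eq c t v v' : has_velocity c t v -> v = v' -> has_velocity c t v'.
Proof. by move=> ? <-. Qed.

Lemma cvel_hdot c d t u v : has_velocity c t u -> has_velocity d t v ->
  cvel (fun x => hdot (c x) (d x)) t (hdot u (d t) + hdot (c t) v).
Proof.
move=> /has_velocityP H1 /has_velocityP H2.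
have H k := cvelM (H1 k) (cvel_conj (H2 k)).
have := cvel_sum H; congr cvel.
by rewrite /hdot -big_split.
Qed.

Lemma cvel_real (a : R -> R) t (b : R) : is_derive t (1 : R) a b ->
  cvel (fun x => (a x)%:C) t b%:C.
Proof. by move=> H; split => /=; [exact: H|exact: is_derive_cst]. Qed.

Lemma has_velocity_holomorphic (f : C R -> Cvec R n) (s : C R) v :
  is_derive s (1 : C R) f v -> has_velocity (fun t => f (s + t%:C)) 0 v.
Proof.
move=> /is_derive_rowP H; apply/has_velocityP => k.
have h : cvel (fun t => s + t%:C) 0 1.
  rewrite -[X in cvel _ _ X]add0r; apply: cvelD; first exact: cvel_cst.
  by apply: (@cvel_real id); exact: is_derive_id.
have E : s + (0 : R)%:C = s by rewrite rmorph0 addr0.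
have Hk := H k; rewrite -[s in is_derive s]E in Hk.
by have := cvel_comp h Hk; rewrite mul1r.
Qed.

Lemma inv_sqrt_estimate (x : R) : 1 / 4 <= x -> `|(Num.sqrt x)^-1 - 1| <= 4 * `|x - 1|.
Proof.
move=> hx; have x0 : 0 < x by lra.
set q := Num.sqrt x; have q0 : 0 < q by rewrite sqrtr_gt0.
have qq : q ^+ 2 = x by rewrite sqr_sqrtr// ltW.
have q2 : 1 / 2 <= q.
  rewrite leNgt; apply/negP => h; have : q * q < 1 / 2 * (1 / 2).
    by apply: ltr_pM => //; exact: ltW.
  by rewrite -expr2 qq; lra.
have -> : q^-1 - 1 = (1 - x) / (q * (1 + q)).
  by rewrite -qq; field; rewrite !gt_eqF//; lra.
rewrite normrM normfV [`|q * _|]gtr0_norm ?mulr_gt0//; last lra.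
rewrite ler_pdivrMr; last by rewrite mulr_gt0//; lra.
rewrite distrC mulrAC -[leLHS]mul1r ler_wpM2r//; nra.
Qed.

(** The stationary case is what normalising a curve requires when its squared length is 1 with zero
    derivative; it follows from the Lipschitz bound [inv_sqrt_estimate] near 1. *)
Lemma is_derive_inv_sqrt (a : R -> R) t : is_derive t (1 : R) a (0 : R) -> a t = 1 ->
  is_derive t (1 : R) (fun x => (Num.sqrt (a x))^-1) (0 : R).
Proof.
move=> /is_derive_realP H at1; apply/is_derive_realP => e e0.
have e40 : 0 < e / 4 by lra.
have [d1 d10 h1] := H _ e40; have [d2 d20 h2] := H 1 ltr01.
exists (Num.min d1 (Num.min d2 (1 / 2))); first by rewrite !lt_min d10 d20; lra.
move=> h; rewrite !lt_min => /andP[/h1 {}h1 /andP[/h2 {}h2 h3]].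
rewrite at1 sqrtr1 invr1 mulr0 subr0 in h1 h2 *.
have : 1 / 4 <= a (t + h).
  by move: h2; rewrite mul1r ler_norml => /andP[]; lra.
rewrite subr0; move=> /inv_sqrt_estimate /le_trans; apply; lra.
Qed.

Definition arc z w r : Cvec R n := (cos r)%:C *: z + (sin r)%:C *: w.

Lemma hdot_arc z w r : hdot z z = 1 -> hdot w w = 1 -> hdot w z = 0 ->
  hdot (arc z w r) (arc z w r) = 1.
Proof.
move=> zz ww wz; have zw : hdot z w = 0 by rewrite hdotC wz rmorph0.
rewrite /arc !(hdotDl, hdotDr, hdotZl, hdotZr) zz ww wz zw.
rewrite !mulr0 !addr0 add0r !mulr1 ![(_%:C)^*%R]conjc_real -!rmorphM -rmorphD /=.
by rewrite -!expr2 cos2Dsin2.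
Qed.

Lemma is_derive_cos_sin r t :
  is_derive t (1 : R) (fun x => cos (r * x)) (- (r * sin (r * t))) /\
  is_derive t (1 : R) (fun x => sin (r * x)) (r * cos (r * t)).
Proof.
have dr : is_derive t (1 : R) (fun x => r * x) r.
  by apply: is_derive_eq; rewrite /GRing.scale /=; ring.
have hc : cvel (fun x => (0 +i* (r * x) : C R)) t (0 +i* r).
  by split => /=; [exact: is_derive_cst|exact: dr].
have [h1 h2] := cvel_comp hc (is_derive_cexp _).
have E x : cexp (0 +i* (r * x)) = cos (r * x) +i* sin (r * x).
  by rewrite /cexp /= expR0 rmorph1 mul1r.
rewrite E in h1 h2; split.
  have -> : (fun x => cos (r * x)) = (fun x => complex.Re ((@cexp R \o (fun x => (0 +i* (r * x) : C R))) x)).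
    by apply/funext => x; exact: esym (congr1 (@complex.Re R) (E x)).
  by apply: (is_derive_eq h1); rewrite /=; ring.
have -> : (fun x => sin (r * x)) = (fun x => complex.Im ((@cexp R \o (fun x => (0 +i* (r * x) : C R))) x)).
  by apply/funext => x; exact: esym (congr1 (@complex.Im R) (E x)).
by apply: (is_derive_eq h2); rewrite /=; ring.
Qed.

Lemma has_velocity_arc z w r t : has_velocity (fun x => arc z w (r * x)) t
  ((- (r * sin (r * t)))%:C *: z + (r * cos (r * t))%:C *: w).
Proof.
have [dc ds] := is_derive_cos_sin r t.
have := has_velocityD (has_velocityZ (cvel_real dc) (has_velocity_cst z t))
  (has_velocityZ (cvel_real ds) (has_velocity_cst w t)).
by rewrite !scaler0 !addr0.
Qed.

Lemma has_velocity_arc2 z w r t :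
  has_velocity (fun x => (- (r * sin (r * x)))%:C *: z + (r * cos (r * x))%:C *: w) t
  ((- r ^+ 2)%:C *: arc z w (r * t)).
Proof.
have [dc ds] := is_derive_cos_sin r t.
have dc' : is_derive t (1 : R) (fun x => r * cos (r * x)) (- (r ^+ 2 * sin (r * t))).
  by apply: (is_derive_eq (is_deriveZ r dc)); rewrite /GRing.scale /=; ring.
have ds' : is_derive t (1 : R) (fun x => - (r * sin (r * x))) (- (r ^+ 2 * cos (r * t))).
  by apply: (is_derive_eq (is_deriveN (is_deriveZ r ds))); rewrite /GRing.scale /=; ring.
have := has_velocityD (has_velocityZ (cvel_real ds') (has_velocity_cst z t))
  (has_velocityZ (cvel_real dc') (has_velocity_cst w t)).
move=> /has_velocity_eq; apply; rewrite !scaler0 !addr0 /arc scalerDr !scalerA.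
by rewrite -!rmorphM /= !mulNr.
Qed.

Lemma hproj_scale z (a : R[i]) : hdot z z != 0 -> hproj z (a *: z) = 0.
Proof. by move=> z0; rewrite /hproj hdotZl mulfK// subrr. Qed.

(** A great circle with horizontal initial velocity remains horizontal, and its acceleration is a
    multiple of the position vector, which the horizontal projection kills. *)
Lemma is_exp_arc z w r : hdot z z = 1 -> hdot w w = 1 -> hdot w z = 0 ->
  is_exp z (r%:C *: w) (arc z w r).
Proof.
move=> zz ww wz; have zw : hdot z w = 0 by rewrite hdotC wz rmorph0.
exists (fun x => arc z w (r * x)); split.
- exists (fun x => (- (r * sin (r * x)))%:C *: z + (r * cos (r * x))%:C *: w).
  exists (fun x => (- r ^+ 2)%:C *: arc z w (r * x)) => t.
  have h1 := hdot_arc (r * t) zz ww wz.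
  split => //; [|exact: has_velocity_arc|exact: has_velocity_arc2|].
    rewrite /arc !(hdotDl, hdotDr, hdotZl, hdotZr) zz ww wz zw.
    rewrite !mulr0 !addr0 add0r !mulr1 ![(_%:C)^*%R]conjc_real -!rmorphM -rmorphD /=.
    by apply/eqP; rewrite eq_complex /=; apply/andP; split; apply/eqP; [ring|].
  by apply: hproj_scale; rewrite h1 oner_neq0.
- by rewrite /arc mulr0 cos0 sin0 rmorph1 rmorph0 scale1r scale0r addr0.
- have := has_velocity_arc z w r 0; rewrite mulr0 sin0 cos0 mulr0 oppr0 mulr1.
  by rewrite rmorph0 scale0r add0r.
- by rewrite mulr1.
Qed.
End velocity.

(** * Tangent and normal vectors of the image *)

Section tangent.
Variables (R : realType) (n : nat) (Gamma : proj_space R 1 -> proj_space R n).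
Hypothesis Gamma_hol : holomorphic Gamma.
Hypothesis Gamma_imm : immersion Gamma.
Hypothesis Gamma_homeo :
  forall U, Defs.proj_open U <-> exists2 V, Defs.proj_open V & U = Gamma @^-1` V.
Local Notation u := (local_expr Gamma).

Lemma ccts_coord (m : nat) (z : Cvec R m) k : ccts z (fun w : Cvec R m => w 0 k).
Proof.
by apply/continuous_normcP => e e0; apply/nbhs_rowP; exists e => // w; apply.
Qed.

Lemma coord_scale (x y : Cvec R n) (a : R[i]) k : a != 0 -> x = a *: y ->
  x 0 k * a^-1 = y 0 k.
Proof. by move=> a0 ->; rewrite mxE mulrAC mulfV// mul1r. Qed.

Lemma near_lt_normc (m : nat) (z : Cvec R m) (F : Cvec R m -> R[i]) : ccts z F ->
  forall e : R, 0 < e -> \forall w \near z, normc (F w - F z) < e.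
Proof. by move=> /continuous_normcP. Qed.

(** The quotient of the two homogeneous coordinates is continuous where the first is nonzero. These
    are the open sets to which the homeomorphism hypothesis is applied in [curve_parameter]. *)
Lemma proj_open_param_disc (s : C R) (d : R) :
  Defs.proj_open [set p | exists2 t : C R, normc (t - s) < d & p = param ord0 t].
Proof.
rewrite /Defs.proj_open openE => z /= [z0 [t td zt]].
have i1 : 'I_2 := lift ord0 ord0.
have zE (w : Cvec R 1) : w 0 ord0 != 0 ->
    pt w = param ord0 (w 0 (lift ord0 ord0) / w 0 ord0).
  move=> w0; rewrite /param -[RHS](@ptZ _ _ (w 0 ord0)) ?row2_neq0//; congr pt.
  apply/rowP => k; rewrite !mxE; case: k => -[|[|//]] hk /=.
    by rewrite mulr1; congr (w 0 _); exact: val_inj.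
  by rewrite mulrC divfK//; congr (w 0 _); exact: val_inj.
have w0n (w : Cvec R 1) : w 0 ord0 != 0 -> w != 0.
  by apply: contraNneq => ->; rewrite mxE.
have z00 : z 0 ord0 != 0.
  have := in_chart_pt ord0 z0; rewrite zt /param in_chart_pt ?row2_neq0// mxE eqxx.
  by rewrite oner_neq0 => <-.
have et : t = z 0 (lift ord0 ord0) / z 0 ord0.
  by apply: (@param_inj _ ord0); rewrite -zt zE.
have e0 : 0 < d - normc (t - s) by rewrite subr_gt0.
have n0 : 0 < normc (z 0 ord0).
  by rewrite lt_neqAle normc_ge0 andbT eq_sym; apply: contra z00 => /eqP/eq0_normc ->.
have c1 := near_lt_normc (cctsM (@ccts_coord 1 z (lift ord0 ord0)) (cctsV (@ccts_coord 1 z ord0) z00)) e0.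
have c2 := near_lt_normc (@ccts_coord 1 z ord0) n0.
apply: filterS2 c1 c2 => w h1 h2.
have w0 : w 0 ord0 != 0.
  by apply: contraTneq h2 => ->; rewrite sub0r normcN ltxx.
split; first exact: w0n.
exists (w 0 (lift ord0 ord0) / w 0 ord0); last exact: zE.
have tri (a : R[i]) : a - s = (a - t) + (t - s) by ring.
rewrite tri; apply: le_lt_trans (le_normcD _ _) _.
by move: h1; rewrite -et; lra.
Qed.

Lemma has_velocity_cts (c : R -> Cvec R n) t v : has_velocity c t v ->
  forall d : R, 0 < d -> \forall x \near t, forall k, normc (c x 0 k - c t 0 k) < d.
Proof.
move=> /has_velocityP H d d0.
apply: (@filter_forall _ _ (fun k x => normc (c x 0 k - c t 0 k) < d) (nbhs t) _) => k.
have [/is_derive_continuous c1 /is_derive_continuous c2] := H k.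
have /continuous_normcP/(_ _ d0) : {for t, continuous (fun x => c x 0 k : C R)}.
  by apply/continuous_complexP; split.
exact.
Qed.

(* Gamma is a homeomorphism onto its image, so a curve in the image close to
   Gamma (param ord0 s) comes from parameters close to s. *)
Lemma curve_parameter (c : R -> Cvec R n) (s : C R) v (d : R) : 0 < d ->
  has_velocity c 0 v -> c 0 != 0 -> pt (c 0) = Gamma (param ord0 s) ->
  (\forall t \near (0 : R), range Gamma (pt (c t))) ->
  \forall t \near (0 : R), c t != 0 /\
    exists2 q : C R, normc (q - s) < d & pt (c t) = Gamma (param ord0 q).
Proof.
move=> d0 cv c0 cs near_c.
have [V oV UV] := (Gamma_homeo _).1 (@proj_open_param_disc s d).
have Vc : V (pt (c 0)).
  rewrite cs -[V _]/((Gamma @^-1` V) (param ord0 s)) -UV.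
  by exists s => //; rewrite subrr normc0.
have /nbhs_rowP[e e0 he] : \forall z \near c 0, z != 0 /\ V (pt z).
  by apply: open_nbhs_nbhs; split; [exact: oV|split].
apply: filterS2 near_c (has_velocity_cts cv e0) => t [p _ pE] /he[ct0 Vt].
split=> //; have : (Gamma @^-1` V) p by rewrite /= pE.
by rewrite -UV => -[q qd pq]; exists q => //; rewrite -pE pq.
Qed.

Lemma cvel_bound (c : R -> R[i]) t v : cvel c t v -> exists2 d : R, 0 < d &
  forall h, `|h| < d -> normc (c (t + h) - c t) <= (normc v + 1) * `|h|.
Proof.
move=> /cvelP/(_ 1 ltr01)[d d0 hd]; exists d => // h /hd H.
rewrite -[X in normc X](subrK (h%:C * v)); apply: le_trans (le_normcD _ _) _.
by rewrite normcM normc_real; lra.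
Qed.

Lemma cvel_small (c : R -> R[i]) t v : cvel c t v ->
  (forall e : R, 0 < e -> exists2 d : R, 0 < d & forall h, `|h| < d ->
     normc (c (t + h) - c t) <= e * `|h|) -> v = 0.
Proof.
move=> /cvelP H1 H2; apply: eq0_normc; apply/eqP; rewrite -normr_le0 ger0_norm ?normc_ge0//.
apply/ler_addgt0Pr => e e0; rewrite add0r; have e20 : 0 < e / 2 by lra.
have [d1 d10 h1] := H1 _ e20; have [d2 d20 h2] := H2 _ e20.
pose h := Num.min d1 d2 / 2.
have h0 : 0 < h by rewrite divr_gt0// lt_min d10.
have hm : h < Num.min d1 d2.
  have m0 : 0 < Num.min d1 d2 by rewrite lt_min d10.
  by rewrite /h; lra.
have nh : `|h| = h by rewrite gtr0_norm.
have {}h1 := h1 h; have {}h2 := h2 h; rewrite nh in h1 h2.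
move: hm; rewrite lt_min => /andP[/h1 {}h1 /h2 {}h2].
rewrite -(ler_pM2l h0) -[X in X * normc v]nh -normc_real -normcM.
have -> : h%:C * v = (c (t + h) - c t) - (c (t + h) - c t - h%:C * v) by ring.
by apply: le_trans (le_normcD _ _) _; rewrite normcN; lra.
Qed.

(** A curve in the image has the form [c t = c t 0 j *: f q] with [q] near [s]. The function
    [H q = hdot (f q) w] vanishes at [s] together with its derivative, and [q - s] is O(t), so
    [hdot (c t) w] is o(t) and its velocity [hdot v w] is 0. *)
Lemma tangent_orth j (s : C R) (z w v : Cvec R n) :
  in_chart j (Gamma (param ord0 s)) ->
  z != 0 -> pt z = Gamma (param ord0 s) ->
  hdot w (u ord0 j s) = 0 -> hdot w (deriv (u ord0 j) s) = 0 ->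
  tangent (range Gamma) z v -> hdot v w = 0.
Proof.
move=> cj z0 zs wf wf1 [c [c0 near_c cv]].
set f := u ord0 j in wf wf1; set f1 := deriv f s in wf1.
have df : is_derive s (1 : C R) f f1.
  by have [_ D] := Gamma_hol cj; exact: deriv_is_derive.
have /is_derive_rowP dfk := df.
have zj : z 0 j != 0 by rewrite -in_chart_pt// zs.
have f10 : f1 != 0.
  apply/eqP => f10; have := jN_local_expr_neq0 Gamma_hol Gamma_imm cj.
  by rewrite -/f -/f1 f10 /jN [hdot (f s) 0]hdotC !hdot0l rmorph0 !(mulr0, mul0r) subrr eqxx.
(* A coordinate in which [f] has nonzero derivative: the increment of this affine coordinate along
   the curve is O(t) and bounds [q - s] from above. *)
have [k0 f1k] : exists k0, f1 0 k0 != 0.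
  apply/existsP; apply: contraT => /existsPn H; case/negP: f10; apply/eqP/rowP => k.
  by have := H k; rewrite negbK mxE => /eqP.
pose H (q : C R) : C R := hdot (f q) w.
have dH : is_derive s (1 : C R) H 0.
  have wc (k : 'I_n.+1) : is_derive s (1 : C R) (fun q => f q 0 k * (w 0 k)^*%R : C R) (f1 0 k * (w 0 k)^*%R).
    have := is_deriveM (dfk k) (is_derive_cst ((w 0 k)^*%R : C R) s (1 : C R)).
    by move=> D; apply: (is_derive_eq D); rewrite /GRing.scale /= mulr0 add0r mulrC.
  have := is_derive_sum (fun k => wc k).
  have -> : \sum_k f1 0 k * (w 0 k)^*%R = 0 :> C R by rewrite -[LHS]/(hdot f1 w) hdotC wf1 rmorph0.
  have -> // : \sum_k (fun q => f q 0 k * (w 0 k)^*%R : C R) = H.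
  by apply/funext => q; rewrite fct_sumE.
have Hs : H s = 0 by rewrite /H hdotC wf rmorph0.
have vH : cvel (fun t => hdot (c t) w) 0 (hdot v w).
  have := cvel_hdot cv (has_velocity_cst w 0).
  by rewrite [hdot (c 0) 0]hdotC hdot0l rmorph0 addr0.
apply: (cvel_small vH) => e e0.
have c0j : c 0 0 j != 0 by rewrite c0.
have /has_velocityP cvk := cv.
have vpsi := cvelM (cvk k0) (cvelV (cvk j) c0j).
have [d1 d10 h1] := cvel_bound vpsi; set K := normc _ + 1 in h1.
have K0 : 0 < K by rewrite ltr_wpDl ?normc_ge0.
have [d2 d20 h2] := cvel_bound (cvk j).
set Mj := normc (v 0 j) + 1 in h2.
pose m := normc (f1 0 k0).
have m0 : 0 < m.
  by rewrite lt_neqAle normc_ge0 andbT eq_sym; apply: contra f1k => /eqP/eq0_normc ->.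
pose B := normc (c 0 0 j) + Mj.
have Mj0 : 0 < Mj by rewrite ltr_wpDl ?normc_ge0.
have B0 : 0 < B by rewrite ltr_wpDl ?normc_ge0.
have m20 : 0 < m / 2 by lra.
have [d3 d30 h3] := (is_derive_complexP _ _ _).1 (dfk k0) _ m20.
(* The factor [c t 0 j] costs at most [B], and [normc (q - s)] is at most [2 * K * |t| / m]; with
   this slope for [H] the product is bounded by [e * |t|]. *)
have eK0 : 0 < e * m / (2 * B * K) by rewrite divr_gt0 ?mulr_gt0.
have [d4 d40 h4] := (is_derive_complexP _ _ _).1 dH _ eK0.
have d340 : 0 < Num.min d3 d4 by rewrite lt_min d30.
have [d5 d50 h5] : exists2 d : R, 0 < d & forall t, `|t| < d ->
    c t != 0 /\ exists2 q : C R, normc (q - s) < Num.min d3 d4 & pt (c t) = Gamma (param ord0 q).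
  have := curve_parameter d340 cv _ _ near_c; rewrite c0 => /(_ s z0 zs) /nbhs_realP[d dd hd].
  by exists d => // t ht; apply: hd; rewrite subr0.
have n0j : 0 < normc (c 0 0 j).
  by rewrite lt_neqAle normc_ge0 andbT eq_sym; apply: contra c0j => /eqP/eq0_normc ->.
have [d6 d60 h6] : exists2 d : R, 0 < d & forall t, `|t| < d -> normc (c t 0 j - c 0 0 j) < normc (c 0 0 j).
  have /nbhs_realP[d dd hd] := has_velocity_cts cv n0j.
  by exists d => // t ht; apply: hd; rewrite subr0.
exists (Num.min (Num.min d1 (Num.min d2 1)) (Num.min d5 d6)).
  by rewrite !lt_min d10 d20 ltr01 d50.
move=> t; rewrite !lt_min add0r => /andP[/andP[t1 /andP[t2 t21]] /andP[/h5[ct0 [q qs ctq]] /h6 t6]].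
have ctj : c t 0 j != 0.
  by apply: contraTneq t6 => ->; rewrite sub0r normcN ltxx.
have ctf : c t = c t 0 j *: f q.
  rewrite /f /local_expr -ctq aff_pt// scalerA mulfV// scale1r.
  by [].
have c0f : c 0 = c 0 0 j *: f s.
  rewrite /f /local_expr -zs -c0 aff_pt ?c0// scalerA mulfV ?scale1r//.
have {}h1 := h1 t t1; rewrite add0r in h1.
have p1 : c t 0 k0 * (c t 0 j)^-1 = f q 0 k0 by exact: (coord_scale k0 ctj ctf).
have p0 : c 0 0 k0 * (c 0 0 j)^-1 = f s 0 k0 by exact: (coord_scale k0 c0j c0f).
rewrite p1 p0 in h1.
have {}h2 := h2 t t2; rewrite add0r in h2.
move: qs; rewrite lt_min => /andP[/h3 {}h3 /h4 {}h4].
rewrite [s + _]addrC !subrK in h3 h4.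
rewrite Hs mulr0 !subr0 in h4.
set x := normc (q - s) in h3 h4.
have x0 : 0 <= x by exact: normc_ge0.
have hx : x * m / 2 <= K * `|t|.
  have : normc ((q - s) * f1 0 k0) <= normc (f q 0 k0 - f s 0 k0) + m / 2 * x.
    rewrite -[X in normc X](subKr (f q 0 k0 - f s 0 k0)).
    by apply: le_trans (le_normcD _ _) _; rewrite normcN lerD2l.
  rewrite normcM -/x -/m; lra.
have hB : normc (c t 0 j) <= B.
  rewrite -(subrK (c 0 0 j) (c t 0 j)); apply: le_trans (le_normcD _ _) _.
  have : Mj * `|t| <= Mj * 1 by rewrite ler_wpM2l ?(ltW Mj0)// ltW.
  by rewrite /B; lra.
have -> : hdot (c 0) w = 0 by rewrite c0f hdotZl hdotC wf rmorph0 mulr0.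
rewrite subr0 ctf hdotZl -/(H q) normcM.
apply: (@le_trans _ _ (B * (e * m / (2 * B * K) * x))).
  by apply: ler_pM; rewrite ?normc_ge0.
have -> : B * (e * m / (2 * B * K) * x) = e / K * (x * m / 2) by field; rewrite !gt_eqF.
apply: (@le_trans _ _ (e / K * (K * `|t|))).
  by rewrite ler_pM2l ?divr_gt0.
by rewrite mulrA divfK ?gt_eqF.
Qed.

Lemma normal_vector_curve j (s : C R) (z w : Cvec R n) :
  in_chart j (Gamma (param ord0 s)) -> hdot z z = 1 -> pt z = Gamma (param ord0 s) ->
  hdot w z = 0 ->
  hdot w (u ord0 j s) = 0 -> hdot w (deriv (u ord0 j) s) = 0 ->
  normal_vector (range Gamma) z w.
Proof.
move=> cj zz zs wz wf wf1; split => //; first by rewrite zs; exists (param ord0 s).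
move=> v tv; have z0 : z != 0.
  by apply: contra_eq_neq zz => ->; rewrite hdot0l eq_sym oner_neq0.
have vw := tangent_orth cj z0 zs wf wf1 tv.
have zw : hdot z w = 0 by rewrite hdotC wz rmorph0.
have wv : hdot w v = 0 by rewrite hdotC vw rmorph0.
by rewrite /FS /hproj wz mul0r scale0r subr0 -scaleNr hdotDr hdotZr wz wv mulr0 addr0 mul0r.
Qed.
End tangent.

(** * Normalisation, Gram-Schmidt and a moving normal vector *)

Section frame.
Variables (R : realType) (n : nat).
Implicit Types (c : R -> Cvec R n) (u v w z f g : Cvec R n) (t r : R).

Lemma cvel_neq0 (a : R -> R[i]) t b : cvel a t b -> a t != 0 ->
  \forall x \near t, a x != 0.
Proof.
move=> [/is_derive_continuous c1 /is_derive_continuous c2] a0.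
have n0 : 0 < normc (a t).
  by rewrite lt_neqAle normc_ge0 andbT eq_sym; apply: contra a0 => /eqP/eq0_normc ->.
have /continuous_normcP/(_ _ n0) : {for t, continuous (a : R -> C R)}.
  by apply/continuous_complexP; split.
apply: filterS => x; apply: contraTneq => ->.
by rewrite sub0r normcN ltxx.
Qed.

Definition unitize z : Cvec R n := ((Num.sqrt (hnorm2 z))^-1)%:C *: z.

Lemma hdot_unitize z : hdot z z != 0 -> hdot (unitize z) (unitize z) = 1.
Proof.
rewrite hdotE -(rmorph0 (real_complex R)) (inj_eq (@complexI R)) => z0.
rewrite /unitize hdotZl hdotZr hdotE [_^*%R]conjc_real -!rmorphM /=.
have z1 : 0 < hnorm2 z by rewrite lt_neqAle eq_sym z0 hnorm2_ge0.
rewrite mulrA -invfM -expr2 sqr_sqrtr ?(ltW z1)// mulVf//.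
Qed.

Lemma unitize_id z : hdot z z = 1 -> unitize z = z.
Proof.
rewrite hdotE => /(@complexI R) => z1.
by rewrite /unitize z1 sqrtr1 invr1 scale1r.
Qed.

(** At a unit vector with orthogonal velocity the squared length is stationary, so normalising does
    not change the velocity. *)
Lemma has_velocity_unitize c t v : has_velocity c t v -> hdot (c t) (c t) = 1 ->
  hdot v (c t) = 0 -> has_velocity (fun x => unitize (c x)) t v.
Proof.
move=> cv c1 v0; have := cvel_hdot cv cv.
rewrite v0 hdotC v0 rmorph0 addr0 => -[h _].
have n1 : hnorm2 (c t) = 1 by apply: (@complexI R); rewrite -hdotE.
have {}h : is_derive t (1 : R) (fun x => hnorm2 (c x)) (0 : R).
  have -> : (fun x => hnorm2 (c x)) = (fun x => complex.Re (hdot (c x) (c x))).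
    by apply/funext => x; rewrite hdotE.
  exact: h.
have := has_velocityZ (cvel_real (is_derive_inv_sqrt h n1)) cv.
by rewrite n1 sqrtr1 invr1 rmorph0 scale0r add0r scale1r.
Qed.

Definition rejection v w : Cvec R n := v - (hdot v w / hdot w w) *: w.

Lemma hdot_rejection v w : hdot w w != 0 -> hdot (rejection v w) w = 0.
Proof. by move=> w0; rewrite /rejection -scaleNr hdotDl hdotZl mulNr divfK// subrr. Qed.

Lemma rejection_orth v w z : hdot v z = 0 -> hdot w z = 0 -> hdot (rejection v w) z = 0.
Proof. by move=> v0 w0; rewrite /rejection -scaleNr hdotDl hdotZl v0 w0 mulr0 addr0. Qed.

Lemma rejection_id v w : hdot v w = 0 -> rejection v w = v.
Proof. by move=> v0; rewrite /rejection v0 mul0r scale0r subr0. Qed.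

Lemma has_velocity_rejection (c d : R -> Cvec R n) t v w :
  has_velocity c t v -> has_velocity d t w -> hdot (d t) (d t) != 0 ->
  hdot (c t) (d t) = 0 ->
  has_velocity (fun x => rejection (c x) (d x)) t
    (v - ((hdot v (d t) + hdot (c t) w) / hdot (d t) (d t)) *: d t).
Proof.
move=> cv dw d0 cd.
have h := cvelM (cvel_hdot cv dw) (cvelV (cvel_hdot dw dw) d0).
have {}h := has_velocityZ (cvel_cst (-1) t) (has_velocityZ h dw).
have := has_velocityD cv h.
have -> : (fun x => c x + -1 *: ((hdot (c x) (d x) * (hdot (d x) (d x))^-1) *: d x)) =
    (fun x => rejection (c x) (d x)).
  by apply/funext => x; rewrite scaleN1r.
move=> /has_velocity_eq; apply.
by rewrite cd !mul0r scale0r !addr0 scale0r add0r scaleN1r addr0.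
Qed.

(* zc is G normalised; xi is w made orthogonal to G and G1, and normalised. *)
Lemma normal_frame (G G1 : R -> Cvec R n) g2 w (mu cc : R) :
  has_velocity G 0 (G1 0) -> has_velocity G1 0 g2 ->
  hdot (G 0) (G 0) = 1 -> hdot (G1 0) (G 0) = 0 -> hdot (G1 0) (G1 0) = cc%:C ->
  cc != 0 -> hdot w (G 0) = 0 -> hdot w (G1 0) = 0 -> hdot w w = 1 ->
  hdot w g2 = mu%:C ->
  exists zc xi : R -> Cvec R n,
   [/\ zc 0 = G 0 /\ xi 0 = w, has_velocity zc 0 (G1 0),
      has_velocity xi 0 ((- (mu / cc))%:C *: G1 0) &
      \forall t \near (0 : R), [/\ hdot (zc t) (zc t) = 1, hdot (xi t) (xi t) = 1,
        hdot (xi t) (G t) = 0, hdot (xi t) (G1 t) = 0 &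
        exists a : R[i], zc t = a *: G t]].
Proof.
move=> vG vG1 G0 G10 G11 cc0 wG wG1 ww wg2.
have wo (x y : Cvec R n) : hdot x y = 0 -> hdot y x = 0.
  by move=> h; rewrite hdotC h rmorph0.
have c0 : hdot (G1 0) (G1 0) != 0.
  by rewrite G11 -(rmorph0 (real_complex R)) (inj_eq (@complexI R)).
have G0n : hdot (G 0) (G 0) != 0 by rewrite G0 oner_neq0.
(* [G1] is first made orthogonal to [G]; then removing the component along [Q] keeps vectors
   orthogonal to [G]. *)
pose Q x := rejection (G1 x) (G x).
have Q0 : Q 0 = G1 0 by rewrite /Q rejection_id.
have vQ := has_velocity_rejection vG1 vG G0n G10; rewrite -/Q in vQ.
pose Y x := rejection w (G x).
have Y0 : Y 0 = w by rewrite /Y rejection_id.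
have vY : has_velocity Y 0 0.
  have := has_velocity_rejection (has_velocity_cst w 0) vG G0n wG.
  by rewrite hdot0l wG1 addr0 mul0r scale0r subr0.
pose X x := rejection (Y x) (Q x).
have Qn : hdot (Q 0) (Q 0) != 0 by rewrite Q0.
have YQ : hdot (Y 0) (Q 0) = 0 by rewrite Y0 Q0.
have X0 : X 0 = w by rewrite /X rejection_id // Y0.
(* At 0 the vector [w] is orthogonal to [Q], so only the derivative of [hdot (Y x) (Q x)] matters.
   It equals [hdot w g2], because [Y] is stationary and [w] is orthogonal to the correction along
   [G]. *)
have vX : has_velocity X 0 ((- (mu / cc))%:C *: G1 0).
  have wQ (a : R[i]) : hdot w (g2 - a *: G 0) = mu%:C.
    by rewrite -scaleNr hdotDr wg2 hdotZr wG mulr0 addr0.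
  have := has_velocity_rejection vY vQ Qn YQ.
  move=> /has_velocity_eq; apply; rewrite hdot0l Y0 Q0 G11 wQ !add0r -scaleNr.
  by rewrite rmorphN /= rmorphM /= fmorphV.
have vX0 : hdot ((- (mu / cc))%:C *: G1 0) (X 0) = 0.
  by rewrite X0 hdotZl (wo _ _ wG1) mulr0.
exists (fun x => unitize (G x)), (fun x => unitize (X x)); split.
- by rewrite X0 !unitize_id.
- exact: has_velocity_unitize.
- by apply: has_velocity_unitize => //; rewrite X0.
have nX : hdot (X 0) (X 0) != 0 by rewrite X0 ww oner_neq0.
have nG := cvel_neq0 (cvel_hdot vG vG) G0n.
have nQ := cvel_neq0 (cvel_hdot vQ vQ) Qn.
have {}nX := cvel_neq0 (cvel_hdot vX vX) nX.
apply: filterS3 nG nQ nX => t tG tQ tX.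
have YG : hdot (Y t) (G t) = 0 by exact: hdot_rejection.
have QG : hdot (Q t) (G t) = 0 by exact: hdot_rejection.
have XG : hdot (X t) (G t) = 0 by exact: rejection_orth.
have XQ : hdot (X t) (Q t) = 0 by exact: hdot_rejection.
have XG1 : hdot (X t) (G1 t) = 0.
  have -> : G1 t = Q t + (hdot (G1 t) (G t) / hdot (G t) (G t)) *: G t by rewrite /Q /rejection subrK.
  by rewrite hdotDr hdotZr XQ XG mulr0 addr0.
split; first exact: hdot_unitize.
- exact: hdot_unitize.
- by rewrite /unitize hdotZl XG mulr0.
- by rewrite /unitize hdotZl XG1 mulr0.
by exists ((Num.sqrt (hnorm2 (G t)))^-1)%:C.
Qed.

Lemma hdot_gauge (a : R[i]) z v : hdot z z != 0 ->
  hdot (a *: v + (- (a * (hdot v z / hdot z z))) *: z) (a *: z) = 0.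
Proof.
move=> z0; rewrite hdotDl !hdotZl !hdotZr.
by move: (hdot v z) (hdot z z) z0 => x y y0; field.
Qed.

Lemma Re_jN_gauge (k : R) (h1 : R[i]) f f1 g g1 :
  g = k%:C *: f -> g1 = k%:C *: f1 + h1 *: f ->
  complex.Re (jN g g1) = k ^+ 4 * complex.Re (jN f f1).
Proof.
move=> -> ->; rewrite jN_gauge [_^*%R]conjc_real -rmorphM -rmorphXn /= -expr2 -exprM.
by case: (jN _ _) => x y /=; ring.
Qed.

Lemma Re_jcurv_gauge (k : R) (h1 h2 : R[i]) f f1 f2 g g1 g2 :
  g = k%:C *: f -> g1 = k%:C *: f1 + h1 *: f ->
  g2 = k%:C *: f2 + (2 * h1) *: f1 + h2 *: f ->
  complex.Re (jcurv g g1 g2) = k ^+ 8 * complex.Re (jcurv f f1 f2).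
Proof.
move=> -> -> ->; rewrite jcurv_gauge [_^*%R]conjc_real -rmorphM -rmorphXn /= -expr2 -exprM.
by case: (jcurv _ _ _) => x y /=; ring.
Qed.

Lemma jN_gt0 f f1 : jN f f1 != 0 -> 0 < complex.Re (jN f f1).
Proof.
move=> N0; rewrite lt_neqAle jN_ge0 andbT eq_sym.
by apply: contra N0 => /eqP E; rewrite jN_real E.
Qed.

Lemma scaled_lt (k x y a : R) : 0 < k -> k ^+ 2 * a = 1 -> y ^+ 3 < x * a ^+ 2 ->
  (k ^+ 4 * y) ^+ 3 < k ^+ 8 * x.
Proof.
move=> k0 ka h; have -> : x = k ^+ 4 * (x * a ^+ 2).
  by rewrite -[LHS]mulr1 -(expr1n _ 2) -ka; ring.
have -> : (k ^+ 4 * y) ^+ 3 = k ^+ 8 * (k ^+ 4 * y ^+ 3) by ring.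
by rewrite !ltr_pM2l ?exprn_gt0.
Qed.

(** The component [m] of [g2] orthogonal to [g] and [g1] represents the second fundamental form, and
    [jcurv] equals |g1|^2 |m|^2. The assumption then reads |g1|^2 < |m|; take [w] to be [m]
    normalised and [mu] its length. *)
Lemma curvature_normal g g1 g2 : hdot g g = 1 -> hdot g1 g = 0 ->
  0 < hnorm2 g1 -> hnorm2 g1 ^+ 3 < complex.Re (jcurv g g1 g2) ->
  exists w (mu : R), [/\ hdot w g = 0, hdot w g1 = 0, hdot w w = 1,
    hdot w g2 = mu%:C & hnorm2 g1 < mu].
Proof.
move=> gg g1g c0 hJ; have gg1 : hdot g g1 = 0 by rewrite hdotC g1g rmorph0.
have g11 := hdotE g1; set c := hnorm2 g1 in c0 hJ g11 *.
have cn : c%:C != 0 :> R[i] by rewrite -(rmorph0 (real_complex R)) (inj_eq (@complexI R)) gt_eqF.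
pose m := rejection (rejection g2 g) g1.
have mg : hdot m g = 0.
  by apply: rejection_orth => //; apply: hdot_rejection; rewrite gg oner_neq0.
have mg1 : hdot m g1 = 0 by apply: hdot_rejection; rewrite g11.
have mg2 : hdot m g2 = hdot m m.
  rewrite {3}/m /rejection -!scaleNr !hdotDr !hdotZr mg mg1 !mulr0 !addr0.
  by [].
have EJ : jcurv g g1 g2 = c%:C * hdot m m.
  rewrite -mg2 /m /rejection -!scaleNr !(hdotDl, hdotZl).
  rewrite gg g11 gg1 mulr0 addr0.
  rewrite /jcurv /jq /jqc /jN gg g11 g1g gg1.
  move: (hdot g2 g) (hdot g g2) (hdot g2 g1) (hdot g1 g2) (hdot g2 g2) => d d' k k' e.
  by rewrite /GRing.scale /=; field.
have hm : c ^+ 2 < hnorm2 m.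
  move: hJ; rewrite EJ hdotE -rmorphM /= => h.
  by rewrite -(ltr_pM2l c0) -exprS.
have m0 : 0 < hnorm2 m by apply: lt_trans hm; rewrite exprn_gt0.
pose mu := Num.sqrt (hnorm2 m).
have mu0 : 0 < mu by rewrite sqrtr_gt0.
have mu2 : mu ^+ 2 = hnorm2 m by rewrite sqr_sqrtr// ltW.
exists (unitize m), mu; split.
- by rewrite /unitize hdotZl mg mulr0.
- by rewrite /unitize hdotZl mg1 mulr0.
- by apply: hdot_unitize; rewrite hdotE -(rmorph0 (real_complex R)) (inj_eq (@complexI R)) gt_eqF.
- rewrite /unitize -/mu hdotZl mg2 hdotE -rmorphM /= -mu2; congr (_%:C).
  by rewrite expr2 mulKf// gt_eqF.
by rewrite -[_ < _](@ltr_pXn2r _ 2)// ?nnegrE ?(ltW c0) ?(ltW mu0) ?mu2.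
Qed.

Lemma atan_lt_pi4 (x : R) : 0 < x -> x < 1 -> exists r, [/\ 0 < r, r < pi / 4 &
  sin r = x * cos r].
Proof.
move=> x0 x1; exists (atan x); split.
- by rewrite -atan0 lt_atan.
- by rewrite -atan1 lt_atan.
have c0 : cos (atan x) != 0.
  by apply: lt0r_neq0; apply: cos_gt0_pihalf; rewrite atan_gtNpi2 atan_ltpi2.
by rewrite -[X in X * _](atanK x) /tan divfK.
Qed.
End frame.

(** * A large second fundamental form produces a focal point *)

Section focal.
Variables (R : realType) (n : nat) (Gamma : proj_space R 1 -> proj_space R n).
Hypothesis Gamma_hol : holomorphic Gamma.
Hypothesis Gamma_imm : immersion Gamma.
Hypothesis Gamma_homeo :
  forall U, Defs.proj_open U <-> exists2 V, Defs.proj_open V & U = Gamma @^-1` V.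
Local Notation u := (local_expr Gamma).

(* With z' = G' and xi' = - (mu / |G'|^2) G', the point cos r z + sin r xi is
   stationary when tan r = |G'|^2 / mu < 1. *)
Lemma focal_radius_frame j (s : C R) (h h1 : C R -> C R) (G G1 : R -> Cvec R n) g2 w (mu : R) :
  in_chart j (Gamma (param ord0 s)) ->
  (forall t, G t = h (s + t%:C) *: u ord0 j (s + t%:C)) ->
  (forall t, G1 t = h (s + t%:C) *: deriv (u ord0 j) (s + t%:C)
                    + h1 (s + t%:C) *: u ord0 j (s + t%:C)) ->
  has_velocity G 0 (G1 0) -> has_velocity G1 0 g2 ->
  hdot (G 0) (G 0) = 1 -> hdot (G1 0) (G 0) = 0 ->
  0 < hnorm2 (G1 0) -> hdot w (G 0) = 0 -> hdot w (G1 0) = 0 -> hdot w w = 1 ->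
  hdot w g2 = mu%:C -> hnorm2 (G1 0) < mu ->
  exists2 r, r < pi / 4 & focal_radius (range Gamma) r.
Proof.
move=> cj GE G1E vG vG1 G0 G10 c0 wG wG1 ww wg2 cmu.
set c := hnorm2 (G1 0) in c0 cmu.
have mu0 : 0 < mu by exact: lt_trans cmu.
have cn : c != 0 by rewrite gt_eqF.
have [zc [xi [[zc0 xi0] vz vx near_frame]]] :=
  normal_frame vG vG1 G0 G10 (hdotE _) cn wG wG1 ww wg2.
have [r [r0 r4 sr]] : exists r, [/\ 0 < r, r < pi / 4 & sin r = c / mu * cos r].
  by apply: atan_lt_pi4; rewrite ?divr_gt0// ltr_pdivrMr// mul1r.
have near_cj : \forall t \near (0 : R), in_chart j (Gamma (param ord0 (s + t%:C))).
  have /nbhs_complexP[d d0 hd] := near_in_chart Gamma_hol cj.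
  apply/nbhs_realP; exists d => // t; rewrite subr0 => td.
  by apply: hd; rewrite [s + _]addrC addrK normc_real.
(* All complex multiples are included so that the unit vector [xi] and the vector [r%:C *: xi] are
   covered at once. *)
have near_normal : \forall t \near (0 : R),
    (forall a : R[i], normal_vector (range Gamma) (zc t) (a *: xi t)) /\
    is_exp (zc t) (r%:C *: xi t) (arc (zc t) (xi t) r).
  apply: filterS2 near_cj near_frame => t ct [zz xx xG xG1 [a za]].
  set f := u ord0 j (s + t%:C) in GE G1E *.
  have zf : zc t = (a * h (s + t%:C)) *: f by rewrite za GE scalerA.
  have ah : a * h (s + t%:C) != 0.
    apply: contra_eq_neq zz => ah; rewrite zf ah scale0r hdot0l eq_sym.
    exact: oner_neq0.
  have hn : (h (s + t%:C))^*%R != 0.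
    by rewrite conjC_eq0; apply: contra ah => /eqP ->; rewrite mulr0.
  have xf : hdot (xi t) f = 0.
    by move/eqP: xG; rewrite GE hdotZr mulf_eq0 (negPf hn) => /eqP.
  have xfE : hdot (xi t) (u ord0 j (s + t%:C)) = 0 := xf.
  have xf1 : hdot (xi t) (deriv (u ord0 j) (s + t%:C)) = 0.
    move/eqP: xG1; rewrite G1E hdotDr [X in _ + X]hdotZr xfE mulr0 addr0 hdotZr.
    by rewrite mulf_eq0 (negPf hn) => /eqP.
  have xz : hdot (xi t) (zc t) = 0 by rewrite za hdotZr xG mulr0.
  have f0 : f != 0 by exact: local_expr_neq0.
  split; last exact: is_exp_arc.
  move=> b; apply: (normal_vector_curve Gamma_hol Gamma_imm Gamma_homeo ct zz).
  - by rewrite zf ptZ// /f /local_expr pt_aff.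
  - by rewrite hdotZl xz mulr0.
  - by rewrite hdotZl xf mulr0.
  - by rewrite hdotZl xf1 mulr0.
exists r => //; split => //; exists (G 0), w; split => //.
  have [/(_ 1) H _] := nbhs_singleton near_normal.
  by rewrite -zc0 -xi0 -[xi 0]scale1r.
exists zc, (fun t => r%:C *: xi t), (fun t => arc (zc t) (xi t) r).
exists (G1 0), (r%:C *: ((- (mu / c))%:C *: G1 0)), 0; split.
- by rewrite xi0.
- by apply: filterS near_normal => t [H ?]; split.
- split; first exact: vz.
  + have := has_velocityZ (cvel_cst r%:C 0) vx.
    by rewrite scale0r add0r.
  + have := has_velocityD (has_velocityZ (cvel_cst (cos r)%:C 0) vz)
      (has_velocityZ (cvel_cst (sin r)%:C 0) vx).
    move=> /has_velocity_eq; apply; rewrite !scale0r !add0r scalerA -scalerDl -rmorphM -rmorphD /=.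
    rewrite (_ : cos r + sin r * - (mu / c) = 0) ?scale0r// sr.
    by field; rewrite cn gt_eqF.
(* A foot-point velocity along the U(1)-orbit would be a multiple of [G 0]; being orthogonal to
   [G 0] it would vanish, against [0 < hnorm2 (G1 0)]. *)
- move=> [a [Ea _]]; move: c0; rewrite /c.
  suff -> : G1 0 = 0 by rewrite (_ : hnorm2 0 = 0) ?ltxx//; apply/eqP; rewrite hnorm2_eq0.
  move: G10; rewrite Ea hdotZl G0 mulr1 => ->.
  by rewrite scale0r.
by rewrite /hproj hdot0l mul0r scale0r subr0.
Qed.

Lemma curvature_le (s : C R) :
  ((pi / 4)%:E <= min_focal_distance (range Gamma))%E ->
  let f := u ord0 (chart Gamma ord0 s) in
  complex.Re (jcurv (f s) (deriv f s) (deriv (deriv f) s)) * hnorm2 (f s) ^+ 2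
    <= complex.Re (jN (f s) (deriv f s)) ^+ 3.
Proof.
move=> far; cbv zeta; set f := u ord0 (chart Gamma ord0 s); rewrite leNgt; apply/negP => curv.
have cj : in_chart (chart Gamma ord0 s) (Gamma (param ord0 s)) := chartP Gamma ord0 s.
suff [r r4 fr] : exists2 r, r < pi / 4 & focal_radius (range Gamma) r.
  have : (min_focal_distance (range Gamma) <= r%:E)%E by apply: ereal_inf_lbound; exists r.
  by move=> /(le_trans far); rewrite lee_fin leNgt r4.
have [ds ds1 _ _] := nbhs_singleton (near_derivs (near_derivable Gamma_hol cj)).
rewrite -/f in ds ds1.
set f1 := deriv f s in ds1 curv *; set f2 := deriv (deriv f) s in ds1 curv *.
have fs0 : f s != 0 by exact: local_expr_neq0.
have a0 : 0 < hnorm2 (f s) by rewrite hnorm2_gt0.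
pose k := (Num.sqrt (hnorm2 (f s)))^-1.
have k0 : 0 < k by rewrite invr_gt0 sqrtr_gt0.
have k2 : k ^+ 2 * hnorm2 (f s) = 1.
  by rewrite exprVn sqr_sqrtr ?(ltW a0)// mulVf// gt_eqF.
(* An affine factor [h] suffices: its value [k] makes the lift a unit vector at [s], and its slope
   [h1] makes the derivative of the lift orthogonal to the lift there. *)
pose b := hdot f1 (f s) / hdot (f s) (f s).
pose h1 : C R := - (k%:C * b).
pose h (z : C R) : C R := k%:C + (z - s) * h1.
have hs : h s = k%:C by rewrite /h subrr mul0r addr0.
have dh : forall z, is_derive z (1 : C R) h h1.
  move=> z; have D := is_deriveM (is_deriveB (is_derive_id z (1 : C R))
    (is_derive_cst s z (1 : C R))) (is_derive_cst h1 z (1 : C R)).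
  have {}D := is_deriveD (is_derive_cst (k%:C : C R) z (1 : C R)) D.
  apply: (is_derive_eq D).
  by rewrite scaler0 subr0 !add0r /GRing.scale /= mulr1.
pose G t := h (s + t%:C) *: f (s + t%:C).
pose G1 t := h (s + t%:C) *: deriv f (s + t%:C) + h1 *: f (s + t%:C).
have st0 : s + (0 : R)%:C = s by rewrite rmorph0 addr0.
have G0 : G 0 = k%:C *: f s by rewrite /G st0 hs.
have G10 : G1 0 = k%:C *: f1 + h1 *: f s by rewrite /G1 st0 hs.
have vG : has_velocity G 0 (G1 0).
  rewrite G10 -hs; exact: (has_velocity_holomorphic (is_derive_scale (dh s) ds)).
pose g2 := k%:C *: f2 + (2 * h1) *: f1 + 0 *: f s.
have vG1 : has_velocity G1 0 g2.
  have D1 := is_derive_scale (dh s) ds1; rewrite hs in D1.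
  have D2 := is_derive_scale (is_derive_cst h1 s (1 : C R)) ds.
  have vel := has_velocity_holomorphic (is_deriveD D1 D2).
  apply: (has_velocity_eq vel).
  have aux (x y z : Cvec R n) (c d : R[i]) :
      (c *: x + d *: y) + (d *: y + 0 *: z) = c *: x + (2 * d) *: y + 0 *: z.
    by rewrite scale0r !addr0 -addrA -scalerDl -mulr2n mulr_natl.
  exact: aux.
have GG : hdot (G 0) (G 0) = 1.
  rewrite G0 hdotZl hdotZr hdotE [_^*%R]conjc_real -!rmorphM /= mulrA -expr2 k2.
  by [].
have G1G : hdot (G1 0) (G 0) = 0.
  by rewrite G0 G10; apply: hdot_gauge; exact: hdot_local_expr_neq0.
have NE : hnorm2 (G1 0) = k ^+ 4 * complex.Re (jN (f s) f1).
  have := Re_jN_gauge G0 G10; rewrite /jN GG G1G mul1r mul0r subr0 hdotE.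
  by [].
have JE : complex.Re (jcurv (G 0) (G1 0) g2) = k ^+ 8 * complex.Re (jcurv (f s) f1 f2).
  exact: Re_jcurv_gauge G0 G10 (erefl g2).
have N0 : 0 < hnorm2 (G1 0).
  have NN : jN (f s) f1 != 0 := jN_local_expr_neq0 Gamma_hol Gamma_imm cj.
  by rewrite NE; exact: mulr_gt0 (exprn_gt0 4 k0) (jN_gt0 NN).
have curv' : hnorm2 (G1 0) ^+ 3 < complex.Re (jcurv (G 0) (G1 0) g2).
  by rewrite JE NE; exact: scaled_lt k0 k2 curv.
have [w [mu [wG wG1 ww wg2 cmu]]] := curvature_normal GG G1G N0 curv'.
exact (@focal_radius_frame _ s h (fun=> h1) G G1 g2 w mu cj
  (fun=> erefl) (fun=> erefl) vG vG1 GG G1G N0 wG wG1 ww wg2 cmu).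
Qed.
End focal.

(** This is [4 * (n - 1) <= 2 ^ n], with equality at [n = 3]; the strict inequality of the theorem
    comes from [Vol_lt]. *)
Lemma four_pi_le (R : realType) (n : nat) : (3 <= n)%N ->
  4 * pi <= pi * 2 ^+ n / (n%:R - 1) :> R.
Proof.
move=> hn; have n1 : 0 < n%:R - 1 :> R by rewrite subr_gt0 ltr1n (leq_trans _ hn).
rewrite ler_pdivlMr// mulrAC mulrC ler_pM2l ?pi_gt0//.
elim: n hn {n1} => // n IH; rewrite leq_eqVlt => /orP[/eqP <-|hn].
  by rewrite !exprS expr0; lra.
have {}IH := IH hn; rewrite exprS -natr1.
have : 2 <= n%:R :> R by rewrite ler_nat; exact: ltnW hn.
lra.
Qed.

Local Close Scope complex_scope.

Theorem theorem1p4 (R : realType) (n : nat) (hn : (3 <= n)%N)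
    (Gamma : proj_space R 1 -> proj_space R n)
    (Gamma_quadric : forall p, quadric (Gamma p))
    (Gamma_holomorphic : holomorphic Gamma)
    (Gamma_embedding : embedding Gamma)
    (focal : ((pi / 4)%:E <= min_focal_distance (range Gamma))%E) :
  (Vol Gamma < (pi * 2 ^+ n / (n%:R - 1))%:E)%E.
Proof.
have [_ imm homeo] := Gamma_embedding.
have curv s := curvature_le Gamma_holomorphic imm homeo s focal.
apply: lt_le_trans (Vol_lt Gamma_holomorphic imm curv) _.
by rewrite lee_fin; exact: four_pi_le.
Qed.
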